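(* Let $0<m<\infty$ and let $C_*=C_*(m)$ be the sharp constant in the Sz.-Nagy inequality $$\|f\|_{m+1}^{\frac{3(m+1)}{m}}\le C_*\,\|f\|_1^{\frac{m+3}{m}}\,\|f_x\|_2^2\qquad (0\le f\in L^1(\mathbb{R}),\ f_x\in L^2(\mathbb{R})).$$ Then the following statements hold: (i) For $m\neq 3$, the Sz.-Nagy inequality admits a unique optimizer $U_*$ in $\mathcal{Y}_{M,P_*}$. This optimizer is the unique nonnegative, radially decreasing steady state (with mass $M$) of the equation $u_t=-(u u_{xxx})_x-(u(u^m)_x)_x$ on $\mathbb{R}$ with bounded support and zero contact angle. (ii) For $m=3$, the Sz.-Nagy inequality admits infinitely many optimizers in $\mathcal{Y}_{M_c}$. These optimizers are nonnegative, radially decreasing steady states of $u_t=-(u u_{xxx})_x-(u(u^3)_x)_x$ on $\mathbb{R}$ and form a one-parameter family under the mass-invariant scaling $V\mapsto \mu V(\mu\,\cdot)$, $\mu>0$.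
   Context: $\|\cdot\|_p$ is the norm of $L^p(\mathbb{R})$. An optimizer is a nonzero function for which the Sz.-Nagy inequality is an equality. For a given mass $M>0$: $\mathcal{Y}_M=\{u\in L^1(\mathbb{R})\cap H^1(\mathbb{R}): u\ge 0,\ \|u\|_1=M\}$. For $m\ne3$: $\mathcal{Y}_{M,P_*}=\{u\in\mathcal{Y}_M:\|u\|_{m+1}=P_*\}$ with $$P_*=\left(\frac{3(m+1)}{2mC_*M^{\frac{m+3}{m}}}\right)^{\frac{m}{(m+1)(m-3)}}.$$ For $m=3$: $C_*=\frac{9}{4\pi^2}$, $M_c=(2/C_* )^{1/2}$, and $\mathcal{Y}_{M_c}=\{u\in L^1(\mathbb{R})\cap H^1(\mathbb{R}): u\ge 0,\ \|u\|_1=M_c\}$. Steady state: a nonnegative $U_s\in L^1(\mathbb{R})\cap H^1(\mathbb{R})$ such that $U_s(U_s^m)_x\in H^1_{loc}(\mathbb{R})$, $(U_s)_{xxx}\in L^1_{loc}(\mathbb{R})$, and $U_s(U_s)_{xxx}+U_s(U_s^m)_x=0$ in $\mathbb{R}$ in the sense of distributions. Standing assumptions on steady states: $U_s\in C(\mathbb{R})$ and $\int_{\mathbb{R}}U_s\,dx=M$ (with $M=M_c$ in (ii)); with $\Omega=\{x:U_s(x)>0\}$, $U_s=0$ in $\mathbb{R}\setminus\Omega$; if $\Omega$ is unbounded, $U_s$ decays sufficiently fast at infinity; if $\Omega$ is bounded, $\partial\Omega\in C^1$ and $U_s\in C^1(\overline\Omega)$. Radially decreasing means even in $x$ and non-increasing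 in $|x|$. Zero contact angle means that the derivative of $U_s$ vanishes at the endpoints of the support.
   Formalization: Optimizers are treated up to translation (uniqueness, radial decrease and the one-parameter family), since the inequality is translation invariant; in a steady state, the third derivative is taken on {U_s>0}, integrable up to the edges, since on all of R it has Dirac masses there. *)

(* Defs.v *)
From HB Require Import structures.
From mathcomp Require Import all_boot all_order all_algebra.
From mathcomp Require Import all_classical all_reals all_analysis.

Set Implicit Arguments.
Unset Strict Implicit.
Unset Printing Implicit Defensive.

Import Order.TTheory GRing.Theory Num.Theory.
Import numFieldNormedType.Exports.

Local Open Scope classical_set_scope.
Local Open Scope ring_scope.

(* Elements of L^p and H^1 are represented by functions R -> R; statements about
   such functions that should not depend on the representative are stated almost
   everywhere.  Statements about continuous functions are pointwise. *)

Section SobolevSpaces.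
Context {R : realType}.
Local Notation mu := (@lebesgue_measure R).

Definition test_function (D : set R) (phi : R -> R) : Prop :=
  (forall n x, derivable (derive1n n phi) x 1) /\
  exists K : set R, [/\ compact K, K `<=` D & forall x, ~ K x -> phi x = 0].

Definition weak_derivative (D : set R) (n : nat) (u g : R -> R) : Prop :=
  [/\ locally_integrable D u, locally_integrable D g &
      forall phi, test_function D phi ->
        \int[mu]_(x in D) (u x * derive1n n phi x) =
        (-1) ^+ n * \int[mu]_(x in D) (g x * phi x)].

Definition H1 (u : R -> R) : Prop :=
  u \in Lfun mu 2%:E /\
  exists g, weak_derivative setT 1 u g /\ g \in Lfun mu 2%:E.

Definition L2_loc (u : R -> R) : Prop :=
  measurable_fun setT u /\ locally_integrable setT (fun x => u x ^+ 2).

Definition H1_loc (u : R -> R) : Prop :=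
  L2_loc u /\ exists g, weak_derivative setT 1 u g /\ L2_loc g.

End SobolevSpaces.

Section SzNagy.
Context {R : realType}.
Local Notation mu := (@lebesgue_measure R).

Definition sz_nagy_pair (f g : R -> R) : Prop :=
  [/\ f \in Lfun mu 1%E, \forall x \ae mu, 0 <= f x,
      weak_derivative setT 1 f g & g \in Lfun mu 2%:E].

Definition sz_nagy_lhs (m : R) (f : R -> R) : \bar R :=
  ('N[mu]_((m + 1)%:E)[EFin \o f] `^ (3 * (m + 1) / m))%E.

Definition sz_nagy_rhs (m C : R) (f g : R -> R) : \bar R :=
  (C%:E * 'N[mu]_1[EFin \o f] `^ ((m + 3) / m)
        * 'N[mu]_(2%:E)[EFin \o g] ^+ 2)%E.

Definition sz_nagy_inequality (m C : R) : Prop :=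
  forall f g, sz_nagy_pair f g -> (sz_nagy_lhs m f <= sz_nagy_rhs m C f g)%E.

Definition sz_nagy_constant (m : R) : R := inf [set C | sz_nagy_inequality m C].

Definition sz_nagy_optimizer (m : R) (f : R -> R) : Prop :=
  ~ (f = cst 0 %[ae mu]) /\
  exists g, sz_nagy_pair f g /\
    sz_nagy_lhs m f = sz_nagy_rhs m (sz_nagy_constant m) f g.

Definition mass_class (M : R) (u : R -> R) : Prop :=
  [/\ u \in Lfun mu 1%E, H1 u, \forall x \ae mu, 0 <= u x &
      'N[mu]_1[EFin \o u]%E = M%:E].

Definition critical_norm (m M : R) : R :=
  (3 * (m + 1) / (2 * m * sz_nagy_constant m * M `^ ((m + 3) / m)))
    `^ (m / ((m + 1) * (m - 3))).

Definition mass_norm_class (m M : R) (u : R -> R) : Prop :=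
  mass_class M u /\
  'N[mu]_((m + 1)%:E)[EFin \o u]%E = (critical_norm m M)%:E.

Definition critical_mass : R := Num.sqrt (2 / sz_nagy_constant 3).

End SzNagy.

Section SteadyStates.
Context {R : realType}.
Local Notation mu := (@lebesgue_measure R).

Definition positivity_set (U : R -> R) : set R := [set x | 0 < U x].

Definition boundary (A : set R) : set R := closure A `\` A°.

(* In dimension one a C^1 boundary means that, near each boundary point, the set
   is an open half-line: this excludes isolated boundary points with the set on
   both sides as well as accumulation of boundary points. *)
Definition C1_boundary (A : set R) : Prop :=
  forall x, boundary A x ->
    (\forall y \near x, A y <-> x < y) \/ (\forall y \near x, A y <-> y < x).

Definition C1_closure (A : set R) (U : R -> R) : Prop :=
  exists d : R -> R, {within closure A, continuous d} /\
    forall x, A x -> is_derive x 1 U (d x).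

Definition rapid_decay (U : R -> R) : Prop :=
  forall k : nat, (x ^+ k * U x @[x --> +oo] --> (0 : R)) /\
                  (x ^+ k * U x @[x --> -oo] --> (0 : R)).

(* [v] is (U^m)_x on the whole line and [w] is U_xxx on the positivity set.
   A profile with zero contact angle has a second derivative that jumps at the
   edges of its support, so its third distributional derivative on the whole line
   has atoms there and is not a locally integrable function.  The atoms are
   located where the factor U vanishes; hence U_xxx is taken on {U > 0}, where it
   must be locally integrable up to the edges, whereas the equation is tested
   against all of C_c^oo(R).  The values of [w] outside {U > 0} are irrelevant. *)
Definition steady_equation (m : R) (U : R -> R) : Prop :=
  exists v w : R -> R,
    [/\ weak_derivative setT 1 (fun x => U x `^ m) v,
        H1_loc (fun x => U x * v x),
        locally_integrable setT w,
        weak_derivative (positivity_set U) 3 U w &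
        forall phi, test_function setT phi ->
          \int[mu]_(x in setT) ((U x * w x + U x * v x) * phi x) = 0].

Record steady_state (m M : R) (U : R -> R) : Prop := SteadyState {
  steady_ge0 : forall x, 0 <= U x;
  steady_L1 : U \in Lfun mu 1%E;
  steady_H1 : H1 U;
  steady_eq : steady_equation m U;
  steady_continuous : continuous U;
  steady_mass : \int[mu]_(x in setT) U x = M;
  steady_unbounded : ~ bounded_set (positivity_set U) -> rapid_decay U;
  steady_bounded : bounded_set (positivity_set U) ->
    C1_boundary (positivity_set U) /\ C1_closure (positivity_set U) U
}.

Definition radially_decreasing (U : R -> R) : Prop :=
  (forall x, U (- x) = U x) /\ (forall x y, `|x| <= `|y| -> U y <= U x).

Definition bounded_support (U : R -> R) : Prop := bounded_set (positivity_set U).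

(* U vanishes outside its positivity set, so for U in C^1 up to the boundary the
   vanishing of the one-sided derivative from inside is the same as U'(x) = 0. *)
Definition zero_contact_angle (U : R -> R) : Prop :=
  forall x, boundary (positivity_set U) x -> is_derive x 1 U 0.

Definition mass_scaling (k : R) (V : R -> R) : R -> R := fun x => k * V (k * x).

(* The inequality is translation invariant.  Among the optimizers, those centred
   at the origin are selected through their continuous representative. *)
Definition centred_critical_optimizers : set (R -> R) :=
  [set u | [/\ mass_class critical_mass u, sz_nagy_optimizer 3 u,
               continuous u & radially_decreasing u]].

End SteadyStates.

(* Main.v *)
(** The sharp inequality is obtained by calibration, without rearrangement.  Put
    [W s = sqrt (s (1 - s^m))] and let [H' = W], [H 0 = 0].  Dividing a
    nonnegative function by its maximum gives [h <= 1] with [h c = 1], and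
    expanding squares yields, for every [l > 0],
      [int h'^2 + l^2 (int h - int h^(m+1))
         = 4 l H(1) + int_(x < c) (h' - l W(h))^2 + int_(x > c) (h' + l W(h))^2].
    Optimising first over [l] and then over the ratio of [int h] to
    [int h^(m+1)] (Bernoulli's inequality) gives the constant.  In the case of
    equality [h' = l W(h)] on the left and [h' = - l W(h)] on the right of [c];
    the solutions are [phi (l (x - c))], where [phi] is the even inverse of
    [s |-> int_s^1 1 / W], cut open by a plateau at height [1], and the
    Pohozaev identity forces the plateau to be trivial.

    Since [phi'' = (1 - (m + 1) phi^m) / 2] on the support, [U = A phi (k x)]
    satisfies [U'' + U^m = A^m / (m + 1)] there exactly when
    [k^2 = 2 A^(m-1) / (m + 1)], and for [m <> 3] this is also the condition
    [||U||_(m+1) = P_*].  Conversely, on its support a steady state solves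
    [V'' + V^m = alpha] by the du Bois-Reymond lemma; the zero contact angle
    fixes the constant of the first integral, which becomes
    [V' = - k A W (V / A)] on the right half of the support, and uniqueness for
    this equation gives [V = A phi (k x)].  The mass of this profile is a
    constant multiple of [A^((3-m)/2)], so it determines [A] unless [m = 3].
    For [m = 3] the value of the constant comes from [int phi = 2 pi / 3]. *)

Require Import Defs.
From HB Require Import structures.
From mathcomp Require Import all_boot all_order all_algebra.
From mathcomp Require Import all_classical all_reals all_analysis.
From mathcomp Require Import measurable_realfun.
From mathcomp Require Import ring lra.
Set Implicit Arguments.
Unset Strict Implicit.
Unset Printing Implicit Defensive.

Import Order.TTheory GRing.Theory Num.Theory.
Import numFieldNormedType.Exports.

Local Open Scope classical_set_scope.
Local Open Scope ring_scope.

(** * Calculus and integration on the line *)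

(** Three difficulties shape the development. The function classes only know weak derivatives, so
    each member is replaced by a continuous representative that is the integral of its weak
    derivative; the chain rule for [H(h)] must then do without a pointwise derivative of [h]. Next,
    [W] behaves like [sqrt (m (1 - s))] near [1], so [y' = - l W(y)] has many solutions starting at
    the maximum and a solution may rest there: the equation alone cannot exclude a plateau. Equality
    in Bernoulli's inequality can, because it fixes the ratio of [int h] to [int h^(m+1)] at
    [(m + 3) / 3], the Pohozaev ratio of [phi] itself, whereas a plateau of length [d] shifts the
    balance by [- m d]. For steady states the second-order equation excludes the plateau instead.
    Finally, [W] behaves like [sqrt s] near [0], so [1 / W] is integrable and the profile reaches
    zero in finite time with zero slope: this is the source of the bounded support and of the zero
    contact angle. At such an edge [(U^m)_x] is unbounded for small [m], hence a calculus based on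
    integrable rather than bounded derivatives. *)

Lemma sub_count_lt (T : eqType) (s : seq T) (P Q : pred T) (c : T) : c \in s ->
  subpred P Q -> ~~ P c -> Q c -> (count P s < count Q s)%N.
Proof.
move=> + PQ Pc Qc; elim: s => //= y s IHs; rewrite inE => /predU1P[<-|cs].
  by rewrite (negbTE Pc) Qc add0n add1n ltnS; exact: sub_count.
by rewrite -addnS leq_add ?IHs//; case: (P y) (PQ y) => // ->.
Qed.

Section Calculus.
Context {R : realType}.
Implicit Types (f g F G : R -> R) (x y a b c : R).

Lemma is_derive1_add f g x a b : is_derive x 1 f a -> is_derive x 1 g b ->
  is_derive x 1 (fun t => f t + g t) (a + b).
Proof. by move=> fa gb; exact: is_deriveD. Qed.

Lemma is_derive1_sub f g x a b : is_derive x 1 f a -> is_derive x 1 g b ->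
  is_derive x 1 (fun t => f t - g t) (a - b).
Proof. by move=> fa gb; exact: is_deriveB. Qed.

Lemma is_derive1_mul f g x a b : is_derive x 1 f a -> is_derive x 1 g b ->
  is_derive x 1 (fun t => f t * g t) (a * g x + f x * b).
Proof.
move=> fa gb; apply: (is_derive_eq (is_deriveM fa gb)).
by rewrite /GRing.scale /= addrC mulrC.
Qed.

Lemma is_derive1_opp f x a : is_derive x 1 f a ->
  is_derive x 1 (fun t => - f t) (- a).
Proof. by move=> fa; exact: is_deriveN. Qed.

Lemma is_derive1_inv f x a : f x != 0 -> is_derive x 1 f a ->
  is_derive x 1 (fun t => (f t)^-1) (- (f x) ^- 2 * a).
Proof. by move=> fx fa; exact: is_deriveV. Qed.



Lemma is_derive1_mull c f x a : is_derive x 1 f a ->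
  is_derive x 1 (fun t => c * f t) (c * a).
Proof. by move=> fa; exact: is_deriveZ. Qed.

Lemma is_derive1_chain f g x a b : is_derive x 1 f a -> is_derive (f x) 1 g b ->
  is_derive x 1 (fun t => g (f t)) (b * a).
Proof. by move=> fa gb; exact: is_derive1_comp. Qed.

Lemma is_derive1_pow n f x a : is_derive x 1 f a ->
  is_derive x 1 (fun t => f t ^+ n) (n%:R * f x ^+ n.-1 * a).
Proof.
move=> fa; apply: (is_derive1_chain (g := fun y => y ^+ n) fa).
have := derivableP (@exprn_derivable R n (f x) 1).
by rewrite exp_derive /GRing.scale/= mulr1.
Qed.

Lemma is_derive1_affine k c f x a : is_derive (k * x + c) 1 f a ->
  is_derive x 1 (fun t => f (k * t + c)) (k * a).
Proof.
move=> fa; rewrite mulrC; apply: (@is_derive1_chain (fun t => k * t + c)) => //.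
rewrite -[X in is_derive _ _ _ X]addr0 -[X in is_derive _ _ _ (X + _)]mulr1.
by apply: is_derive1_add; exact: is_derive1_mull.
Qed.

Lemma is_derive1_continuous f x a : is_derive x 1 f a -> {for x, continuous f}.
Proof. by move=> fa; apply/differentiable_continuous/derivable1_diffP. Qed.

Lemma continuous_mul f g : continuous f -> continuous g ->
  continuous (fun x => f x * g x).
Proof. by move=> cf cg x; apply: continuousM; [exact: cf|exact: cg]. Qed.

Lemma continuous_add f g : continuous f -> continuous g ->
  continuous (fun x => f x + g x).
Proof. by move=> cf cg x; apply: continuousD; [exact: cf|exact: cg]. Qed.

Lemma continuous_sub f g : continuous f -> continuous g ->
  continuous (fun x => f x - g x).
Proof. by move=> cf cg x; apply: continuousB; [exact: cf|exact: cg]. Qed.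

Lemma continuous_compose f g : continuous f -> continuous g ->
  continuous (fun x => g (f x)).
Proof. by move=> cf cg x; apply: continuous_comp; [exact: cf|exact: cg]. Qed.

Lemma continuous_idfun : continuous (fun x : R => x).
Proof. by move=> x; exact: cvg_id. Qed.

Lemma continuous_cst c : continuous (fun _ : R => c).
Proof. by move=> x; exact: cvg_cst. Qed.

Lemma near_is_derive1 f g x a : (\near x, f x = g x) -> is_derive x 1 f a ->
  is_derive x 1 g a.
Proof. exact: near_eq_is_derive. Qed.

Lemma derive1_is_derive f x a : is_derive x 1 f a -> derive1 f x = a.
Proof. by move=> fa; rewrite derive1E derive_val. Qed.

Lemma derivable_is_derive1 f x : derivable f x 1 -> is_derive x 1 f (derive1 f x).
Proof. by move=> df; rewrite derive1E; exact/derivableP. Qed.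

Lemma within_continuous_segment f a b :
  (forall x, a <= x <= b -> {for x, continuous f}) ->
  {within `[a, b], continuous f}.
Proof.
by move=> cf; apply: continuous_in_subspaceT => x; rewrite inE/= in_itv => /cf.
Qed.

Lemma mean_value f g a b : a < b ->
  (forall x, a < x < b -> is_derive x 1 f (g x)) ->
  (forall x, a <= x <= b -> {for x, continuous f}) ->
  exists2 c, a < c < b & f b - f a = g c * (b - a).
Proof.
move=> ab df cf; have dI x : x \in `]a, b[ -> is_derive x 1 f (g x).
  by rewrite in_itv => /df.
have [c] := MVT ab dI (within_continuous_segment cf).
by rewrite in_itv => abc E; exists c.
Qed.

(** By the mean value theorem each difference quotient at [x] is a value of [g] at an intermediate
    point, so continuity of [g] supplies the missing derivative. It serves at isolated points where
    the formula for the derivative breaks down: the origin for [expinv], the top and the edges of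
    the profile. *)
Lemma is_derive1_removable f g x (e : R) : 0 < e ->
  {for x, continuous f} -> {for x, continuous g} ->
  (forall y : R, y != x -> `|y - x| < e -> is_derive y 1 f (g y)) ->
  is_derive x 1 f (g x).
Proof.
move=> e0 cf cg dfg; apply/is_derive1_caratheodory.
pose h z := if z == x then g x else (f z - f x) / (z - x).
exists h; split; last by rewrite /h eqxx.
  move=> z; rewrite /h; have [->|zx] := eqVneq z x; first by rewrite !subrr mulr0.
  by rewrite divfK// subr_eq0.
have cfe y : `|y - x| < e -> {for y, continuous f}.
  have [->//|yx ye] := eqVneq y x.
  by apply: is_derive1_continuous; exact: dfg.
have mvt z : z != x -> `|z - x| < e ->
    exists2 y, `|y - x| <= `|z - x| & f z - f x = g y * (z - x).
  rewrite neq_lt => /orP[zx|xz]; rewrite ltr_norml => ze.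
    have [y|y yI|y + E] := @mean_value f g z x zx.
    - move=> /andP[zy yx]; apply: dfg; first by rewrite lt_eqF.
      by rewrite ltr_norml; lra.
    - by apply: cfe; rewrite ltr_norml; lra.
    - move=> yI; exists y; last by rewrite -opprB E; ring.
      by rewrite !ltr0_norm; lra.
  have [y|y yI|y + E] := @mean_value f g x z xz.
  - move=> /andP[xy yz]; apply: dfg; first by rewrite gt_eqF.
    by rewrite ltr_norml; lra.
  - by apply: cfe; rewrite ltr_norml; lra.
  - move=> yI; exists y; last by rewrite E.
    by rewrite !gtr0_norm; lra.
apply/cvgrPdist_lt => /= d d0.
have hx : h x = g x by rewrite /h eqxx.
have /cvgrPdist_lt /(_ _ d0) [r /= r0 H] := cg; exists (Num.min r e).
  by rewrite /= lt_min r0.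
move=> z /=; rewrite lt_min distrC => /andP[zr ze].
rewrite hx /h; have [_|zx] := eqVneq z x; first by rewrite subrr normr0.
have [y yz ->] := mvt _ zx ze.
rewrite mulfK ?subr_eq0//; apply: H => /=; rewrite distrC; exact: le_lt_trans zr.
Qed.

End Calculus.

(** * Integral functions and the fundamental theorem with integrable derivatives *)

Section Primitives.
Context {R : realType}.
Local Notation mu := (@lebesgue_measure R).
Implicit Types (f g F G : R -> R) (x y a b c : R).

Definition segment_integrable g := forall a b, mu.-integrable `[a, b] (EFin \o g).

(** No pointwise derivative is claimed: this is how a continuous function with weak derivative [g]
    is handled throughout. *)
Definition primitive f g := forall a b, a <= b ->
  \int[mu]_(t in `[a, b]) g t = f b - f a.

Lemma integrable_Radd (A : set R) f g : measurable A ->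
  mu.-integrable A (EFin \o f) -> mu.-integrable A (EFin \o g) ->
  mu.-integrable A (EFin \o (fun x => f x + g x)).
Proof. by move=> mA iF ig; have := @integrableD _ _ _ mu A mA _ _ iF ig. Qed.

Lemma integrable_Rsub (A : set R) f g : measurable A ->
  mu.-integrable A (EFin \o f) -> mu.-integrable A (EFin \o g) ->
  mu.-integrable A (EFin \o (fun x => f x - g x)).
Proof. by move=> mA iF ig; have := @integrableB _ _ _ mu A mA _ _ iF ig. Qed.

Lemma integrable_Rmull (A : set R) f c : measurable A ->
  mu.-integrable A (EFin \o f) ->
  mu.-integrable A (EFin \o (fun x => c * f x)).
Proof. by move=> mA iF; have := @integrableZl _ _ _ mu A mA c _ iF. Qed.

Lemma integrable_Rnorm (A : set R) f : measurable A ->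
  mu.-integrable A (EFin \o f) -> mu.-integrable A (EFin \o (fun x => `|f x|)).
Proof. by move=> mA iF; have := @integrable_abse _ _ _ mu A _ iF. Qed.

Lemma integrable_Rle (A : set R) f g : measurable A -> measurable_fun A f ->
  (forall x, A x -> `|f x| <= g x) -> mu.-integrable A (EFin \o g) ->
  mu.-integrable A (EFin \o f).
Proof.
move=> mA mf fg ig; apply: (@le_integrable _ _ _ mu A mA _ (EFin \o g)) => //.
  exact/measurable_EFinP.
by move=> x Ax; rewrite /= lee_fin (le_trans (fg _ Ax))// ler_norm.
Qed.

Lemma le_Rintegral_subset (A B : set R) f : measurable A -> measurable B ->
  A `<=` B -> (forall x, B x -> 0 <= f x) -> mu.-integrable B (EFin \o f) ->
  \int[mu]_(x in A) f x <= \int[mu]_(x in B) f x.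
Proof.
move=> mA mB AB f0 iB.
have iA : mu.-integrable A (EFin \o f) by exact: integrableS iB.
apply: fine_le; [exact: integrable_fin_num|exact: integrable_fin_num|].
by apply: ge0_subset_integral => //; have /integrableP[] := iB.
Qed.

Lemma continuous_segment_integrable g : continuous g -> segment_integrable g.
Proof.
move=> cg a b; apply: continuous_compact_integrable; first exact: segment_compact.
exact: continuous_subspaceT.
Qed.

(** Segments suffice: the line is a countable union of them, which gives measurability, and every
    compact set lies in one. *)
Lemma locally_integrable_segment g :
  locally_integrable setT g <-> segment_integrable g.
Proof.
split=> [[mg _ ig] a b|ig].
  apply/integrableP; split.
    by apply/measurable_EFinP; exact: measurable_funTS.
  by apply: ig => //; exact: segment_compact.
have mg : measurable_fun setT g.
  rewrite (_ : setT = \bigcup_(n in @setT nat) `[(- n%:R : R), n%:R]%classic).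
    apply: (measurable_fun_bigcup _ _).2 => // n.
    by have /integrableP[/measurable_EFinP] := ig (- n%:R) n%:R.
  apply/seteqP; split=> // x _; exists (Num.bound `|x|) => //=.
  rewrite in_itv/=; have := archi_boundP (normr_ge0 x); rewrite ltr_norml.
  by move=> /andP[/ltW -> /ltW ->].
split => //; first exact: openT.
move=> K _ cK; have [M [_ /(_ (M + 1))]] := compact_bounded cK.
rewrite ltrDl ltr01 => /(_ erefl) KM.
have /integrableP[_] : mu.-integrable K (EFin \o g); last by [].
apply: (integrableS _ _ _ (ig (- (M + 1)) (M + 1))) => //.
  exact: compact_measurable.
by move=> x /KM /=; rewrite in_itv/= ler_norml.
Qed.

Lemma Rintegral_segment_split g a b c : a <= b -> b <= c ->
  mu.-integrable `[a, c] (EFin \o g) ->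
  \int[mu]_(t in `[a, c]) g t =
  \int[mu]_(t in `[a, b]) g t + \int[mu]_(t in `[b, c]) g t.
Proof.
move=> ab bc ig; apply/eqP; rewrite addrC -subr_eq; apply/eqP.
rewrite Rintegral_itvB ?bnd_simp// Rintegral_itv_obnd_cbnd//.
by apply: integrableS ig => //; apply: subset_itvr; rewrite bnd_simp.
Qed.

Lemma primitive_continuous f g : segment_integrable g -> primitive f g ->
  continuous f.
Proof.
move=> ig pg x.
have xI : x \in `]x - 1, x + 1[ by rewrite in_itv/=; lra.
have ab : x - 1 < x + 1 by lra.
pose P y := f (x - 1) + \int[mu]_(t in `[x - 1, y]) g t.
have PE y : x - 1 <= y -> P y = f y by move=> xy; rewrite /P pg ?subrKC.
have c1 : {within `[x - 1, x + 1], continuous P}.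
  move=> y; apply: cvgD; first exact: cvg_cst.
  by apply: parameterized_integral_continuous => //; exact: ltW.
have /(continuous_within_itvP _ ab)[/(_ _ xI) cx _ _] := c1.
rewrite /continuous_at -PE; last lra.
apply: cvg_trans cx; apply: near_eq_cvg; near=> y; rewrite PE//.
by near: y; exists 1 => //= z /=; rewrite ltr_norml; lra.
Unshelve. all: by end_near. Qed.

Lemma primitive_is_derive f g x : segment_integrable g -> primitive f g ->
  {for x, continuous g} -> is_derive x 1 f (g x).
Proof.
move=> ig pg cx.
have x1 : x < x + 1 by lra.
have xx : x - 1 < x by lra.
have [d1 d2] := continuous_FTC1_closed x1 (ig (x - 1) _) xx cx.
rewrite -d2; apply: (@near_is_derive1 _ (fun y => f (x - 1) + \int[mu]_(t in `[x - 1, y]) g t)).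
  near=> y; rewrite pg ?subrKC//.
  by near: y; exists 1 => //= z /=; rewrite ltr_norml; lra.
rewrite -[X in is_derive _ _ _ X]add0r; apply: is_derive1_add.
exact: derivable_is_derive1.
Unshelve. all: by end_near. Qed.

(** [G] may be unbounded at the endpoints. The integral of [G] up to [x] minus [F x] is continuous
    on the closed segment and has zero derivative inside, hence is constant. *)
Lemma FTC_open F G a b : a <= b -> {within `[a, b], continuous F} ->
  (forall x, a < x < b -> is_derive x 1 F (G x)) ->
  (forall x, a < x < b -> {for x, continuous G}) ->
  mu.-integrable `[a, b] (EFin \o G) ->
  \int[mu]_(t in `[a, b]) G t = F b - F a.
Proof.
rewrite le_eqVlt => /predU1P[<- _ _ _ _|ab cF dF cG iG].
  by rewrite set_itv1 Rintegral_set1 subrr.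
pose P x := \int[mu]_(t in `[a, x]) G t - F x.
have cP : {within `[a, b], continuous P}.
  move=> x; apply: cvgB; last exact: cF.
  by apply: parameterized_integral_continuous => //; exact: ltW.
have dP x : x \in `]a, b[ -> is_derive x 1 P ((fun=> 0) x).
  rewrite in_itv/= => /andP[ax xb].
  have axb : a < x < b by rewrite ax.
  have [d1 d2] := continuous_FTC1_closed xb iG ax (cG x axb).
  rewrite -(subrr (G x)); apply: is_derive1_sub; last exact: dF.
  by rewrite -d2; exact: derivable_is_derive1.
have [c _] := MVT ab dP cP.
rewrite mul0r /P set_itv1 Rintegral_set1 sub0r opprK => /eqP.
by rewrite addrAC subr_eq0 => /eqP H; apply/eqP; rewrite -subr_eq0; apply/eqP; lra.
Qed.

(** The list [s] collects the points where [G] may jump or blow up, such as the edges of the support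
    for [(U^m)_x]. *)
Definition piecewise_C1 (s : seq R) F G :=
  [/\ continuous F,
      forall x, x \notin s -> is_derive x 1 F (G x),
      forall x, x \notin s -> {for x, continuous G} &
      segment_integrable G].

(** Induction on the number of exceptional points strictly inside the interval: cutting at one of
    them turns it into an endpoint and leaves fewer in each half. *)
Lemma piecewise_C1_primitive s F G : piecewise_C1 s F G -> primitive F G.
Proof.
move=> [cF dF cG iG] a b.
have [n] := ubnP (count (fun x => a < x < b) s).
elim: n a b => // n IH a b; rewrite ltnS => sn ab.
have [/hasP[c cs /andP[ac cb]]|] := boolP (has (fun x => a < x < b) s).

  rewrite (@Rintegral_segment_split _ _ c) ?ltW// IH ?ltW//; last first.
    apply: leq_trans sn; apply: (sub_count_lt cs); rewrite ?ac ?ltxx ?andbF//.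
    by move=> z /andP[-> /lt_trans]; exact.
  rewrite IH ?ltW//; first by rewrite addrC subrKA.
  apply: leq_trans sn; apply: (sub_count_lt cs); rewrite ?cb ?ltxx ?ac//.
  by move=> z /andP[/(lt_trans ac) -> ->].
rewrite -all_predC => /allP/= sab.
by apply: FTC_open => // [|x abx|x abx]; [exact: continuous_subspaceT|
  apply: dF|apply: cG]; apply/negP => /sab; rewrite abx.
Qed.

Lemma continuous_bounded_segment f a b : continuous f ->
  [bounded f x | x in `[a, b]%classic].
Proof.
move=> cf; have /compact_bounded[M [_ MB]] : compact (f @` `[a, b]).
  by apply: continuous_compact; [exact: continuous_subspaceT|exact: segment_compact].
by exists M; split; rewrite ?num_real// => r Mr x abx; apply: MB => //; exists x.
Qed.

Lemma segment_integrable_mul g f : segment_integrable g -> continuous f ->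
  segment_integrable (fun x => g x * f x).
Proof.
move=> ig cf a b; apply: (integrableMl _ (ig a b)) => //.
  by apply: measurable_funTS; exact: continuous_measurable_fun.
exact: continuous_bounded_segment.
Qed.

Lemma segment_integrable_add f g : segment_integrable f -> segment_integrable g ->
  segment_integrable (fun x => f x + g x).
Proof.
by move=> iF ig a b; exact: integrable_Radd.
Qed.

Lemma piecewise_C1_mul s F G f g : piecewise_C1 s F G ->
  (forall x, is_derive x 1 f (g x)) -> continuous g ->
  piecewise_C1 s (fun x => F x * f x) (fun x => G x * f x + F x * g x).
Proof.
move=> [cF dF cG iG] df cg.
have cf : continuous f by move=> x; exact: is_derive1_continuous (df x).
split.
- by move=> x; apply: continuousM; [exact: cF|exact: cf].
- by move=> x /dF dFx; exact: is_derive1_mul.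
- move=> x /cG cGx; apply: continuousD; apply: continuousM => //.
  + exact: cf.
  + exact: cF.
  + exact: cg.
- apply: (@segment_integrable_add (fun x => G x * f x)).
    exact: segment_integrable_mul.
  apply: continuous_segment_integrable => x.
  by apply: continuousM; [exact: cF|exact: cg].
Qed.

Lemma Rintegral_support (D : set R) f a b : `[a, b] `<=` D ->
  (forall x, D x -> ~~ (a <= x <= b) -> f x = 0) ->
  \int[mu]_(x in D) f x = \int[mu]_(x in `[a, b]) f x.
Proof.
move=> abD f0; rewrite [LHS]Rintegral_mkcond [RHS]Rintegral_mkcond.
congr Rintegral; apply/funext => x; rewrite !patchE.
case: ifPn => [/set_mem Dx|/negP Dx].
  case: ifPn => // /negP abx; apply: f0 => //.
  by apply/negP => abx'; apply: abx; rewrite inE/= in_itv.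
by case: ifPn => // /set_mem/abD Dx'; exfalso; apply: Dx; rewrite inE.
Qed.

End Primitives.

(** * Test functions and integration by parts *)

Section TestFunctions.
Context {R : realType}.
Local Notation mu := (@lebesgue_measure R).
Implicit Types (f g F G phi : R -> R) (x y a b c : R) (D : set R).

Lemma test_function_is_derive D phi n x : test_function D phi ->
  is_derive x 1 (derive1n n phi) (derive1n n.+1 phi x).
Proof. by move=> [dphi _]; exact: derivable_is_derive1. Qed.

Lemma test_function_continuous D phi n : test_function D phi ->
  continuous (derive1n n phi).
Proof.
by move=> tphi x; exact: is_derive1_continuous (test_function_is_derive n x tphi).
Qed.

Lemma derive1n_near0 phi n x : (\near x, phi x = 0) -> derive1n n phi x = 0.
Proof.
move=> phi0; suff : \near x, derive1n n phi x = 0 by exact: nbhs_singleton.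
elim: n => [//|n /near_join]; apply: filterS => y phi0y.
apply: derive1_is_derive; apply: (@near_is_derive1 _ (cst 0)).
by apply: filterS phi0y => z <-.
Qed.

(** The maximum and the minimum of the compact support are interior points of [D], so there is room
    to enlarge the interval a little; thanks to this margin all derivatives vanish at [a] and [b]
    too. *)
Lemma test_function_support D phi : open D -> D !=set0 ->
  (forall x y z, D x -> D y -> x <= z <= y -> D z) ->
  test_function D phi ->
  exists a b, [/\ a <= b, `[a, b] `<=` D &
    forall n x, ~~ (a < x < b) -> derive1n n phi x = 0].
Proof.
move=> oD [x0 Dx0] convD [dphi [K [cK KD phi0]]].
have [K0|/set0P K0] := eqVneq K set0.
  have phiE : phi = cst 0 by apply/funext => x; apply: phi0; rewrite K0.
  exists x0, x0; split => // [y|n x _].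
    by rewrite /= in_itv/= => xyx; exact: (convD x0 x0).
  by apply: derive1n_near0; near=> y; rewrite phiE.
have cid : {within K, continuous (@id R)}.
  by apply: continuous_subspaceT => x; exact: cvg_id.
have [p Kp pM] := compact_EVT_max K0 cK cid.
have [q Kq qM] := compact_EVT_min K0 cK cid.
have /oD[/= e e0 eD] := KD _ (set_mem Kp).
have /oD[/= d d0 dD] := KD _ (set_mem Kq).
have Db : D (p + e / 2) by apply: eD => /=; rewrite ltr_norml; lra.
have Da : D (q - d / 2) by apply: dD => /=; rewrite ltr_norml; lra.
exists (q - d / 2), (p + e / 2); split => [||n x xab].
- by have := qM _ Kp => /= ?; lra.
- by move=> y; rewrite /= in_itv/=; exact: convD.
- apply: derive1n_near0; move: xab; rewrite negb_and -!leNgt => /orP[] xab.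
    exists (d / 2) => /=; first lra.
    move=> y /=; rewrite ltr_norml => yx; apply: phi0 => Ky.
    by have := qM y (mem_set Ky) => /=; lra.
  exists (e / 2) => /=; first lra.
  move=> y /=; rewrite ltr_norml => yx; apply: phi0 => Ky.
  by have := pM y (mem_set Ky) => /=; lra.
Unshelve. all: by end_near. Qed.

Lemma test_functionT_support D phi : test_function D phi ->
  exists a b, [/\ a <= b &
    forall n x, ~~ (a < x < b) -> derive1n n phi x = 0].
Proof.
move=> [dphi [K [cK KD phi0]]].
have tphi : test_function setT phi by split => //; exists K; split.
have [|//|a [b [? ? ?]]] := test_function_support openT _ _ tphi; last by exists a, b.
by exists 0.
Qed.

(** The product of [F] with a test function is again piecewise C^1 and vanishes at both ends of the
    support, so the integral of its derivative is zero. *)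
Lemma piecewise_C1_weak_derivative s F G : piecewise_C1 s F G ->
  weak_derivative setT 1 F G.
Proof.
move=> pFG; have [cF dF cG iG] := pFG.
split; [exact/locally_integrable_segment/continuous_segment_integrable|
        exact/locally_integrable_segment|move=> phi tphi].
have [a [b [ab phi0]]] := test_functionT_support tphi.
have cphi n : continuous (derive1n n phi) := test_function_continuous tphi.
have pM := piecewise_C1_mul pFG (fun x => test_function_is_derive 0 x tphi) (cphi 1%N).
have := piecewise_C1_primitive pM ab.
rewrite (phi0 0%N a) ?ltxx// (phi0 0%N b) ?ltxx ?andbF// !mulr0 subrr => I0.
have phi0' n x : ~~ (a <= x <= b) -> derive1n n phi x = 0.
  by move=> abx; apply: phi0; apply: contra abx => /andP[/ltW -> /ltW ->].
rewrite (@Rintegral_support _ _ _ a b)//; last first.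
  by move=> x _ /(phi0' 1%N) ->; rewrite mulr0.
rewrite (@Rintegral_support _ _ (fun x => G x * phi x) a b)//; last first.
  by move=> x _ /(phi0' 0%N) /= ->; rewrite mulr0.
rewrite expr1 mulN1r; apply/eqP; rewrite -addr_eq0 addrC -RintegralD//.
- by rewrite I0.
- by apply: segment_integrable_mul => //; exact: (cphi 0%N).
- by apply: continuous_segment_integrable => x; apply: continuousM;
    [exact: cF|exact: (cphi 1%N)].
Qed.

End TestFunctions.

Section Antiderivative.
Context {R : realType}.
Local Notation mu := (@lebesgue_measure R).
Implicit Types (f g : R -> R) (x y a b c : R).

(** For [x < c] the set [[c, x]] is empty; the second branch restores the sign of an oriented
    integral. *)
Definition antiderivative c g x : R :=
  if c <= x then \int[mu]_(t in `[c, x]) g t else - \int[mu]_(t in `[x, c]) g t.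

Lemma antiderivative0 c g : antiderivative c g c = 0.
Proof. by rewrite /antiderivative lexx set_itv1 Rintegral_set1. Qed.

Lemma antiderivative_primitive c g : segment_integrable g ->
  primitive (antiderivative c g) g.
Proof.
move=> ig a b ab; rewrite /antiderivative.
have [cb|bc] := leP c b; have [ca|ac] := leP c a.
- by have -> := Rintegral_segment_split ca ab (ig _ _); rewrite addrAC subrr add0r.
- by have -> := Rintegral_segment_split (ltW ac) cb (ig _ _); rewrite opprK addrC.
- by move: bc; rewrite ltNge (le_trans ca ab).
- have -> := Rintegral_segment_split ab (ltW bc) (ig _ _).
  by rewrite opprK addrC addrK.
Qed.

Lemma Rintegral_dominated_cvg (D : set R) (F : nat -> R -> R) f g : measurable D ->
  (forall n, measurable_fun D (F n)) ->
  (forall x, D x -> F n x @[n --> \oo] --> f x) ->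
  mu.-integrable D (EFin \o g) -> (forall n x, D x -> `|F n x| <= g x) ->
  mu.-integrable D (EFin \o f) /\
  \int[mu]_(x in D) F n x @[n --> \oo] --> \int[mu]_(x in D) f x.
Proof.
move=> mD mF Ff ig Fg.
have mf : measurable_fun D f by apply: (measurable_fun_cvg mF) => x Dx; exact: Ff.
have h1 n : measurable_fun D (EFin \o F n) by exact/measurable_EFinP.
have h2 : measurable_fun D (EFin \o f) by exact/measurable_EFinP.
have h3 : {ae mu, forall x, D x -> (EFin \o F n) x @[n --> \oo] --> (EFin \o f) x}.
  by apply/aeW => x Dx; apply: cvg_EFin; [exact: nearW|exact: Ff].
have h4 : {ae mu, forall x n, D x -> (`|(EFin \o F n) x| <= (EFin \o g) x)%E}.
  by apply/aeW => x n Dx; rewrite /= lee_fin Fg.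
have [i _ c] := @dominated_convergence _ _ _ mu D mD (fun n => EFin \o F n)
  (EFin \o f) (EFin \o g) h1 h2 h3 ig h4.
split => //; apply: fine_cvg; rewrite fineK; last exact: integrable_fin_num.
exact: c.
Qed.

End Antiderivative.

(** * A smooth bump and a smooth step *)

Section SmoothStep.
Context {R : realType}.
Local Notation mu := (@lebesgue_measure R).
Implicit Types (f g : R -> R) (x y a b c t : R).

(** This is [n]-fold differentiability, with nothing said about continuity of the last derivative;
    for all [n] together it is smoothness. Peeling off the innermost derivative makes the closure
    properties provable by induction on [n]. *)
Fixpoint Ck n f : Prop :=
  if n is n'.+1 then (forall x, derivable f x 1) /\ Ck n' (derive1 f) else True.

Lemma Ck_derivable f : (forall n, Ck n f) ->
  forall n x, derivable (derive1n n f) x 1.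
Proof.
move=> cf n; elim: n f cf => [|n IH] f cf x; first by have [] := cf 1%N.
by rewrite /derive1n iterSr; apply: IH => n'; have [] := cf n'.+1.
Qed.

Lemma derivable_Ck f n : (forall n x, derivable (derive1n n f) x 1) -> Ck n f.
Proof.
elim: n f => // n IH f df; split; first exact: (df 0%N).
by apply: IH => k x; have := df k.+1 x; rewrite /derive1n iterSr.
Qed.

Lemma CkS n f g : (forall x, is_derive x 1 f (g x)) -> Ck n g -> Ck n.+1 f.
Proof.
move=> fg cg; split; first by move=> x; exact: ex_derive.
by rewrite (_ : derive1 f = g)//; apply/funext => x; exact: derive1_is_derive.
Qed.

Lemma CkSE n f : Ck n.+1 f ->
  (forall x, is_derive x 1 f (derive1 f x)) /\ Ck n (derive1 f).
Proof. by move=> [df ?]; split => // x; exact: derivable_is_derive1. Qed.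

Lemma CkW n f : Ck n.+1 f -> Ck n f.
Proof. by elim: n f => // n IH f [df cf]; split => //; exact: IH. Qed.

Lemma Ck_add n f g : Ck n f -> Ck n g -> Ck n (fun x => f x + g x).
Proof.
elim: n f g => // n IH f g /CkSE[df cf] /CkSE[dg cg].
by apply: (CkS (fun x => is_derive1_add (df x) (dg x))); exact: IH.
Qed.

Lemma Ck_mull n f c : Ck n f -> Ck n (fun x => c * f x).
Proof.
elim: n f => // n IH f /CkSE[df cf].
by apply: (CkS (fun x => is_derive1_mull c (df x))); exact: IH.
Qed.

Lemma Ck_mul n f g : Ck n f -> Ck n g -> Ck n (fun x => f x * g x).
Proof.
elim: n f g => // n IH f g cf cg; have [df cf'] := CkSE cf; have [dg cg'] := CkSE cg.
by apply: (CkS (fun x => is_derive1_mul (df x) (dg x))); apply: Ck_add;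
  apply: IH => //; exact: CkW.
Qed.

Lemma Ck_affine n f k c : Ck n f -> Ck n (fun x => f (k * x + c)).
Proof.
elim: n f => // n IH f /CkSE[df cf].
apply: (CkS (fun x => is_derive1_affine (df (k * x + c)))).
by apply: Ck_mull; exact: IH.
Qed.

(** The factor [t^(-k)] closes the family under differentiation, so all members are smooth by a
    single induction on the order. *)
Definition expinv k t : R := if 0 < t then t^-1 ^+ k * expR (- t^-1) else 0.

Lemma expinv_ge0 k t : 0 <= expinv k t.
Proof.
by rewrite /expinv; case: ifP => // t0; rewrite mulr_ge0 ?expR_ge0// exprn_ge0// invr_ge0 ltW.
Qed.

(** With [y = 1 / t] this is [y^(k+1) <= (k+1)! exp y]. The bound is linear in [t], which yields
    continuity at the origin. *)
Lemma expinv_bound k t : expinv k t <= (k.+1)`!%:R * `|t|.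
Proof.
rewrite /expinv; case: ifPn => [t0|_]; last by rewrite mulr_ge0.
rewrite gtr0_norm// expRN ler_pdivrMr ?expR_gt0//.
have := @expR_ge1Dxn _ t^-1 k; rewrite invr_ge0 ltW// => /(_ erefl) H.
have f0 : (0 : R) < (k.+1)`!%:R by rewrite ltr0n fact_gt0.
have : t^-1 ^+ k.+1 <= (k.+1)`!%:R * expR t^-1.
  by rewrite mulrC -ler_pdivrMr//; apply: le_trans H; rewrite lerDr.
rewrite exprSr ler_pdivrMr// => /le_trans; apply.
by rewrite mulrAC.
Qed.

Lemma expinv_continuous0 k : {for 0, continuous (expinv k)}.
Proof.
have E0 : expinv k 0 = 0 by rewrite /expinv ltxx.
apply/cvgrPdist_le => /= e e0.
have f0 : (0 : R) < (k.+1)`!%:R by rewrite ltr0n fact_gt0.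
exists (e / (k.+1)`!%:R); first by rewrite /= divr_gt0.
move=> t /=; rewrite E0 !sub0r !normrN ltr_pdivlMr// => te.
rewrite ger0_norm ?expinv_ge0//; apply: le_trans (expinv_bound k t) _.
by rewrite mulrC ltW.
Qed.

Lemma is_derive_expinv k t :
  is_derive t 1 (expinv k) (expinv k.+2 t - k%:R * expinv k.+1 t).
Proof.
have neq0 y : y != 0 -> is_derive y 1 (expinv k) (expinv k.+2 y - k%:R * expinv k.+1 y).
  rewrite neq_lt => /orP[y0|y0].
    rewrite /expinv ltNge ltW//= mulr0 subrr; apply: (@near_is_derive1 _ (cst 0)).
    by near=> z; rewrite ltNge ltW//; near: z; exact: lt_nbhsl.
  have dV : is_derive y 1 (fun z : R => z^-1) (- y ^- 2).
    have y0' : y != 0 by rewrite gt_eqF.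
    by have := is_derive1_inv y0' (is_derive_id y (1 : R)); rewrite mulr1.
  apply: (@near_is_derive1 _ (fun z => z^-1 ^+ k * expR (- z^-1))).
    by near=> z; rewrite /expinv ifT//; near: z; exact: open_gt.
  rewrite /expinv y0.
  have dE : is_derive y 1 (fun z => expR (- z^-1)) (expR (- y^-1) * y ^- 2).
    apply: (@is_derive1_chain _ (fun z => - z^-1)) => //.
    by have := is_derive1_opp dV; rewrite opprK.
  have dP : is_derive y 1 (fun z : R => z^-1 ^+ k) (- k%:R * y^-1 ^+ k.+1).
    apply: (is_derive_eq (is_derive1_pow k dV)).
    rewrite -exprVn mulrN mulNr -mulrA -exprD; congr (- _).
    case: k => [|k]; first by rewrite !mul0r.
    by rewrite /= addn2.
  apply: (is_derive_eq (is_derive1_mul dP dE)).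
  by rewrite -exprVn !exprS expr0; ring.
have [->|] := eqVneq t 0; last exact: neq0.
apply: (@is_derive1_removable _ (expinv k) (fun t => expinv k.+2 t - k%:R * expinv k.+1 t) 0 1) => //.
- exact: expinv_continuous0.
- apply: continuousB; first exact: expinv_continuous0.
  by apply: continuousM; [exact: cst_continuous|exact: expinv_continuous0].
- by move=> y + _; exact: neq0.
Unshelve. all: by end_near. Qed.

Lemma expinv_Ck n k : Ck n (expinv k).
Proof.
elim: n k => // n IH k; apply: (CkS (is_derive_expinv k)).
apply: Ck_add => //.
rewrite (_ : (fun _ => _) = fun x => (- k%:R) * expinv k.+1 x).
  exact: Ck_mull.
by apply/funext => x; rewrite mulNr.
Qed.

Definition smooth_bump t : R := expinv 0 t * expinv 0 (- 1 * t + 1).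

Lemma smooth_bump_Ck n : Ck n smooth_bump.
Proof. by apply: Ck_mul; [exact: expinv_Ck|apply: Ck_affine; exact: expinv_Ck]. Qed.

Lemma smooth_bump_continuous : continuous smooth_bump.
Proof. by move=> x; have [/(_ x) d _] := smooth_bump_Ck 1; exact/differentiable_continuous/derivable1_diffP. Qed.

Lemma smooth_bump_ge0 t : 0 <= smooth_bump t.
Proof. by rewrite mulr_ge0 ?expinv_ge0. Qed.

Lemma smooth_bump_le1 t : smooth_bump t <= 1.
Proof.
have e1 s : expinv 0 s <= 1.
  rewrite /expinv; case: ifP => // s0; rewrite expr0 mul1r expR_le1.
  by rewrite oppr_le0 invr_ge0 ltW.
by rewrite mulr_ile1 ?expinv_ge0.
Qed.

Lemma smooth_bump_gt0 t : 0 < t < 1 -> 0 < smooth_bump t.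
Proof.
move=> /andP[t0 t1]; rewrite /smooth_bump /expinv t0 !expr0 !mul1r ifT; last lra.
by rewrite mulr_gt0// expR_gt0.
Qed.

Lemma smooth_bump_eq0 t : ~~ (0 < t < 1) -> smooth_bump t = 0.
Proof.
rewrite /smooth_bump /expinv negb_and => /orP[/negbTE ->|t1]; first by rewrite mul0r.
by rewrite [X in _ * X]ifF ?mulr0//; apply/negbTE; move: t1; rewrite -!leNgt; lra.
Qed.

(** Not normalised: beyond [1] it has the constant value [smooth_step 1 > 0], a factor that is
    carried along and cancelled at the end. *)
Definition smooth_step t : R := antiderivative 0 smooth_bump t.

Lemma is_derive_smooth_step t : is_derive t 1 smooth_step (smooth_bump t).
Proof.
have ib := continuous_segment_integrable smooth_bump_continuous.
apply: primitive_is_derive => //; first exact: antiderivative_primitive.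
exact: smooth_bump_continuous.
Qed.

Lemma smooth_step_Ck n : Ck n smooth_step.
Proof. by apply: CkW; apply: (CkS is_derive_smooth_step); exact: smooth_bump_Ck. Qed.

Lemma smooth_step_continuous : continuous smooth_step.
Proof. by move=> t; exact: is_derive1_continuous (is_derive_smooth_step t). Qed.

Lemma smooth_step_cst a b : a <= b -> (forall t, a < t < b -> ~~ (0 < t < 1)) ->
  smooth_step a = smooth_step b.
Proof.
rewrite le_eqVlt => /predU1P[->//|ab ab0].
have [t _|t _|t /ab0 t0] := mean_value ab (g := smooth_bump) (f := smooth_step).
- exact: is_derive_smooth_step.
- exact: smooth_step_continuous.
- by rewrite smooth_bump_eq0// mul0r => /eqP; rewrite subr_eq0 => /eqP.
Qed.

Lemma smooth_step_le0 t : t <= 0 -> smooth_step t = 0.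
Proof.
move=> t0; rewrite (smooth_step_cst t0); first exact: antiderivative0.
by move=> s; lra.
Qed.

Lemma smooth_step_ge1 t : 1 <= t -> smooth_step t = smooth_step 1.
Proof. by move=> t1; rewrite -(smooth_step_cst t1)// => s; lra. Qed.

Lemma smooth_step1_gt0 : 0 < smooth_step 1.
Proof.
have [t _|t _|t t01] := mean_value (@ltr01 R) (g := smooth_bump) (f := smooth_step).
- exact: is_derive_smooth_step.
- exact: smooth_step_continuous.
- by rewrite (@smooth_step_le0 0)// !subr0 mulr1 => ->; exact: smooth_bump_gt0.
Qed.

Lemma smooth_step_mono a b : a <= b -> smooth_step a <= smooth_step b.
Proof.
rewrite le_eqVlt => /predU1P[->//|ab].
have [t _|t _|t _] := mean_value ab (g := smooth_bump) (f := smooth_step).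
- exact: is_derive_smooth_step.
- exact: smooth_step_continuous.
- by move=> E; rewrite -subr_ge0 E mulr_ge0 ?smooth_bump_ge0 ?subr_ge0 ?ltW.
Qed.

Lemma smooth_step_ge0 t : 0 <= smooth_step t.
Proof.
have [t0|t0] := leP t 0; first by rewrite smooth_step_le0.
by rewrite -(@smooth_step_le0 0)// smooth_step_mono ?ltW.
Qed.

Lemma smooth_step_le t : smooth_step t <= smooth_step 1.
Proof.
have [t0|t0] := leP t 1; first exact: smooth_step_mono.
by rewrite smooth_step_ge1 ?lexx ?ltW.
Qed.

End SmoothStep.

(** * The du Bois-Reymond lemma *)

Section DuBoisReymond.
Context {R : realType}.
Local Notation mu := (@lebesgue_measure R).
Implicit Types (u g f phi : R -> R) (x y z a b c r : R) (D : set R).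

Lemma locally_integrable_sub D u a b : locally_integrable D u ->
  `[a, b] `<=` D -> mu.-integrable `[a, b] (EFin \o u).
Proof.
move=> [mu_ oD iu] abD; apply/integrableP; split.
  by apply/measurable_EFinP; apply: measurable_funS mu_ => //; exact: open_measurable.
by apply: iu => //; exact: segment_compact.
Qed.

(** One-sided Lebesgue points, matching the kernel below, which is supported to the right of [x]. *)
Definition right_lebesgue u x : Prop :=
  r^-1 * \int[mu]_(z in `[x, x + r]) `|u z - u x| @[r --> 0^'+] --> 0.

Lemma Rintegral_cst_segment a b c : a <= b ->
  \int[mu]_(z in `[a, b]) c = c * (b - a).
Proof.
rewrite le_eqVlt => /predU1P[->|ab].
  by rewrite set_itv1 Rintegral_set1 subrr mulr0.
by rewrite Rintegral_cst//= lebesgue_measure_itv/= lte_fin ab.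
Qed.

Lemma integrable_cst_segment a b c : mu.-integrable `[a, b] (EFin \o cst c).
Proof.
by apply: continuous_segment_integrable => x; exact: cst_continuous.
Qed.

Lemma integrable_normB (A : set R) u c : measurable A ->
  mu.-integrable A (EFin \o u) -> mu.-integrable A (EFin \o cst c) ->
  mu.-integrable A (EFin \o (fun z => `|u z - c|)).
Proof.
move=> mA iu ic.
by apply: integrable_Rnorm => //; exact: integrable_Rsub.
Qed.

Lemma continuous_right_lebesgue u x (d : R) : 0 < d ->
  mu.-integrable `[x, x + d] (EFin \o u) -> {for x, continuous u} ->
  right_lebesgue u x.
Proof.
move=> d0 iu cu; apply/cvgrPdist_le => /= e e0.
have /cvgrPdist_le /(_ _ e0) [s /= s0 su] := cu.
near=> r.
have r0 : 0 < r by near: r; exact: nbhs_right_gt.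
have rs : r < s by near: r; exact: nbhs_right_lt.
have rd : r < d by near: r; exact: nbhs_right_lt.
have ir : mu.-integrable `[x, x + r] (EFin \o u).
  by apply: integrableS iu => //; apply: subset_itvl; rewrite bnd_simp lerD2l ltW.
rewrite sub0r normrN ger0_norm; last first.
  by apply: mulr_ge0; [rewrite invr_ge0 ltW|apply: Rintegral_ge0].
rewrite ler_pdivrMl// mulrC -[leRHS](_ : \int[mu]_(z in `[x, x + r]) e = _); last first.
  by rewrite Rintegral_cst_segment ?lerDl ?ltW// (addrC x) addrK.
apply: le_Rintegral => //.
- by apply: integrable_normB => //; exact: integrable_cst_segment.
- exact: integrable_cst_segment.
- move=> z /=; rewrite in_itv/= distrC => /andP[xz zr]; apply: su => /=.
  by rewrite ler0_norm ?subr_le0//; lra.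
Unshelve. all: by end_near. Qed.

(** The segment [[x, x + r]] lies in the ball of radius [2 r], whose measure is [4 r]; the one-sided
    average is therefore at most four times the symmetric one. *)
Lemma lebesgue_pt_right_lebesgue u x : segment_integrable u ->
  lebesgue_pt u x -> right_lebesgue u x.
Proof.
move=> iu /fine_cvgP[fin]; move=> /cvgrPdist_lt H; apply/cvgrPdist_le => /= e e0.
have e4 : 0 < e / 4 by lra.
have [s1 /= s10 fin1] := fin; have [s2 /= s20 H2] := H _ e4.
near=> r.
have r0 : 0 < r by near: r; exact: nbhs_right_gt.
have rs1 : r < s1 / 2 by near: r; apply: nbhs_right_lt; lra.
have rs2 : r < s2 / 2 by near: r; apply: nbhs_right_lt; lra.
have inn a b : mu.-integrable `[a, b] (EFin \o (fun z => `|u z - u x|)).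
  by apply: integrable_normB => //; exact: integrable_cst_segment.
have bI : ball x (2 * r) `<=` `[x - 2 * r, x + 2 * r].
  by move=> z; rewrite ball_itv/= !in_itv/= => /andP[/ltW -> /ltW ->].
have mb : measurable (ball x (2 * r) : set R) by exact: measurable_ball.
have inb : mu.-integrable (ball x (2 * r)) (EFin \o (fun z => `|u z - u x|)).
  by apply: integrableS (inn (x - 2 * r) (x + 2 * r)).
have r2 : 0 < 2 * r by lra.
have f1 : davg u x (2 * r) \is a fin_num.
  by apply: fin1 => //=; rewrite sub0r normrN gtr0_norm//; lra.
have := H2 (2 * r); rewrite /= sub0r normrN gtr0_norm// sub0r normrN => /(_ _ r2).
have dE : davg u x (2 * r) =
    ((4 * r)^-1 * \int[mu]_(z in ball x (2 * r)) `|u z - u x|)%:E.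
  rewrite /davg /iavg lebesgue_measure_ball ?(ltW r2)// inver.
  rewrite gt_eqF//=; last by rewrite mulrn_wgt0.
  rewrite EFinM; congr (_%:E * _)%E; first by congr (_^-1); ring.
  rewrite /Rintegral fineK//; exact: integrable_fin_num.
rewrite dE/= => /(_ ltac:(lra)).
set I1 := Rintegral _ _ _; set I2 := Rintegral _ _ _.
have P1 : 0 <= I1 by apply: Rintegral_ge0.
have P2 : 0 <= I2 by apply: Rintegral_ge0.
have le21 : I2 <= I1.
  by apply: le_Rintegral_subset => // z; rewrite ball_itv/= !in_itv/=; lra.
have r4 : 0 <= (4 * r)^-1 by rewrite invr_ge0; lra.
have r1 : 0 <= r^-1 by rewrite invr_ge0; lra.
rewrite sub0r normrN (ger0_norm (mulr_ge0 r4 P1)) (ger0_norm (mulr_ge0 r1 P2)).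
rewrite ltr_pdivrMl ?ler_pdivrMl//; last lra.
by lra.
Unshelve. all: by end_near. Qed.

(** A smooth ramp from [0] at [x] to [smooth_step 1] at [x + r]. The difference of the ramps at [x]
    and [y] is a multiple of the mollified indicator of [[x, y]]. *)
Definition smear x r z := smooth_step (r^-1 * z + - (r^-1 * x)).

Definition step_kernel x r z := r^-1 * smooth_bump (r^-1 * z + - (r^-1 * x)).

Lemma is_derive_smear x r z : is_derive z 1 (smear x r) (step_kernel x r z).
Proof. by apply: is_derive1_affine; exact: is_derive_smooth_step. Qed.

Lemma smear_Ck n x r : Ck n (smear x r).
Proof. by apply: Ck_affine; exact: smooth_step_Ck. Qed.

Lemma step_kernel_continuous x r : continuous (step_kernel x r).
Proof.
move=> z; apply: is_derive1_continuous.
have [/(_ z) + _] := @Ck_affine _ 1 _ r^-1 (- (r^-1 * x)) (smooth_bump_Ck 1).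
by move=> /derivable_is_derive1/(is_derive1_mull r^-1); exact.
Qed.

Lemma smear_le x r z : 0 < r -> z <= x -> smear x r z = 0.
Proof.
move=> r0 zx; apply: smooth_step_le0; rewrite -mulrBr.
by rewrite mulr_ge0_le0 ?invr_ge0 ?subr_le0// ltW.
Qed.

Lemma smear_ge x r z : 0 < r -> x + r <= z -> smear x r z = smooth_step 1.
Proof.
move=> r0 zx; apply: smooth_step_ge1; rewrite -mulrBr.
by rewrite ler_pdivlMl// mulr1; lra.
Qed.

Lemma step_kernel_out x r z : 0 < r -> ~~ (x <= z <= x + r) -> step_kernel x r z = 0.
Proof.
move=> r0 zx; rewrite /step_kernel smooth_bump_eq0 ?mulr0//; apply: contra zx.
rewrite -mulrBr ltr_pdivrMl// mulr1 pmulr_rgt0 ?invr_gt0//; lra.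
Qed.

Lemma step_kernel_ge0 x r z : 0 < r -> 0 <= step_kernel x r z.
Proof. by move=> r0; rewrite mulr_ge0 ?smooth_bump_ge0// invr_ge0 ltW. Qed.

Lemma step_kernel_le x r z : 0 < r -> step_kernel x r z <= r^-1.
Proof. by move=> r0; rewrite ler_piMr ?smooth_bump_le1// invr_ge0 ltW. Qed.

Lemma integrable_mul_step_kernel u x r a b : mu.-integrable `[a, b] (EFin \o u) ->
  mu.-integrable `[a, b] (EFin \o (fun z => u z * step_kernel x r z)).
Proof.
move=> iu; apply: (integrableMl _ iu) => //.
  by apply: measurable_funTS; apply: continuous_measurable_fun; exact: step_kernel_continuous.
by apply: continuous_bounded_segment; exact: step_kernel_continuous.
Qed.

Lemma Rintegral_step_kernel x r : 0 < r ->
  \int[mu]_(z in `[x, x + r]) step_kernel x r z = smooth_step 1.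
Proof.
move=> r0; transitivity (smear x r (x + r) - smear x r x); last first.
  by rewrite smear_ge// smear_le// subr0.
apply: FTC_open => //; first by rewrite lerDl ltW.
- apply: continuous_subspaceT => z.
  exact: is_derive1_continuous (is_derive_smear _ _ _).
- by move=> z _; exact: is_derive_smear.
- by move=> z _; exact: step_kernel_continuous.
- by apply: continuous_segment_integrable; exact: step_kernel_continuous.
Qed.

(** The kernel has total mass [smooth_step 1] and is bounded by [1 / r], so the error is at most the
    average of [|u - u x|], which tends to zero at a right Lebesgue point. *)
Lemma step_kernel_concentrates u x r : 0 < r ->
  mu.-integrable `[x, x + r] (EFin \o u) ->
  `|\int[mu]_(z in `[x, x + r]) (u z * step_kernel x r z) - u x * smooth_step 1| <=
  r^-1 * \int[mu]_(z in `[x, x + r]) `|u z - u x|.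
Proof.
move=> r0 iu.
have xr : x <= x + r by rewrite lerDl ltW.
have ik : segment_integrable (step_kernel x r).
  by apply: continuous_segment_integrable; exact: step_kernel_continuous.
have <- : \int[mu]_(z in `[x, x + r]) (u x * step_kernel x r z) = u x * smooth_step 1.
  by rewrite RintegralZl// Rintegral_step_kernel.
have iuk := integrable_mul_step_kernel x r iu.
have ick : mu.-integrable `[x, x + r] (EFin \o (fun z => u x * step_kernel x r z)).
  by apply: integrable_mul_step_kernel; exact: integrable_cst_segment.
rewrite -RintegralB//.
have inn : mu.-integrable `[x, x + r] (EFin \o (fun z => `|u z - u x|)).
  by apply: integrable_normB => //; exact: integrable_cst_segment.
rewrite -RintegralZl//.
apply: le_trans (le_normr_Rintegral _ _) _ => //.
  exact: integrable_Rsub.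
apply: le_Rintegral => //.
- by apply: integrable_Rnorm => //; exact: integrable_Rsub.
- exact: integrable_Rmull.
- move=> z _; rewrite -mulrBl normrM mulrC ler_wpM2r// ger0_norm ?step_kernel_ge0//.
  exact: step_kernel_le.
Qed.

Lemma step_kernel_cvg u x (r : nat -> R) : (forall n, 0 < r n) ->
  r n @[n --> \oo] --> 0 ->
  (forall n, mu.-integrable `[x, x + r n] (EFin \o u)) -> right_lebesgue u x ->
  \int[mu]_(z in `[x, x + r n]) (u z * step_kernel x (r n) z) @[n --> \oo] -->
  u x * smooth_step 1.
Proof.
move=> r0 rcv iu /cvg_at_rightP/(_ r (conj r0 rcv)) rx.
apply/cvgrPdist_le => e e0; move/cvgrPdist_le : rx => /(_ e e0).
apply: filterS => n; rewrite sub0r normrN => rx.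
rewrite distrC; apply: le_trans (step_kernel_concentrates (r0 n) (iu n)) _.
by rewrite (le_trans _ rx)// ler_norm.
Qed.

Lemma smear_test_function D x y r : 0 < r -> x <= y -> `[x, y + r] `<=` D ->
  test_function D (fun z => smear x r z + -1 * smear y r z).
Proof.
move=> r0 xy xyD; split.
  apply: Ck_derivable => n; apply: Ck_add; first exact: smear_Ck.
  by apply: Ck_mull; exact: smear_Ck.
exists `[x, y + r]%classic; split => // [|z]; first exact: segment_compact.
rewrite /= in_itv/= => /negP; rewrite negb_and -!ltNge => /orP[zx|yz].
  by rewrite !smear_le ?mulr0 ?addr0//; lra.
by rewrite !smear_ge ?mulN1r ?subrr//; lra.
Qed.

(* Test with mollified indicators of [[x, y]] and let the width tend to [0]. *)
Lemma weak_derivative_increment D u g x y (d : R) : 0 < d -> x <= y ->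
  `[x, y + d] `<=` D -> weak_derivative D 1 u g ->
  right_lebesgue u x -> right_lebesgue u y ->
  u y - u x = \int[mu]_(z in `[x, y]) g z.
Proof.
move=> d0 xy xyD [lu lg wug] rx ry.
pose r (n : nat) := d / n.+1%:R.
have r0 n : 0 < r n by rewrite divr_gt0.
have rd n : r n <= d by rewrite ler_pdivrMr// ler_peMr ?(ltW d0)// ler1n.
have rcv : r n @[n --> \oo] --> 0.
  rewrite -[X in _ --> X](mulr0 d); apply: cvgM; first exact: cvg_cst.
  exact: cvg_harmonic.
pose phi n z := smear x (r n) z + -1 * smear y (r n) z.
have phi1 n z : derive1n 1 (phi n) z = step_kernel x (r n) z + -1 * step_kernel y (r n) z.
  apply: derive1_is_derive; apply: is_derive1_add; first exact: is_derive_smear.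
  by apply: is_derive1_mull; exact: is_derive_smear.
have iu := locally_integrable_sub lu xyD.
have ig := locally_integrable_sub lg xyD.
have iuS a b : x <= a -> b <= y + d -> mu.-integrable `[a, b] (EFin \o u).
  move=> xa by_; apply: integrableS iu => //.
  by apply: subset_itv; rewrite bnd_simp.
have xyrD n : `[x, y + r n] `<=` D.
  apply: subset_trans xyD; apply: subset_itvl.
  by rewrite bnd_simp lerD2l.
pose A n := \int[mu]_(z in `[x, x + r n]) (u z * step_kernel x (r n) z) -
    \int[mu]_(z in `[y, y + r n]) (u z * step_kernel y (r n) z).
have E n : A n = - \int[mu]_(z in `[x, y + d]) (g z * phi n z).
  have := wug (phi n) (smear_test_function (r0 n) xy (xyrD n)).
  rewrite expr1 mulN1r.
  rewrite (@Rintegral_support _ _ _ x (y + d))//; last first.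
    move=> z _ zxy; rewrite phi1 !step_kernel_out// ?mulr0 ?addr0 ?mulr0//.
      by apply: contra zxy; have := rd n; lra.
    by apply: contra zxy; have := rd n; lra.
  rewrite (@Rintegral_support _ _ (fun z => g z * phi n z) x (y + d))//; last first.
    move=> z _; rewrite negb_and -!ltNge => /orP[zx|yz].
      by rewrite /phi !smear_le ?mulr0 ?addr0 ?mulr0//; lra.
    by rewrite /phi !smear_ge ?mulN1r ?subrr ?mulr0//; have := rd n; lra.
  move=> <-.
  have k1 : mu.-integrable `[x, y + d] (EFin \o (fun z => u z * step_kernel x (r n) z)).
    exact: integrable_mul_step_kernel.
  have k2 : mu.-integrable `[x, y + d] (EFin \o (fun z => u z * step_kernel y (r n) z)).
    exact: integrable_mul_step_kernel.
  rewrite /A; transitivity (\int[mu]_(z in `[x, y + d]) (u z * step_kernel x (r n) z) -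
    \int[mu]_(z in `[x, y + d]) (u z * step_kernel y (r n) z)).
    congr (_ - _).
      rewrite [RHS](@Rintegral_support _ _ _ x (x + r n))//.
        by apply: subset_itvl; rewrite bnd_simp lerD.
      by move=> z _ ?; rewrite step_kernel_out ?mulr0.
    rewrite [RHS](@Rintegral_support _ _ _ y (y + r n))//.
      by apply: subset_itv; rewrite bnd_simp ?lerD2l.
    by move=> z _ ?; rewrite step_kernel_out ?mulr0.
  rewrite -RintegralB//; apply: eq_Rintegral => z _.
  by rewrite phi1; ring.
have cL : A n @[n --> \oo] --> u x * smooth_step 1 - u y * smooth_step 1.
  by apply: cvgB; apply: step_kernel_cvg => // n; apply: iuS => //;
    have := rd n; lra.
have cR : \int[mu]_(z in `[x, y + d]) (g z * phi n z) @[n --> \oo] -->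
    smooth_step 1 * \int[mu]_(z in `[x, y]) g z.
  (* The limit of the test functions is half-open: each ramp vanishes at its own starting point, so
     the limit is [0] at [x] and [smooth_step 1] at [y] when [x < y]. *)
  pose h z := if x < z <= y then smooth_step 1 * g z else 0.
  have h1 n : measurable_fun `[x, y + d] (fun z => g z * phi n z).
    apply: measurable_funM; first by have /integrableP[/measurable_EFinP] := ig.
    apply: measurable_funTS; apply: continuous_measurable_fun => z.
    apply: continuousD; last apply: continuousM; [|exact: cst_continuous|];
      exact: is_derive1_continuous (is_derive_smear _ _ _).
  have nr e : 0 < e -> \forall n \near \oo, r n < e.
    move=> e0; move/cvgrPdist_lt : rcv => /(_ e e0); apply: filterS => n.
    by rewrite sub0r normrN gtr0_norm.
  have h2 z : z \in `[x, y + d] -> g z * phi n z @[n --> \oo] --> h z.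
    move=> _; rewrite /h; case: ifPn => [/andP[xz zy]|].
      apply: cvg_near_cst; near=> n.
      rewrite /phi [smear y _ _]smear_le// mulr0 addr0 smear_ge 1?mulrC//.
      have : r n < z - x by near: n; apply: nr; lra.
      by lra.
    rewrite negb_and -!leNgt -ltNge => /orP[zx|yz]; apply: cvg_near_cst; near=> n.
      by rewrite /phi !smear_le ?mulr0 ?addr0 ?mulr0//; lra.
    have rn : r n < z - y by near: n; apply: nr; lra.
    by rewrite /phi !smear_ge ?mulN1r ?subrr ?mulr0//; lra.
  have h3 n z : z \in `[x, y + d] -> `|g z * phi n z| <= smooth_step 1 * `|g z|.
    move=> _; rewrite normrM mulrC ler_wpM2r// ler_norml /phi.
    have := smooth_step_ge0 ((r n)^-1 * z + - ((r n)^-1 * x)).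
    have := smooth_step_ge0 ((r n)^-1 * z + - ((r n)^-1 * y)).
    have := smooth_step_le ((r n)^-1 * z + - ((r n)^-1 * x)).
    have := smooth_step_le ((r n)^-1 * z + - ((r n)^-1 * y)).
    by rewrite -/(smear x (r n) z) -/(smear y (r n) z); lra.
  have h4 : mu.-integrable `[x, y + d] (EFin \o (fun z => smooth_step 1 * `|g z|)).
    by apply: integrable_Rmull => //; exact: integrable_Rnorm.
  have [ih] := Rintegral_dominated_cvg (measurable_itv _) h1 h2 h4 h3.
  rewrite (@Rintegral_support _ `[x, y + d] h x y).
  - have ihS : mu.-integrable `]x, y] (EFin \o h).
      apply: integrableS ih => //; apply: subset_itv; rewrite bnd_simp//; lra.
    rewrite -Rintegral_itv_obnd_cbnd//.
    have -> : \int[mu]_(z in `]x, y]) h z =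
        \int[mu]_(z in `]x, y]) (smooth_step 1 * g z).
      by apply: eq_Rintegral => z; rewrite inE/= in_itv/= /h => ->.
    have igS : mu.-integrable `]x, y] (EFin \o g).
      apply: integrableS ig => //; apply: subset_itv; rewrite bnd_simp//; lra.
    by rewrite RintegralZl// Rintegral_itv_obnd_cbnd.
  - by apply: subset_itvl; rewrite bnd_simp; lra.
  - move=> z _ zxy; rewrite /h ifF//; apply/negbTE; apply: contra zxy.
    by move=> /andP[/ltW -> ->].
have s0 := @smooth_step1_gt0 R.
have cLR : - (smooth_step 1 * \int[mu]_(z in `[x, y]) g z) = u x * smooth_step 1 - u y * smooth_step 1.
  apply: cvg_unique cL => //.
  by rewrite (funext E); exact: cvgN.
apply: (mulfI (lt0r_neq0 s0)); lra.
Unshelve. all: by end_near. Qed.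

End DuBoisReymond.

(** * From almost everywhere to everywhere for continuous functions *)

Section AlmostEverywhere.
Context {R : realType}.
Local Notation mu := (@lebesgue_measure R).
Implicit Types (u g f phi : R -> R) (x y z a b c r : R) (D : set R).

Lemma ae_exists_between (P : R -> Prop) a b : a < b -> (\forall x \ae mu, P x) ->
  exists2 x, a < x < b & P x.
Proof.
move=> ab aeP; apply: contrapT => nex.
have : mu.-negligible `]a, b[%classic.
  apply: negligibleS aeP => x /=; rewrite in_itv/= => xab Px.
  by apply: nex; exists x.
move=> /(negligibleP mu (measurable_itv `]a, b[))/eqP.
by rewrite [X in X == _]lebesgue_measure_itv/= lte_fin ab -EFinD eqe subr_eq0 gt_eqF.
Qed.

Lemma ae_imply (P Q : R -> Prop) : (forall x, P x -> Q x) ->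
  (\forall x \ae mu, P x) -> \forall x \ae mu, Q x.
Proof. by move=> PQ; apply: filterS => //; exact: (ae_filter_ringOfSetsType mu). Qed.

Lemma ae_imply2 (P Q S : R -> Prop) : (forall x, P x -> Q x -> S x) ->
  (\forall x \ae mu, P x) -> (\forall x \ae mu, Q x) -> \forall x \ae mu, S x.
Proof. by move=> PQ; apply: filterS2 => //; exact: (ae_filter_ringOfSetsType mu). Qed.

Lemma continuous_ae_eq f g : continuous f -> continuous g ->
  f = g %[ae mu] -> f = g.
Proof.
move=> cf cg fg; apply/funext => x; apply/eqP; apply: contrapT => /negP fgx.
have : {for x, continuous (fun z => f z - g z)}.
  by apply: continuousB; [exact: cf|exact: cg].
have e0 : 0 < `|f x - g x| by rewrite normr_gt0 subr_eq0.
move=> /cvgrPdist_lt/(_ _ e0)[s /= s0 H].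
have xs : x < x + s by rewrite ltrDl.
have [z xz fgz] := ae_exists_between xs fg.
have := H z; rewrite (fgz I) /= subrr subr0 ltxx ltr_norml => H'.
by suff : false by []; apply: H'; lra.
Qed.

Lemma continuous_ae_ge0 f : continuous f -> (\forall x \ae mu, 0 <= f x) ->
  forall x, 0 <= f x.
Proof.
move=> cf f0 x; rewrite leNgt; apply/negP => fx.
have e0 : 0 < - f x by rewrite oppr_gt0.
have /cvgrPdist_lt/(_ _ e0)[s /= s0 H] := cf x.
have xs : x < x + s by rewrite ltrDl.
have [z xz fz] := ae_exists_between xs f0.
have /= := H z; rewrite !ltr_norml => H'.
by have := H' ltac:(lra); lra.
Qed.

End AlmostEverywhere.

(** * Continuous representatives of weakly differentiable functions *)

Section Representative.
Context {R : realType}.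
Local Notation mu := (@lebesgue_measure R).
Implicit Types (u g f phi h : R -> R) (x y z a b c r : R) (D : set R).

(** Almost every point is a right Lebesgue point. One of them serves as base point, and the
    increment formula from it determines [u] at all the others. *)
Lemma weak_derivative_primitive u g : weak_derivative setT 1 u g ->
  exists f, primitive f g /\ u = f %[ae mu].
Proof.
move=> wug; have [lu lg _] := wug.
have iu := (locally_integrable_segment u).1 lu.
have ig := (locally_integrable_segment g).1 lg.
have aeL : \forall x \ae mu, right_lebesgue u x.
  apply: ae_imply (lebesgue_differentiation lu) => x.
  exact: lebesgue_pt_right_lebesgue.
have [x0 _ Lx0] := ae_exists_between (@ltr01 R) aeL.
have pg := antiderivative_primitive x0 ig.
exists (fun x => u x0 + antiderivative x0 g x); split.
  by move=> a b ab; rewrite pg//; ring.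
apply: ae_imply aeL => x Lx _.
have inc y z : right_lebesgue u y -> right_lebesgue u z -> y <= z ->
    u z - u y = \int[mu]_(t in `[y, z]) g t.
  by move=> Ly Lz yz; apply: (@weak_derivative_increment _ setT _ _ _ _ 1).
have [x0x|/ltW xx0] := leP x0 x.
  have := inc _ _ Lx0 Lx x0x; rewrite (pg _ _ x0x) antiderivative0; lra.
have := inc _ _ Lx Lx0 xx0; rewrite (pg _ _ xx0) antiderivative0; lra.
Qed.

(** The hypothesis makes [h] a weak derivative of the zero function, so [h] integrates to zero over
    every segment. At a right Lebesgue point [|h x|] is then bounded by the averages of [|h - h x|],
    which tend to zero. *)
Lemma ae_eq0_of_test h : locally_integrable setT h ->
  (forall phi, test_function setT phi -> \int[mu]_(x in setT) (h x * phi x) = 0) ->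
  \forall x \ae mu, h x = 0.
Proof.
move=> lh h0.
have ih := (locally_integrable_segment h).1 lh.
have w0 : weak_derivative setT 1 (cst 0) h.
  split => //.
    apply/locally_integrable_segment/continuous_segment_integrable.
    by move=> x; exact: cst_continuous.
  move=> phi tphi; rewrite h0// mulr0.
  under eq_Rintegral do rewrite mul0r.
  by rewrite /Rintegral integral0.
have L0 x : right_lebesgue (cst (0 : R)) x.
  apply: (@continuous_right_lebesgue _ _ _ 1) => //.
    exact: integrable_cst_segment.
  exact: cst_continuous.
have I0 x y : x <= y -> \int[mu]_(z in `[x, y]) h z = 0.
  move=> xy; rewrite -(@weak_derivative_increment _ setT _ _ _ _ 1 _ xy _ w0)//.
  by rewrite subrr.
apply: ae_imply (lebesgue_differentiation lh) => x.
move=> /(lebesgue_pt_right_lebesgue ih) Lx.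
apply/eqP; rewrite -normr_le0; apply/ler_addgt0Pl => e e0; rewrite addr0.
move/cvgrPdist_le : Lx => /(_ e e0) Lx.
have [r [r0]] : exists r, 0 < r /\
    `|0 - r^-1 * \int[mu]_(z in `[x, x + r]) `|h z - h x| | <= e.
  near (0 : R)^'+ => r; exists r; split; last by near: r.
  by near: r; exact: nbhs_right_gt.
rewrite sub0r normrN; apply: le_trans.
have xr : x <= x + r by rewrite lerDl ltW.
rewrite -[leLHS](_ : r^-1 * `|\int[mu]_(z in `[x, x + r]) (h z - h x)| = _); last first.
  rewrite RintegralB//; last exact: integrable_cst_segment.
  rewrite I0// Rintegral_cst_segment// sub0r normrN (_ : x + r - x = r); last ring.
  by rewrite normrM (gtr0_norm r0) mulrC mulfK// gt_eqF.
have ri : 0 < r^-1 by rewrite invr_gt0.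
rewrite [leRHS]normrM [X in _ <= X * _]gtr0_norm// ler_pM2l//.
rewrite [leRHS]ger0_norm; last by apply: Rintegral_ge0.
apply: le_normr_Rintegral => //.
by apply: integrable_Rsub => //; exact: integrable_cst_segment.
Unshelve. all: by end_near. Qed.

End Representative.

(** * Functions with vanishing third distributional derivative on an interval *)

Section ThirdOrder.
Context {R : realType}.
Local Notation mu := (@lebesgue_measure R).
Variables (p q : R).
Hypothesis pq : p < q.
Implicit Types (u g f phi psi eta h : R -> R) (x y z a b c r : R) (k : nat).

Local Notation D := (`]p, q[%classic : set R).
Local Notation test := (test_function D).

Lemma test_itv_support phi : test phi ->
  exists a b, [/\ a <= b, `[a, b] `<=` D &
    forall n x, ~~ (a < x < b) -> derive1n n phi x = 0].
Proof.
apply: test_function_support; first exact: itv_open.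
  by exists ((p + q) / 2); have := pq; rewrite /= in_itv/=; lra.
by move=> x y z; rewrite /= !in_itv/=; lra.
Qed.

Lemma derive1n_lin n f g c : (forall k, Ck k f) -> (forall k, Ck k g) ->
  derive1n n (fun x => f x + c * g x) = fun x => derive1n n f x + c * derive1n n g x.
Proof.
move=> cf cg; elim: n => // n IH; rewrite [LHS]/= -/(derive1n _ _) IH.
apply/funext => x; apply: derive1_is_derive; apply: is_derive1_add.
  by apply: derivable_is_derive1; exact: Ck_derivable.
by apply: is_derive1_mull; apply: derivable_is_derive1; exact: Ck_derivable.
Qed.

Lemma test_Ck phi k : test phi -> Ck k phi.
Proof. by move=> [dphi _]; exact: derivable_Ck. Qed.

Lemma test_lin phi psi c : test phi -> test psi ->
  test (fun x => phi x + c * psi x).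
Proof.
move=> tphi tpsi; split.
  apply: Ck_derivable => n; apply: Ck_add; first exact: test_Ck.
  by apply: Ck_mull; exact: test_Ck.
have [_ [K [cK KD K0]]] := tphi; have [_ [L [cL LD L0]]] := tpsi.
exists (K `|` L); split; [exact: compactU|by rewrite subUset|].
by move=> x /= /not_orP[/K0 -> /L0 ->]; rewrite mulr0 addr0.
Qed.

Lemma test_integrable h phi k : continuous h -> test phi ->
  mu.-integrable D (EFin \o (fun x => h x * derive1n k phi x)).
Proof.
move=> ch tphi; have [a [b [ab abD phi0]]] := test_itv_support tphi.
have ic : segment_integrable (fun x => h x * derive1n k phi x).
  apply: continuous_segment_integrable => x; apply: continuousM; first exact: ch.
  exact: (test_function_continuous tphi).
apply: (@integrable_mkcond _ _ _ mu D _ (measurable_itv _)).2.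
have := (@integrable_mkcond _ _ _ mu _ _ (measurable_itv `[a, b])).1 (ic a b).
apply: (@eq_integrable _ _ _ mu setT) => // x _; rewrite !patchE.
case: ifPn => [/set_mem xab|xab].
  by rewrite mem_set//; exact: abD.
case: ifPn => // _; rewrite /= phi0 ?mulr0//.
move: xab; rewrite notin_setE/= in_itv/= => /negP; apply: contra.
by move=> /andP[/ltW -> /ltW ->].
Qed.

Lemma test_Rintegral_sub k c h g phi : continuous h -> continuous g -> test phi ->
  \int[mu]_(x in D) ((h x - c * g x) * derive1n k phi x) =
  \int[mu]_(x in D) (h x * derive1n k phi x) -
  c * \int[mu]_(x in D) (g x * derive1n k phi x).
Proof.
move=> ch cg tphi; have ih := test_integrable k ch tphi.
have ig := test_integrable k cg tphi.
rewrite -RintegralZl// -RintegralB//; last exact: integrable_Rmull.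
by apply: eq_Rintegral => x _; ring.
Qed.

Lemma test_FTC F G : continuous F -> continuous G ->
  (forall x, is_derive x 1 F (G x)) ->
  (exists a b, [/\ a <= b, `[a, b] `<=` D &
    forall x, ~~ (a < x < b) -> F x = 0 /\ G x = 0]) ->
  \int[mu]_(x in D) G x = 0.
Proof.
move=> cF cG dF [a [b [ab abD FG0]]].
rewrite (Rintegral_support abD); last first.
  move=> x _ xab; apply: (FG0 x _).2; apply: contra xab.
  by move=> /andP[/ltW -> /ltW ->].
transitivity (F b - F a); last first.
  by rewrite (FG0 a _).1 ?ltxx// (FG0 b _).1 ?ltxx ?andbF// subrr.
apply: FTC_open => //.
- exact: continuous_subspaceT.
- by move=> x _; exact: cG.
- exact: continuous_segment_integrable.
Qed.

(** The antiderivative from the left end of the support is zero to the left of it; the zero mean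
    makes it zero to the right as well. *)
Lemma test_primitive psi : test psi -> \int[mu]_(x in D) psi x = 0 ->
  exists2 phi, test phi & derive1 phi = psi.
Proof.
move=> tpsi psi0; have [a [b [ab abD p0]]] := test_itv_support tpsi.
have cpsi : continuous psi := test_function_continuous (n := 0%N) tpsi.
have ip := continuous_segment_integrable cpsi.
have pp := antiderivative_primitive a ip.
have dp x : is_derive x 1 (antiderivative a psi) (psi x).
  by apply: primitive_is_derive => //; exact: cpsi.
have supp x y : (forall t, x < t < y -> ~~ (a < t < b)) ->
    \int[mu]_(t in `[x, y]) psi t = 0.
  move=> xyab; have [xy|yx] := ltP x y; last first.
    by move: yx; rewrite le_eqVlt => /predU1P[->|yx]; rewrite ?set_itv1 ?Rintegral_set1//
      set_itv_ge ?Rintegral_set0// bnd_simp -ltNge.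

  have iS : mu.-integrable `]x, y[ (EFin \o psi).
    by apply: integrableS (ip x y) => //; apply: subset_itv; rewrite bnd_simp.
  rewrite -Rintegral_itv_obnd_cbnd; last first.
    by apply: integrableS (ip x y) => //; apply: subset_itv; rewrite bnd_simp.
  rewrite -Rintegral_itv_bndo_bndc//.
  rewrite -[RHS](_ : \int[mu]_(t in `]x, y[) (0 : R) = 0); last first.
    by rewrite /Rintegral integral0.
  apply: eq_Rintegral => t; rewrite inE/= in_itv/= => txy.
  by apply: (p0 0%N); exact: xyab.
exists (antiderivative a psi); last by apply/funext => x; exact: derive1_is_derive.
split.
  by apply: Ck_derivable => n; apply: CkW; apply: (CkS dp); exact: test_Ck.
exists `[a, b]%classic; split => // [|x]; first exact: segment_compact.
rewrite /= in_itv/= => /negP; rewrite negb_and -!ltNge => /orP[/ltW xa|/ltW bx].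
  have := pp _ _ xa; rewrite supp; last by move=> t; lra.
  by rewrite antiderivative0; lra.
have := pp _ _ bx; rewrite supp; last by move=> t; lra.
have := pp _ _ ab; rewrite antiderivative0 -(Rintegral_support abD) ?psi0.
  by lra.
by move=> t _ tab; apply: (p0 0%N); apply: contra tab => /andP[/ltW -> /ltW ->].
Qed.

(** This moment and the next one are the values of [x] and [x^2] against the derivatives of a test
    function; they tell which multiple of a monomial absorbs the constant produced by
    [test_reduce]. *)
Lemma test_moment1 psi : test psi ->
  \int[mu]_(x in D) (x * derive1n 1 psi x) = - \int[mu]_(x in D) psi x.
Proof.
move=> tpsi; have [a [b [ab abD p0]]] := test_itv_support tpsi.
have c n : continuous (derive1n n psi) := test_function_continuous tpsi.
have i1 := test_integrable 1 (@continuous_idfun R) tpsi.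
have i0 : mu.-integrable D (EFin \o psi).
  have := test_integrable 0 (@cst_continuous R R (1 : R)) tpsi.
  by apply: eq_integrable => // x _ /=; rewrite mul1r.
apply/eqP; rewrite -addr_eq0 -RintegralD//; apply/eqP.
apply: (@test_FTC (fun x => x * psi x)).
- exact: continuous_mul (@continuous_idfun R) (c 0%N).
- apply: continuous_add; last exact: (c 0%N).
  exact: continuous_mul (@continuous_idfun R) (c 1%N).
- move=> x; have d := test_function_is_derive 0 x tpsi.
  apply: (is_derive_eq (is_derive1_mul (is_derive_id x (1 : R)) d)).
  by rewrite mul1r addrC.
- exists a, b; split => // x xab.
  by rewrite (p0 1%N)// (p0 0%N x xab : psi x = 0) mulr0 addr0.
Qed.

Lemma test_moment2 psi : test psi ->
  \int[mu]_(x in D) (x ^+ 2 * derive1n 2 psi x) = 2 * \int[mu]_(x in D) psi x.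
Proof.
move=> tpsi; have [a [b [ab abD p0]]] := test_itv_support tpsi.
have c n : continuous (derive1n n psi) := test_function_continuous tpsi.
have i2 := test_integrable 2 (@exprn_continuous R 2) tpsi.
have i0 : mu.-integrable D (EFin \o psi).
  have := test_integrable 0 (@cst_continuous R R (1 : R)) tpsi.
  by apply: eq_integrable => // x _ /=; rewrite mul1r.
apply/eqP; rewrite -subr_eq0 -RintegralZl// -RintegralB//; last first.
  exact: integrable_Rmull.
apply/eqP.
have c2 : continuous (fun x : R => 2 * x).
  exact: continuous_mul (@continuous_cst R 2) (@continuous_idfun R).
apply: (@test_FTC (fun x => x ^+ 2 * derive1n 1 psi x - (2 * x) * psi x)).
- apply: continuous_sub; last exact: continuous_mul c2 (c 0%N).
  exact: continuous_mul (@exprn_continuous R 2) (c 1%N).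
- apply: continuous_sub; last first.
    exact: continuous_mul (@continuous_cst R 2) (c 0%N).
  exact: continuous_mul (@exprn_continuous R 2) (c 2%N).
- move=> x; have d0 := test_function_is_derive 0 x tpsi.
  have d1 := test_function_is_derive 1 x tpsi.
  have dx := is_derive_id x (1 : R).
  apply: (is_derive_eq (is_derive1_sub (is_derive1_mul (is_derive1_pow 2 dx) d1)
    (is_derive1_mul (is_derive1_mull 2 dx) d0))).
  by rewrite /=; ring.
- exists a, b; split => // x xab.
  by rewrite (p0 1%N)// (p0 2%N)// (p0 0%N x xab : psi x = 0) !mulr0 subrr.
Qed.

Lemma unit_test_function : exists2 eta, test eta & \int[mu]_(x in D) eta x = 1.
Proof.
pose r := (q - p) / 3; have r0 : 0 < r by rewrite /r; have := pq; lra.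
have s0 := @smooth_step1_gt0 R.
have ID : `[p + r, p + r + r] `<=` D.
  by move=> x; rewrite /= !in_itv/= /r; have := pq; lra.
exists (fun x => (smooth_step 1)^-1 * step_kernel (p + r) r x).
  split.
    apply: Ck_derivable => n; apply: Ck_mull; apply: Ck_mull; apply: Ck_affine.
    exact: smooth_bump_Ck.
  exists `[p + r, p + r + r]%classic; split => // [|x]; first exact: segment_compact.
  by rewrite /= in_itv/= => /negP xI; rewrite step_kernel_out ?mulr0.
rewrite (Rintegral_support ID); last first.
  by move=> x _ xI; rewrite step_kernel_out ?mulr0.
rewrite RintegralZl//; last first.
  by apply: continuous_segment_integrable; exact: step_kernel_continuous.
rewrite Rintegral_step_kernel// mulVf// gt_eqF//.
Qed.

(* [psi - (int psi) eta] is the derivative of a test function, for [eta] of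
   integral [1]. *)
Lemma test_reduce k h : continuous h ->
  (forall phi, test phi -> \int[mu]_(x in D) (h x * derive1n k.+1 phi x) = 0) ->
  exists c, forall psi, test psi ->
    \int[mu]_(x in D) (h x * derive1n k psi x) = c * \int[mu]_(x in D) psi x.
Proof.
move=> ch h0; have [eta teta eta1] := unit_test_function.
exists (\int[mu]_(x in D) (h x * derive1n k eta x)) => psi tpsi.
set I := \int[mu]_(x in D) psi x.
have i0 f : test f -> mu.-integrable D (EFin \o f).
  move=> tf; have := test_integrable 0 (@cst_continuous R R (1 : R)) tf.
  by apply: eq_integrable => // x _ /=; rewrite mul1r.
have tl : test (fun x => psi x + (- I) * eta x) by exact: test_lin.
have [|phi tphi dphi] := test_primitive tl.
  rewrite RintegralD//; [|exact: i0|by apply: integrable_Rmull => //; exact: i0].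
  by rewrite RintegralZl// ?eta1 ?mulr1 ?subrr//; exact: i0.
have := h0 _ tphi; rewrite /derive1n iterSr -/(derive1n k _) dphi.
rewrite derive1n_lin; [|by move=> n; exact: test_Ck..].
have ip := test_integrable k ch tpsi; have ie := test_integrable k ch teta.
under eq_Rintegral => x _ do rewrite mulrDr mulrCA.
rewrite RintegralD//; last exact: integrable_Rmull.
by rewrite RintegralZl//; lra.
Qed.

(** The order of the derivative falls by one at each application of [test_reduce], at the price of a
    constant that is absorbed into a monomial. What remains has zero weak first derivative, hence
    constant values. *)
Lemma quadratic_of_test h : continuous h ->
  (forall phi, test phi -> \int[mu]_(x in D) (h x * derive1n 3 phi x) = 0) ->
  exists c0 c1 c2, forall x, p < x < q -> h x = c0 + c1 * x + c2 * x ^+ 2.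
Proof.
move=> ch h0.
have csq c : continuous (fun x : R => c * x ^+ 2).
  exact: continuous_mul (@continuous_cst R c) (@exprn_continuous R 2).
have clin c : continuous (fun x : R => c * x).
  exact: continuous_mul (@continuous_cst R c) (@continuous_idfun R).
have [c2 H2] := test_reduce ch h0.
(* The second moment of a test function is twice its integral, whence the factor [1 / 2]. *)
pose h2 x := h x - (c2 / 2) * x ^+ 2.
have ch2 : continuous h2 by exact: continuous_sub ch (csq _).
have [phi tphi|c1 H1] := @test_reduce 1 h2 ch2.
  rewrite (test_Rintegral_sub _ _ ch (@exprn_continuous R 2) tphi).
  by rewrite H2// test_moment2//; lra.
(* The sign comes from the first moment, which is minus the integral. *)
pose h1 x := h2 x - (- c1) * x.
have ch1 : continuous h1 by exact: continuous_sub ch2 (clin _).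
have w1 : weak_derivative D 1 h1 (cst 0).
  split.
  - apply: open_integrable_locally; first exact: itv_open.
    apply: integrableS (continuous_segment_integrable ch1 p q) => //.
    by apply: subset_itv; rewrite bnd_simp.
  - apply: open_integrable_locally; first exact: itv_open.
    apply: integrableS (integrable_cst_segment p q 0) => //.
    by apply: subset_itv; rewrite bnd_simp.
  - move=> phi tphi.
    rewrite (test_Rintegral_sub _ _ ch2 (@continuous_idfun R) tphi).
    rewrite H1// test_moment1// [X in _ = _ * X](_ : _ = 0); last first.
      by under eq_Rintegral => x _ do rewrite /cst mul0r; rewrite /Rintegral integral0.
    by rewrite mulr0; lra.
have E x y : p < x -> x <= y -> y < q -> h1 x = h1 y.
  move=> px xy yq.
  have dq : 0 < (q - y) / 2 by lra.
  have rl z : right_lebesgue h1 z.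
    apply: (@continuous_right_lebesgue _ _ _ 1) => //.
      exact: continuous_segment_integrable.
    exact: ch1.
  have := @weak_derivative_increment _ D _ _ x y _ dq xy _ w1 (rl x) (rl y).
  have I0 : \int[mu]_(z in `[x, y]) cst (0 : R) z = 0 by rewrite Rintegral_cst_segment ?mul0r.
  rewrite I0 => H; apply/esym/eqP; rewrite -subr_eq0; apply/eqP; apply: H.
  by move=> z; rewrite /= !in_itv/=; lra.
exists (h1 ((p + q) / 2)), (- c1), (c2 / 2) => x /andP[px xq].
have <- : h1 x = h1 ((p + q) / 2).
  have [xm|/ltW mx] := leP x ((p + q) / 2); first by apply: E => //; lra.
  by apply/esym; apply: E => //; lra.
by rewrite /h1 /h2; field.
Qed.

End ThirdOrder.

(** * The profile *)

Section ImproperIntegral.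
Context {R : realType}.
Local Notation mu := (@lebesgue_measure R).
Implicit Types (F G : R -> R) (x y a b c : R).

(** On slightly smaller segments the integral of [|G| = G] is an increment of the bounded function
    [F]; monotone convergence carries the bound to the whole segment. *)
Lemma integrable_ge0_derive F G a b : a < b ->
  {within `[a, b], continuous F} ->
  (forall x, a < x < b -> is_derive x 1 F (G x)) ->
  (forall x, a < x < b -> {for x, continuous G}) ->
  (forall x, a < x < b -> 0 <= G x) ->
  mu.-integrable `[a, b] (EFin \o G).
Proof.
move=> ab cF dF cG G0.
have mG : measurable_fun `]a, b[ G.
  apply: open_continuous_measurable_fun; first exact: itv_open.
  by move=> x /set_mem/=; rewrite in_itv/= => /cG.
apply/integrableP; split.
  by apply/measurable_EFinP; exact: measurable_fun_itv_cc mG.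
pose d := (b - a) / 2.
have [e [dn ndn e_le]] : exists e : nat -> R, [/\ forall n, 0 < e n,
    forall n, e n.+1 <= e n & forall r : R, 0 < r -> exists n, e n <= r].
  have d0 : 0 < d by rewrite /d; lra.
  exists (fun n => d / n.+1%:R); split => [n|n|r r0]; first by rewrite divr_gt0.
    by rewrite ler_pM2l// lef_pV2 ?posrE// ler_nat.
  exists (Num.bound (d / r)); rewrite ler_pdivrMr// mulrC -ler_pdivrMr//.
  apply: (@le_trans _ _ (Num.bound (d / r))%:R); last by rewrite ler_nat.
  by apply/ltW/archi_boundP; rewrite divr_ge0// ltW.
pose A (n : nat) : set R := `[a + e n, b - e n]%classic.
have An n x : A n x -> a < x < b.
  by rewrite /A/= in_itv/=; have := dn n; lra.
have U : \bigcup_n A n = `]a, b[%classic.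
  apply/seteqP; split=> [x [n _ /An]|x]; rewrite /= in_itv//= => abx.
  have r0 : 0 < Num.min (x - a) (b - x) by rewrite lt_min; lra.
  have [n H] := e_le _ r0; exists n => //.
  by rewrite /A/= in_itv/=; move: H; rewrite le_min; lra.
rewrite -integral_itv_obnd_cbnd//; last first.
  apply: measurableT_comp => //; apply/measurable_EFinP.
  exact/measurable_fun_itv_bndo_bndcP.
rewrite -integral_itv_bndo_bndc//; last first.
  by apply: measurableT_comp => //; exact/measurable_EFinP.
have [M MF] : exists M, forall x, a <= x <= b -> `|F x| <= M.
  have /compact_bounded[M [_ MB]] : compact (F @` `[a, b]).
    by apply: continuous_compact => //; exact: segment_compact.
  exists (M + 1) => x abx; apply: MB; first by rewrite ltrDl.
  by exists x.
apply: (@le_lt_trans _ _ (M + M)%:E); last exact: ltry.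
have mA n : measurable (A n) by exact: measurable_itv.
have ndA : nondecreasing_seq A.
  apply/nondecreasing_seqP => n; rewrite subsetEset => x; rewrite /A/= !in_itv/=.
  by have := ndn n; lra.
have mGA n : measurable_fun (A n) (fun x => `|(G x)%:E|%E).
  apply: measurableT_comp => //; apply/measurable_EFinP.
  by apply: measurable_funS mG => // x /An; rewrite /= in_itv.
have nn n x : A n x -> (0 <= `|(G x)%:E|)%E by [].
have cvgI : (\int[mu]_(x in A n) `|(G x)%:E|)%E @[n --> \oo] -->
    (\int[mu]_(x in \bigcup_n A n) `|(G x)%:E|)%E.
  exact: ge0_nondecreasing_set_cvg_integral.
rewrite -U -(cvg_lim _ cvgI)//.
apply: lime_le; first by apply/cvg_ex; eexists; exact: cvgI.
apply: nearW => n.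
have [abn|abn] := leP (a + e n) (b - e n); last first.
  rewrite /A set_itv_ge ?integral_set0 ?lee_fin; last by rewrite bnd_simp -ltNge.
  by have := MF a; have := normr_ge0 (F a); lra.
have cGn : {within A n, continuous G}.
  by apply: within_continuous_segment => x xA; apply: cG; apply: (An n); rewrite /A/= in_itv.
have iGn : mu.-integrable (A n) (EFin \o G).
  by apply: continuous_compact_integrable => //; exact: segment_compact.
have -> : (\int[mu]_(x in A n) `|(G x)%:E|)%E = (\int[mu]_(x in A n) G x)%:E.
  rewrite /Rintegral fineK; last first.
    by apply: integrable_fin_num; [exact: measurable_itv|exact: iGn].
  apply: eq_integral => x /set_mem /An abx.
  by rewrite gee0_abs// lee_fin G0.
have -> : \int[mu]_(x in A n) G x = F (b - e n) - F (a + e n).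
  apply: FTC_open => //.
  - apply: within_continuous_segment => x xA; apply: is_derive1_continuous.
    by apply: dF; apply: (An n); rewrite /A/= in_itv.
  - by move=> x xA; apply: dF; have := dn n; lra.
  - by move=> x xA; apply: cG; have := dn n; lra.
rewrite lee_fin.
have := MF (b - e n); have := MF (a + e n).
rewrite !ler_norml; have := dn n; lra.
Qed.

End ImproperIntegral.

(** * The truncated power and the function W *)

Section PositivePower.
Context {R : realType}.
Variable m : R.
Hypothesis m_gt0 : 0 < m.
Implicit Types (x y s t : R).

(* [powR] takes the value [1] on negative bases; truncating the base makes the
   power continuous on the whole line. *)
Definition pospow s : R := (Num.max s 0) `^ m.

Lemma pospowE s : 0 <= s -> pospow s = s `^ m.
Proof. by move=> s0; rewrite /pospow max_l. Qed.

Lemma pospow_le0 s : s <= 0 -> pospow s = 0.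
Proof. by move=> s0; rewrite /pospow max_r// powR0// gt_eqF. Qed.

Lemma pospow_ge0 s : 0 <= pospow s.
Proof. exact: powR_ge0. Qed.

Lemma pospow1 : pospow 1 = 1.
Proof. by rewrite pospowE// powR1. Qed.

Lemma pospow_mono s t : s <= t -> pospow s <= pospow t.
Proof.
move=> st; have [s0|s0] := leP s 0; first by rewrite pospow_le0// pospow_ge0.
have t0 := lt_le_trans s0 st; rewrite !pospowE ?(ltW s0) ?(ltW t0)//.
by apply: ge0_ler_powR; rewrite ?nnegrE ?(ltW s0) ?(ltW t0) ?(ltW m_gt0).
Qed.

Lemma pospow_lt s t : 0 <= s -> s < t -> pospow s < pospow t.
Proof.
move=> s0 st; rewrite !pospowE//; last exact: le_trans (ltW st).
by apply: gt0_ltr_powR => //; rewrite nnegrE// (le_trans _ (ltW st)).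
Qed.

Lemma is_derive_pospow s : 0 < s -> is_derive s 1 pospow (m * s `^ (m - 1)).
Proof.
move=> s0; apply: (@near_is_derive1 _ (fun z => z `^ m)).
  by near=> z; rewrite pospowE// ltW//; near: z; exact: open_gt.
exact: is_derive1_powR.
Unshelve. all: by end_near. Qed.

Lemma pospow_continuous : continuous pospow.
Proof.
move=> s; have [s0|] := ltP 0 s.
  exact: is_derive1_continuous (is_derive_pospow s0).
rewrite le_eqVlt => /predU1P[->|s0]; last first.
  rewrite /continuous_at [X in _ --> X]pospow_le0 ?ltW//; apply: cvg_near_cst.
  by near=> z; rewrite pospow_le0// ltW//; near: z; exact: lt_nbhsl.
rewrite /continuous_at [X in _ --> X](pospow_le0 (lexx 0)).
apply/cvgrPdist_lt => /= e e0.
have /cvgrPdist_lt/(_ e e0) [r /= r0 H] := powR_cvg0 m_gt0.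
exists r => //= z zr; have [z0|z0] := leP z 0.
  by rewrite pospow_le0// subrr normr0.
by rewrite pospowE ?ltW//; exact: H.
Unshelve. all: by end_near. Qed.

Lemma mul_pospow s : 0 <= s -> s * pospow s = s `^ (m + 1).
Proof.
rewrite le_eqVlt => /predU1P[<-|s0].
  by rewrite mul0r powR0// gt_eqF// addr_gt0.
rewrite pospowE ?ltW// powRD; last by rewrite (gt_eqF s0) implybT.
by rewrite powRr1 ?ltW// mulrC.
Qed.

(** Outside [[0, 1]] the radicand is negative, where [Num.sqrt] returns [0]; so [W] is extended by
    zero and stays continuous. *)
Definition W s : R := Num.sqrt (s * (1 - pospow s)).

Lemma W_continuous : continuous W.
Proof.
move=> s; apply: (continuous_comp (f := fun s => s * (1 - pospow s))); last first.
  exact: sqrt_continuous.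
apply: continuous_mul; first exact: continuous_idfun.
exact: continuous_sub (@continuous_cst R 1) pospow_continuous.
Qed.

Lemma W_ge0 s : 0 <= W s. Proof. exact: sqrtr_ge0. Qed.

Lemma W_sqr s : 0 <= s <= 1 -> W s ^+ 2 = s * (1 - pospow s).
Proof.
move=> /andP[s0 s1]; rewrite sqr_sqrtr// mulr_ge0// subr_ge0 -pospow1.
exact: pospow_mono.
Qed.

Lemma W_gt0 s : 0 < s < 1 -> 0 < W s.
Proof.
move=> /andP[s0 s1]; rewrite sqrtr_gt0 mulr_gt0// subr_gt0 -pospow1.
by apply: pospow_lt => //; exact: ltW.
Qed.

Lemma W_eq0 s : ~~ (0 < s < 1) -> W s = 0.
Proof.
rewrite negb_and -!leNgt => /orP[s0|s1]; apply: ler0_sqrtr.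
  by rewrite pospow_le0// subr0 mulr1.
rewrite mulr_ge0_le0 ?(le_trans ler01 s1)// subr_le0 -pospow1.
exact: pospow_mono.
Qed.

Lemma is_derive_W s : 0 < s < 1 ->
  is_derive s 1 W ((1 - (m + 1) * pospow s) / (2 * W s)).
Proof.
move=> s01; have W0 := W_gt0 s01; have /andP[s0 s1] := s01.
have ds : is_derive (s * (1 - pospow s)) 1 Num.sqrt (2 * W s)^-1.
  by apply: is_derive1_sqrt; rewrite -sqrtr_gt0.
have dp := is_derive_pospow s0.
apply: (is_derive_eq (is_derive1_chain (is_derive1_mul (is_derive_id s (1 : R))
  (is_derive1_sub (is_derive_cst (1 : R) s 1) dp)) ds)).
have E : s * s `^ (m - 1) = pospow s by rewrite pospowE ?mulr_powRB1// ltW.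
rewrite [LHS]mulrC; congr (_ / _).
by rewrite -E /=; ring.
Qed.

(** For [m >= 1] because [s^m <= s]; for [m < 1] because the slope [m x^(m-1)] is at least [m] on
    []0, 1]]. It shows that [W] vanishes no faster than a multiple of [sqrt (1 - s)] at [1]. *)
Lemma pospow_gap : exists2 c, 0 < c & forall s, 0 <= s <= 1 ->
  c * (1 - s) <= 1 - pospow s.
Proof.
exists (Num.min 1 m); first by rewrite lt_min ltr01.
move=> s /andP[s0 s1].
have [m1|m1] := leP 1 m.
  rewrite mul1r lerD2l lerN2.
  have [->|sn0] := eqVneq s 0; first by rewrite pospow_le0.
  by rewrite pospowE// ge1r_powR// lt0r sn0 s0.
move: s1; rewrite le_eqVlt => /predU1P[->|s1].
  by rewrite pospow1 !subrr mulr0.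
have [x x01|x _|x /andP[sx x1]] := @mean_value _ pospow (fun z => m * z `^ (m - 1)) s 1 s1.
- by apply: is_derive_pospow; lra.
- exact: pospow_continuous.
rewrite pospow1 => ->; rewrite ler_pM2r ?subr_gt0// ler_pMr//.
have x0 : 0 < x by lra.
have : x `^ 0 <= x `^ (m - 1) by apply: ger_powR; [rewrite x0 ltW|lra].
by rewrite powRr0.
Qed.

End PositivePower.

(** * The base profile and its derivatives *)

Section BaseProfile.
Context {R : realType}.
Local Notation mu := (@lebesgue_measure R).
Variable m : R.
Hypothesis m_gt0 : 0 < m.
Implicit Types (x y s t : R).
Local Notation W := (W m).
Local Notation pospow := (pospow m).

Lemma integrable_inv_sqrt :
  mu.-integrable `[0, 1] (EFin \o (fun s : R => (Num.sqrt s)^-1)).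
Proof.
apply: (@integrable_ge0_derive _ (fun s => 2 * Num.sqrt s)
  (fun s => (Num.sqrt s)^-1) 0 1 ltr01).
- apply: continuous_subspaceT; apply: continuous_mul; first exact: continuous_cst.
  exact: sqrt_continuous.
- move=> s /andP[s0 s1].
  apply: (is_derive_eq (is_derive1_mull 2 (is_derive1_sqrt s0))).
  by rewrite invfM mulrA divff ?mul1r.
- move=> s /andP[s0 s1]; apply: continuousV; last exact: sqrt_continuous.
  by rewrite gt_eqF// sqrtr_gt0.
- by move=> s _; rewrite invr_ge0 sqrtr_ge0.
Qed.

Lemma integrable_inv_sqrt_onem :
  mu.-integrable `[0, 1] (EFin \o (fun s : R => (Num.sqrt (1 - s))^-1)).
Proof.
have c1 : continuous (fun s : R => Num.sqrt (1 - s)).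
  apply: (@continuous_compose _ (fun s => 1 - s)); last exact: sqrt_continuous.
  exact: continuous_sub (@continuous_cst R 1) (@continuous_idfun R).
apply: (@integrable_ge0_derive _ (fun s => - 2 * Num.sqrt (1 - s))
  (fun s => (Num.sqrt (1 - s))^-1) 0 1 ltr01).
- apply: continuous_subspaceT; apply: continuous_mul => //; exact: continuous_cst.
- move=> s /andP[s0 s1]; have s1' : 0 < 1 - s by lra.
  have d1 := is_derive1_sub (is_derive_cst (1 : R) s 1) (is_derive_id s (1 : R)).
  apply: (is_derive_eq (is_derive1_mull (- 2) (is_derive1_chain d1 (is_derive1_sqrt s1')))).
  have sn0 : Num.sqrt (1 - s) != 0 by rewrite gt_eqF// sqrtr_gt0.
  by field.
- move=> s /andP[s0 s1]; apply: continuousV; last exact: c1.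
  by rewrite gt_eqF// sqrtr_gt0; lra.
- by move=> s _; rewrite invr_ge0 sqrtr_ge0.
Qed.

(** On [[0, 1]] the function is dominated by a multiple of [1 / sqrt s + 1 / sqrt (1 - s)]. Outside
    it is zero, since [W] vanishes there and [0^-1 = 0]. *)
Lemma inv_W_integrable : segment_integrable (fun s => (W s)^-1).
Proof.
have i01 : mu.-integrable `[0, 1] (EFin \o (fun s => (W s)^-1)).
  have [c c0 gap] := pospow_gap m_gt0.
  apply: (@integrable_Rle _ _ _ (fun s => (Num.sqrt c)^-1 *
     ((Num.sqrt s)^-1 + (Num.sqrt (1 - s))^-1))) => //.
  - apply: (@measurable_fun_itv_cc _ _ _ false true).
    apply: open_continuous_measurable_fun; first exact: itv_open.
    move=> s /set_mem/=; rewrite in_itv/= => s01; apply: continuousV.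
      by rewrite gt_eqF// W_gt0.
    exact: W_continuous.
  - move=> s; rewrite /= in_itv/= => s01.
    rewrite ger0_norm ?invr_ge0 ?W_ge0//.
    have rhs0 : 0 <= (Num.sqrt s)^-1 + (Num.sqrt (1 - s))^-1.
      by rewrite addr_ge0 ?invr_ge0 ?sqrtr_ge0.
    have [s01'|ns] := boolP (0 < s < 1); last first.
      by rewrite W_eq0// invr0 mulr_ge0// invr_ge0 sqrtr_ge0.
    have /andP[s0 s1] := s01'.
    have a0 : 0 < Num.sqrt s by rewrite sqrtr_gt0.
    have b0 : 0 < Num.sqrt (1 - s) by rewrite sqrtr_gt0 subr_gt0.
    have d0 : 0 < Num.sqrt c by rewrite sqrtr_gt0.
    set a := Num.sqrt s in a0 *; set b := Num.sqrt (1 - s) in b0 *.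
    set d := Num.sqrt c in d0 *.
    have Wle : d * (a * b) <= W s.
      rewrite /W /a /b /d -(sqrtrM _ (ltW s0)) -(sqrtrM _ (ltW c0)).
      by rewrite ler_wsqrtr// mulrCA ler_wpM2l ?(ltW s0)// gap.
    have a2 : a ^+ 2 = s by rewrite sqr_sqrtr// ltW.
    have b2 : b ^+ 2 = 1 - s by rewrite sqr_sqrtr// subr_ge0 ltW.
    (* From [a^2 + b^2 = 1] with [a, b > 0]; hence [1 / (a b) <= 1 / a + 1 / b], which separates the
       two singularities. *)
    have ab1 : 1 <= a + b by nra.
    apply: (@le_trans _ _ (d * (a * b))^-1).
      by rewrite lef_pV2 ?posrE ?W_gt0// !mulr_gt0.
    rewrite invfM ler_pM2l ?invr_gt0//.
    rewrite invfM -[leLHS]mulr1.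
    have -> : a^-1 + b^-1 = a^-1 * b^-1 * (a + b) by field; rewrite !gt_eqF.
    by rewrite ler_pM2l// mulr_gt0 ?invr_gt0.
  - apply: integrable_Rmull => //; apply: integrable_Radd => //.
      exact: integrable_inv_sqrt.
    exact: integrable_inv_sqrt_onem.
move=> a b; have : mu.-integrable setT (EFin \o (fun s => (W s)^-1)).
  have := (@integrable_mkcond _ _ _ mu _ _ (measurable_itv `[0, 1])).1 i01.
  apply: (@eq_integrable _ _ _ mu setT) => // s _; rewrite patchE.
  case: ifPn => //=; rewrite notin_setE/= in_itv/= => /negP s01.
  rewrite W_eq0 ?invr0//; apply: contra s01.
  by move=> /andP[/ltW -> /ltW ->].
exact: integrableS.
Qed.

(** The time at which the solution of [y' = - W(y)] that leaves height [1] at time zero reaches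
    height [s]. *)
Definition tau s : R := - antiderivative 1 (fun s => (W s)^-1) s.

Lemma tau1 : tau 1 = 0.
Proof. by rewrite /tau antiderivative0 oppr0. Qed.

Lemma tau_continuous : continuous tau.
Proof.
move=> s; apply: continuousN.
apply: primitive_continuous inv_W_integrable _ s.
exact: antiderivative_primitive inv_W_integrable.
Qed.

Lemma is_derive_tau s : 0 < s < 1 -> is_derive s 1 tau (- (W s)^-1).
Proof.
move=> s01; apply: is_derive1_opp.
apply: (primitive_is_derive (g := fun s => (W s)^-1) inv_W_integrable).
  exact: antiderivative_primitive inv_W_integrable.
apply: continuousV; last exact: W_continuous.
by rewrite gt_eqF// W_gt0.
Qed.

Lemma tau_lt s t : 0 <= s -> s < t -> t <= 1 -> tau t < tau s.
Proof.
move=> s0 st t1.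
have [x x01|x _|x x01] := mean_value st (f := tau) (g := fun s => - (W s)^-1).
- by apply: is_derive_tau; lra.
- exact: tau_continuous.
move=> E; rewrite -subr_lt0 E mulNr oppr_lt0 mulr_gt0 ?subr_gt0//.
by rewrite invr_gt0 W_gt0//; lra.
Qed.

(** The time to reach height zero. It is finite because [1 / W] is integrable at [0], and this is
    why the profile has bounded support. *)
Definition half_width : R := tau 0.
Local Notation L := half_width.

Lemma half_width_gt0 : 0 < L.
Proof. by rewrite -tau1; apply: tau_lt. Qed.

(* The even inverse of [tau]; beyond [L] the set is empty and [xget] returns
   its default value [0]. *)
Definition phi x : R := xget 0 [set s | 0 <= s <= 1 /\ tau s = `|x|].

Lemma tau_inj s t : 0 <= s <= 1 -> 0 <= t <= 1 -> tau s = tau t -> s = t.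
Proof.
move=> /andP[s0 s1] /andP[t0 t1] E; have [st|ts|//] := ltgtP s t.
  by have := tau_lt s0 st t1; rewrite E ltxx.
by have := tau_lt t0 ts s1; rewrite E ltxx.
Qed.

Lemma phi_spec x : `|x| <= L -> 0 <= phi x <= 1 /\ tau (phi x) = `|x|.
Proof.
move=> xL; apply: (@xgetPex _ _ [set s | 0 <= s <= 1 /\ tau s = `|x|]).
have [||s] := @IVT R tau 0 1 `|x| ler01.
- by apply: continuous_subspaceT; exact: tau_continuous.
- by rewrite tau1 -/L ge_min le_max normr_ge0 xL orbT.
by rewrite in_itv => s01 ts; exists s.
Qed.

Lemma tauK s : 0 <= s <= 1 -> phi (tau s) = s.
Proof.
move=> s01; have t0 : 0 <= tau s.
  have /andP[s0] := s01; rewrite -tau1 le_eqVlt => /predU1P[->//|s1].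
  by rewrite ltW// tau_lt.
have tL : `|tau s| <= L.
  rewrite ger0_norm// /half_width; have /andP[+ s1] := s01.
  rewrite le_eqVlt => /predU1P[<-//|s0]; rewrite ltW// tau_lt//.
have [p01 pt] := phi_spec tL; apply: tau_inj => //.
by rewrite pt ger0_norm.
Qed.

Lemma phi_even x : phi (- x) = phi x.
Proof. by rewrite /phi normrN. Qed.

Lemma phi_norm x : phi `|x| = phi x.
Proof. by rewrite /phi normr_id. Qed.

Lemma phi_out x : L <= `|x| -> phi x = 0.
Proof.
rewrite le_eqVlt => /predU1P[xL|Lx].
  by rewrite -phi_norm -xL /half_width tauK// lexx ler01.
rewrite /phi xgetPN// => s [/andP[+ s1] ts].
rewrite le_eqVlt => /predU1P[s0|s0].
  by move: Lx; rewrite -ts -s0 /half_width ltxx.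
by have := tau_lt (lexx 0) s0 s1; rewrite ts ltNge ltW.
Qed.

Lemma phi0 : phi 0 = 1.
Proof. by rewrite -tau1 tauK// lexx ler01. Qed.

Lemma phi_01 x : 0 <= phi x <= 1.
Proof.
have [/phi_spec[]//|/ltW/phi_out ->] := leP `|x| L.
by rewrite lexx ler01.
Qed.

Lemma phi_gt0 x : `|x| < L -> 0 < phi x.
Proof.
move=> xL; have [/andP[+ p1] pt] := phi_spec (ltW xL).
rewrite le_eqVlt => /predU1P[p0|//].
by move: xL; rewrite -pt -p0 /half_width !ltxx.
Qed.

Lemma phi_lt1 x : x != 0 -> phi x < 1.
Proof.
move=> x0; have [xL|/phi_out ->//] := ltP `|x| L.
have [/andP[p0 +] pt] := phi_spec (ltW xL).
rewrite le_eqVlt => /predU1P[p1|//].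
by move: x0; rewrite -normr_eq0 -pt p1 tau1 eqxx.
Qed.

(** On [[0, L]] this is the inverse of a continuous injection of a segment; the even extension by
    zero is its composition with [x |-> min |x| L]. *)
Lemma phi_continuous : continuous phi.
Proof.
have L0 := half_width_gt0.
have cL : {within `[0, L], continuous phi}.
  rewrite -[X in `[X, _]]tau1; apply: (segment_can_ge_continuous ler01).
    by apply: continuous_subspaceT; exact: tau_continuous.
  by move=> s; rewrite in_itv; exact: tauK.
pose c x := Num.min `|x| L.
have cc : continuous c.
  move=> x; apply: continuous_min; [exact: norm_continuous|exact: cst_continuous].
have cI x : `[0, L]%classic (c x).
  by rewrite /= in_itv/= /c le_min ge_min lexx orbT normr_ge0 ltW.
have phiE : phi = phi \o c.
  apply/funext => x; rewrite /= /c; have [xL|Lx] := leP `|x| L.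
    by rewrite phi_norm.
  by rewrite phi_out ?(ltW Lx)// phi_out// ger0_norm// ltW.
suff : continuous (phi \o c) by rewrite -phiE.
move=> x.
have /subspace_continuousP/(_ _ (cI x)) H := cL.
move=> P /H; rewrite /= => HP.
have {}HP := cc x _ HP; move: HP; rewrite !nbhs_simpl /=.
by apply: filterS => y /=; apply; exact: cI.
Qed.

(** The branches agree at [0] because [W 1 = 0], and the formula vanishes beyond the edges because
    [W 0 = 0]; so it is continuous on the whole line. *)
Definition dphi x : R := if x <= 0 then W (phi x) else - W (phi x).

Lemma W_phi_continuous : continuous (fun x => W (phi x)).
Proof.
exact: continuous_compose phi_continuous (W_continuous m_gt0).
Qed.

Lemma W1 : W 1 = 0. Proof. by rewrite W_eq0// ltxx andbF. Qed.
Lemma W0 : W 0 = 0. Proof. by rewrite W_eq0// ltxx. Qed.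

Lemma dphi_continuous : continuous dphi.
Proof.
move=> x; have [x0|x0|->] := ltgtP x 0.
- rewrite /continuous_at {2}/dphi (ltW x0).
  apply: cvg_trans (@W_phi_continuous x); apply: near_eq_cvg.
  near=> y; rewrite /dphi ifT// ltW//; near: y; exact: lt_nbhsl.
- rewrite /continuous_at {2}/dphi leNgt x0/=.
  apply: cvg_trans (continuousN (@W_phi_continuous x)); apply: near_eq_cvg.
  near=> y; rewrite /dphi ifF//; apply/negbTE; rewrite -ltNge; near: y; exact: open_gt.
- have E0 : dphi 0 = 0 by rewrite /dphi lexx phi0 W1.
  apply/cvgrPdist_lt => /= e e0; rewrite E0.
  have /cvgrPdist_lt/(_ e e0) := @W_phi_continuous 0.
  apply: filterS => y; rewrite phi0 W1 !sub0r !normrN /dphi.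
  by case: ifP; rewrite ?normrN.
Unshelve. all: by end_near. Qed.

Lemma phi_interior x : 0 < x < L -> 0 < phi x < 1 /\ tau (phi x) = x.
Proof.
move=> /andP[x0 xL]; have xL' : `|x| < L by rewrite gtr0_norm.
split; first by rewrite phi_gt0// phi_lt1// gt_eqF.
by have [_ ->] := phi_spec (ltW xL'); rewrite gtr0_norm.
Qed.

Lemma is_derive_phi_pos x : 0 < x < L -> is_derive x 1 phi (- W (phi x)).
Proof.
move=> xL; have [p01 <-] := phi_interior xL.
set s := phi x in p01 *; rewrite tauK; last lra.
have /andP[s0 s1] := p01.
have -> : - W s = (- (W s)^-1)^-1 by rewrite invrN invrK.
apply: (is_derive_inverse (f := tau)).
- near=> y; apply: tauK.
  have : 0 < y < 1; last by lra.
  by apply/andP; split; near: y; [exact: open_gt|exact: lt_nbhsl].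
- by near=> y; exact: tau_continuous.
- exact: is_derive_tau.
- by rewrite oppr_eq0 invr_eq0 gt_eqF// W_gt0.
Unshelve. all: by end_near. Qed.

Lemma is_derive_phi_regular x : x != 0 -> `|x| != L -> is_derive x 1 phi (dphi x).
Proof.
move=> x0; rewrite neq_lt => /orP[xL|Lx]; last first.
  have -> : dphi x = 0.
    by rewrite /dphi phi_out ?(ltW Lx)// W0 oppr0; case: ifP.
  apply: (@near_is_derive1 _ (cst 0)).
  near=> y; rewrite phi_out// ltW//; near: y.
  have := @norm_continuous _ _ x; move=> /(_ [set z | L < z]); apply.
  exact: open_gt.
move: x0; rewrite neq_lt /dphi => /orP[x0|x0].
  rewrite (ltW x0) -phi_even.
  have xL' : 0 < - x < L by move: xL; rewrite ltr0_norm//; lra.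
  have := is_derive1_chain (is_derive1_opp (is_derive_id x (1 : R)))
    (is_derive_phi_pos xL').
  rewrite mulrN1 opprK; apply: near_is_derive1.
  by near=> y; rewrite phi_even.
rewrite leNgt x0/=; apply: is_derive_phi_pos.
by move: xL; rewrite gtr0_norm// x0.
Unshelve. all: by end_near. Qed.

(** The derivative of [tau] is infinite at heights [0] and [1], so inversion says nothing at [0] and
    at the edges; there the derivative is recovered from the continuity of [dphi]. *)
Lemma is_derive_phi x : is_derive x 1 phi (dphi x).
Proof.
have L0 := half_width_gt0.
have [/andP[x0 xL]|] := boolP ((x != 0) && (`|x| != L)).
  exact: is_derive_phi_regular.
(* The exceptional points [- L], [0], [L] are at distance at least [L] from each other, so radius
   [L / 2] isolates each of them. *)
move=> xE; apply: (@is_derive1_removable _ phi dphi x (L / 2)); first lra.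
- exact: phi_continuous.
- exact: dphi_continuous.
move=> y yx xy; apply: is_derive_phi_regular.
  apply/eqP => y0; move: xE; rewrite negb_and !negbK => /orP[/eqP x0|/eqP xL].
    by move: yx; rewrite y0 x0 eqxx.
  by move: xy; rewrite y0 sub0r normrN xL; lra.
apply/eqP => yL; move: xE; rewrite negb_and !negbK => /orP[/eqP x0|/eqP xL].
  by move: xy; rewrite x0 subr0 yL; lra.
move: yx xy yL xL; case: (lerP 0 x) => x0; case: (lerP 0 y) => y0.
all: rewrite ?(ger0_norm x0) ?(ger0_norm y0) ?(ltr0_norm x0) ?(ltr0_norm y0).
all: rewrite neq_lt ltr_norml => ? ? ? ?; lra.
Qed.

Lemma dphi_sqr x : dphi x ^+ 2 = phi x * (1 - pospow (phi x)).
Proof. by rewrite /dphi; case: ifP => _; rewrite ?sqrrN W_sqr// phi_01. Qed.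

Definition ddphi x : R := (1 - (m + 1) * pospow (phi x)) / 2.

(** Here [phi'' = (W W')(phi)], and [W W'] is half the derivative of [s - s^(m+1)]. The top, where
    [W'] is infinite, is a removable exception; at the edges [phi''] jumps from [1 / 2] to [0],
    whence the strict inequality. *)
Lemma is_derive_dphi x : `|x| < L -> is_derive x 1 dphi (ddphi x).
Proof.
have L0 := half_width_gt0.
have reg y : `|y| < L -> y != 0 -> is_derive y 1 dphi (ddphi y).
  move=> yL y0; have p01 : 0 < phi y < 1 by rewrite phi_gt0// phi_lt1.
  have Wn0 : W (phi y) != 0 by rewrite gt_eqF// W_gt0.
  have d := is_derive1_chain (is_derive_phi y) (is_derive_W m_gt0 p01).
  move: y0; rewrite neq_lt => /orP[y0|y0].
    apply: (@near_is_derive1 _ (fun x => W (phi x))).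
      near=> z; rewrite /dphi ifT// ltW//; near: z; exact: lt_nbhsl.
    apply: (is_derive_eq d); rewrite /dphi (ltW y0) /ddphi.
    by field.
  apply: (@near_is_derive1 _ (fun x => - W (phi x))).
    near=> z; rewrite /dphi ifF//; apply/negbTE; rewrite -ltNge; near: z; exact: open_gt.
  apply: (is_derive_eq (is_derive1_opp d)); rewrite /dphi leNgt y0/= /ddphi.
  by field.
have [->|x0] := eqVneq x 0; last by move=> xL; exact: reg.
move=> _; apply: (@is_derive1_removable _ dphi ddphi 0 L) => //.
- exact: dphi_continuous.
- apply: continuous_mul; last exact: continuous_cst.
  apply: continuous_sub; first exact: continuous_cst.
  apply: continuous_mul; first exact: continuous_cst.
  exact: continuous_compose phi_continuous (pospow_continuous m_gt0).
- by move=> y y0; rewrite subr0 => yL; exact: reg.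
Unshelve. all: by end_near. Qed.

End BaseProfile.

(** * The sharp inequality *)

Section ChainRule.
Context {R : realType}.
Local Notation mu := (@lebesgue_measure R).
Implicit Types (f g h H w F : R -> R) (x y z a b c : R).

(* Cousin's lemma for additive properties of intervals. *)
Lemma additive_interval_property (P : R -> R -> Prop) a b : a <= b ->
  (forall u v z, u <= v -> v <= z -> P u v -> P v z -> P u z) ->
  (forall x, exists2 d : R, 0 < d &
     forall u v, x - d < u -> u <= x -> x <= v -> v < x + d -> P u v) ->
  P a b.
Proof.
move=> ab Padd Ploc.
pose S := [set y | a <= y <= b /\ P a y].
have Sa : S a.
  split; first by rewrite lexx.
  by have [d d0 Pd] := Ploc a; apply: Pd; lra.
have hS : has_sup S by split; [exists a|exists b => y [/andP[]]].
have sS := sup_upper_bound hS.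
have sb : sup S <= b by apply: ge_sup; [exists a|move=> y [/andP[]]].
have as_ : a <= sup S by exact: sS.
have [d d0 Pd] := Ploc (sup S).
have [y [/andP[ay yb] Pay] ys] := sup_adherent d0 hS.
have ysS : y <= sup S by apply: sS; split; rewrite ?ay.
have Pas : P a (sup S) by apply: Padd Pay _ => //; apply: Pd; lra.
move: sb; rewrite le_eqVlt => /predU1P[<-//|sb].
pose v := Num.min b (sup S + d / 2).
have vs : sup S < v by rewrite lt_min sb/=; lra.
have vb : v <= b by rewrite ge_min lexx.
have vd : v <= sup S + d / 2 by rewrite ge_min lexx orbT.
have Sv : S v.
  split; first by rewrite vb andbT; lra.
  by apply: Padd Pas _; [|lra|apply: Pd; lra].
by have := sS _ Sv; rewrite leNgt vs.
Qed.

Lemma mean_value_between H w a b : (forall s : R, is_derive s 1 H (w s)) ->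
  exists2 xi, Num.min a b <= xi <= Num.max a b & H b - H a = w xi * (b - a).
Proof.
move=> dH; have cH : continuous H by move=> s; exact: is_derive1_continuous (dH s).
have [ab|ba|<-] := ltgtP a b.
- have [s _|xi xab E] := @mean_value _ H w a b ab (fun s _ => dH s); first exact: cH.
  by exists xi => //; have /andP[x1 x2] := xab; rewrite !ltW.
- have [s _|xi xab E] := @mean_value _ H w b a ba (fun s _ => dH s); first exact: cH.
  exists xi; last by rewrite -opprB E; ring.
  by have /andP[x1 x2] := xab; rewrite !ltW.
- by exists a; rewrite ?lexx// !subrr mulr0.
Qed.

(** Since [g] is merely integrable, the two sides are compared on short intervals: where [w (h x)]
    oscillates by at most [e], they differ by at most [e] times the integral of [|g|]. This bound is
    additive, so it holds on [[a, b]] for every [e]. *)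
Lemma primitive_chain h g H w : segment_integrable g -> primitive h g ->
  (forall s : R, is_derive s 1 H (w s)) -> continuous w ->
  primitive (fun x => H (h x)) (fun x => g x * w (h x)).
Proof.
move=> ig pg dH cw a b ab.
have ch := primitive_continuous ig pg.
have cwh : continuous (fun x => w (h x)) := continuous_compose ch cw.
have igw := segment_integrable_mul ig cwh.
have ing : segment_integrable (fun x => `|g x|).
  by move=> u v; apply: integrable_Rnorm.
pose T u v := \int[mu]_(t in `[u, v]) (g t * w (h t)) - (H (h v) - H (h u)).
pose J u v := \int[mu]_(t in `[u, v]) `|g t|.
have J0 u v : 0 <= J u v by apply: Rintegral_ge0.
suff key e : 0 < e -> `|T a b| <= e * J a b.
  apply/eqP; rewrite -subr_eq0 -normr_le0 -/(T a b).
  apply/ler_addgt0Pl => e e0; rewrite addr0.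
  have J1 : 0 < J a b + 1 by have := J0 a b; lra.
  apply: le_trans (key (e / (J a b + 1)) _) _; first by rewrite divr_gt0.
  by rewrite mulrAC ler_pdivrMr// ler_pM2l//; lra.
move=> e0; apply: (@additive_interval_property (fun u v => `|T u v| <= e * J u v)) => //.
  move=> u v z uv vz Tuv Tvz.
  have -> : T u z = T u v + T v z.
    by rewrite /T (Rintegral_segment_split uv vz (igw _ _)); ring.
  have -> : J u z = J u v + J v z by exact: Rintegral_segment_split.
  by apply: le_trans (ler_normD _ _) _; rewrite mulrDr lerD.
move=> x; have e2 : 0 < e / 2 by lra.
have /cvgrPdist_le/(_ _ e2) [d /= d0 Hd] := cwh x.
exists d => // u v xu ux xv vx.
have uv : u <= v := le_trans ux xv.
have [xi xiI HE] := mean_value_between (h u) (h v) dH.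
(* The mean value [xi] lies between [h u] and [h v], so it is a value of [h] on [[u, v]], and the
   oscillation bound covers [w xi] too. *)
have [t tuv ht] := IVT uv (continuous_subspaceT ch) xiI.
have osc z : z \in `[u, v] -> `|w (h z) - w xi| <= e.
  rewrite in_itv/= => zuv.
  have E1 := Hd z; have E2 := Hd t; rewrite -ht.
  rewrite in_itv/= in tuv.
  have {}E1 : `|w (h x) - w (h z)| <= e / 2 by apply: E1; rewrite /= ltr_norml; lra.
  have {}E2 : `|w (h x) - w (h t)| <= e / 2 by apply: E2; rewrite /= ltr_norml; lra.
  by move: E1 E2; rewrite !ler_norml; lra.
have icst : mu.-integrable `[u, v] (EFin \o (fun z => w xi * g z)) by exact: integrable_Rmull.
have -> : T u v = \int[mu]_(z in `[u, v]) (g z * w (h z) - w xi * g z).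
  by rewrite RintegralB// RintegralZl// pg// /T HE.
apply: le_trans (le_normr_Rintegral _ _) _ => //; first exact: integrable_Rsub.
rewrite -RintegralZl//; apply: le_Rintegral => //.
- by apply: integrable_Rnorm => //; exact: integrable_Rsub.
- exact: integrable_Rmull.
- move=> z zuv; rewrite (_ : _ - _ = g z * (w (h z) - w xi)); last ring.
  by rewrite normrM mulrC ler_wpM2r// osc.
Qed.

Lemma Rintegral_symmetric_cvg F c : mu.-integrable setT (EFin \o F) ->
  \int[mu]_(x in `[c - n%:R, c + n%:R]) F x @[n --> \oo] --> \int[mu]_(x in setT) F x.
Proof.
move=> iF.
have iN : mu.-integrable setT (EFin \o (fun x => `|F x|)) by exact: integrable_Rnorm.
have mF : measurable_fun setT F by have /integrableP[/measurable_EFinP] := iF.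
pose Fn (n : nat) := F \_ (`[c - n%:R, c + n%:R]%classic : set R).
have h1 n : measurable_fun setT (Fn n).
  by apply/(measurable_restrictT _ _).1 => //; exact: measurable_funTS.
have h2 x : [set: R] x -> Fn n x @[n --> \oo] --> F x.
  move=> _; apply: cvg_near_cst; exists (Num.bound `|x - c|) => // n /= ln.
  rewrite /Fn patchE mem_set//= in_itv/=.
  have : `|x - c| < n%:R.
    by apply: lt_le_trans (archi_boundP (normr_ge0 _)) _; rewrite ler_nat.
  by rewrite ltr_norml; lra.
have h3 n x : [set: R] x -> `|Fn n x| <= `|F x|.
  by move=> _; rewrite /Fn patchE; case: ifP; rewrite ?normr0.
have [_] := Rintegral_dominated_cvg measurableT h1 h2 iN h3.
by under eq_fun do rewrite /Fn -Rintegral_mkcond.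
Qed.

Lemma integrable_tail F (e : R) : 0 < e -> (forall x, 0 <= F x) ->
  mu.-integrable setT (EFin \o F) ->
  exists2 M, 0 <= M & forall x, M <= x \/ x <= - M - 1 ->
    \int[mu]_(t in `[x, x + 1]) F t <= e.
Proof.
move=> e0 F0 iF.
have iS a b : mu.-integrable `[a, b] (EFin \o F) by exact: integrableS iF.
have /cvgrPdist_le/(_ _ e0) [n _ Hn] := Rintegral_symmetric_cvg 0 iF.
have In : \int[mu]_(t in setT) F t <= \int[mu]_(t in `[- n%:R, n%:R]) F t + e.
  have := Hn n (leqnn n); rewrite /= sub0r add0r ler_norml => /andP[_].
  by rewrite lerBlDr addrC.
exists n%:R => // x xn.
have sub a b : \int[mu]_(t in `[a, b]) F t <= \int[mu]_(t in setT) F t.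
  by apply: le_Rintegral_subset.
have nn a b : 0 <= \int[mu]_(t in `[a, b]) F t by exact: Rintegral_ge0.
have n0 : (0 : R) <= n%:R by [].
have arith (I J K S : R) : I <= J + e -> J + (K + S) <= I -> 0 <= K -> S <= e by lra.
case: xn => xn.
  have x1 : n%:R <= x + 1 by lra.
  have x2 : - n%:R <= n%:R :> R by lra.
  have x3 : x <= x + 1 by lra.
  have E1 := Rintegral_segment_split x2 x1 (iS _ _).
  have E2 := Rintegral_segment_split xn x3 (iS _ _).
  have S1 := sub (- n%:R) (x + 1); have S2 := nn n%:R x.
  by apply: arith In _ S2; rewrite -E2 -E1.
have x1 : x + 1 <= n%:R by lra.
have x2 : x + 1 <= - n%:R by lra.
have x3 : x <= x + 1 by lra.
have x4 : - n%:R <= n%:R :> R by lra.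
have E1 := Rintegral_segment_split x3 x1 (iS _ _).
have E2 := Rintegral_segment_split x2 x4 (iS _ _).
have S1 := sub x n%:R; have S2 := nn (x + 1) (- n%:R).
have arith' (I J K S : R) : I <= J + e -> S + (K + J) <= I -> 0 <= K -> S <= e.
  by rewrite addrCA [S + J]addrC addrCA; exact: arith.
by apply: arith' In _ S2; rewrite -E2 -E1.
Qed.

(** The pointwise counterpart of [sz_nagy_pair], satisfied by the continuous representative. *)
Definition admissible h g := [/\ primitive h g, segment_integrable g,
  forall x, 0 <= h x, mu.-integrable setT (EFin \o h) &
  mu.-integrable setT (EFin \o (fun x => g x ^+ 2))].

(** With [d = e / 3], far out [int h <= d] and [int g^2 <= d^2] over any unit interval. From
    [|g| <= d + g^2 / d] the variation of [h] there is at most [2 d], so [h x] exceeds the mean of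
    [h] by at most [2 d]. *)
Lemma admissible_decay h g (e : R) : admissible h g -> 0 < e ->
  exists2 M, 0 <= M & forall x, M <= `|x| -> h x <= e.
Proof.
move=> [pg ig h0 ih ig2] e0.
pose d := e / 3; have d0 : 0 < d by rewrite /d; lra.
have [M1 M10 H1] := integrable_tail d0 h0 ih.
have [M2 M20 H2] := integrable_tail (mulr_gt0 d0 d0) (fun x => sqr_ge0 (g x)) ig2.
exists (M1 + M2 + 1); first lra.
move=> x xM.
have {}H1 : \int[mu]_(t in `[x, x + 1]) h t <= d.
  by apply: H1; move: xM; rewrite ler_normr => /orP[]; [left|right]; lra.
have {}H2 : \int[mu]_(t in `[x, x + 1]) g t ^+ 2 <= d * d.
  by apply: H2; move: xM; rewrite ler_normr => /orP[]; [left|right]; lra.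
have x1 : x <= x + 1 by lra.
have iS (F : R -> R) a b : mu.-integrable setT (EFin \o F) ->
    mu.-integrable `[a, b] (EFin \o F) by move=> iF; exact: integrableS iF.
have ing a b : mu.-integrable `[a, b] (EFin \o (fun t => `|g t|)).
  by apply: integrable_Rnorm.
have I1 : \int[mu]_(t in `[x, x + 1]) `|g t| <= d + d.
  have ir : mu.-integrable `[x, x + 1] (EFin \o (fun t => d + d^-1 * g t ^+ 2)).
    apply: integrable_Radd => //; first exact: integrable_cst_segment.
    by apply: integrable_Rmull => //; exact: iS.
  apply: (@le_trans _ _ (\int[mu]_(t in `[x, x + 1]) (d + d^-1 * g t ^+ 2))).
    apply: le_Rintegral => // t _.
    have d1 : 0 < d^-1 by rewrite invr_gt0.
    have dd : d * d^-1 = 1 by rewrite divff// gt_eqF.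
    have n0 := normr_ge0 (g t); rewrite -real_normK ?num_real//.
    by have := sqr_ge0 (`|g t| - d); nra.
  rewrite RintegralD//; [|exact: integrable_cst_segment|
    by apply: integrable_Rmull => //; exact: iS].
  rewrite Rintegral_cst_segment// RintegralZl//; last exact: iS.
  rewrite lerD//; first by rewrite (_ : x + 1 - x = 1) ?mulr1//; ring.
  by rewrite mulrC ler_pdivrMr.
have hx t : x <= t <= x + 1 -> h x <= h t + (d + d).
  move=> /andP[xt t1]; have := pg _ _ xt.
  have : `|\int[mu]_(s in `[x, t]) g s| <= d + d.
    apply: le_trans (le_normr_Rintegral _ _) _ => //.
    apply: le_trans I1; apply: le_Rintegral_subset => //.
    by apply: subset_itvl; rewrite bnd_simp.
  by rewrite ler_norml => ? ?; lra.
have : \int[mu]_(t in `[x, x + 1]) (h x) <= \int[mu]_(t in `[x, x + 1]) (h t + (d + d)).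
  have ir : mu.-integrable `[x, x + 1] (EFin \o (fun t => h t + (d + d))).
    by apply: integrable_Radd => //; [exact: iS|exact: integrable_cst_segment].
  have ic : mu.-integrable `[x, x + 1] (EFin \o cst (h x)).
    exact: integrable_cst_segment.
  apply: (le_Rintegral _ ic ir) => // t; rewrite /= in_itv/=; exact: hx.
rewrite RintegralD//; [|exact: iS|exact: integrable_cst_segment].
rewrite !Rintegral_cst_segment// (_ : x + 1 - x = 1) ?mulr1; last ring.
by rewrite /d in H1 *; lra.
Qed.

Lemma admissible_continuous h g : admissible h g -> continuous h.
Proof. by move=> [pg ig _ _ _]; exact: primitive_continuous pg. Qed.

Lemma admissible_argmax h g x0 : admissible h g -> 0 < h x0 ->
  exists c, forall x, h x <= h c.
Proof.
move=> ahg hx0; have h20 : 0 < h x0 / 2 by lra.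
have [M M0 HM] := admissible_decay ahg h20.
pose K := M + `|x0|; have K0 : 0 <= K by rewrite addr_ge0.
have nK : - K <= K by lra.
have [c _ cmax] := EVT_max nK (continuous_subspaceT (admissible_continuous ahg)).
exists c => x; have [xK|Kx] := leP `|x| K.
  by apply: cmax; rewrite in_itv/= -ler_norml.
apply: (@le_trans _ _ (h x0 / 2)).
  by apply: HM; apply: le_trans (ltW Kx); rewrite lerDl.
apply: (@le_trans _ _ (h x0)); first lra.
by apply: cmax; rewrite in_itv/= -ler_norml /K lerDr.
Qed.

End ChainRule.

(** * The calibration identity *)

Section Calibration.
Context {R : realType}.
Local Notation mu := (@lebesgue_measure R).
Variable m : R.
Hypothesis m_gt0 : 0 < m.
Implicit Types (f g h : R -> R) (x y c l s : R).
Local Notation W := (W m).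
Local Notation pospow := (pospow m).

Definition intW s : R := antiderivative 0 W s.

Lemma is_derive_intW s : is_derive s 1 intW (W s).
Proof.
have iW := continuous_segment_integrable (W_continuous m_gt0).
apply: (primitive_is_derive iW); first exact: antiderivative_primitive.
exact: W_continuous.
Qed.

Lemma intW0 : intW 0 = 0. Proof. exact: antiderivative0. Qed.

Lemma intW1_gt0 : 0 < intW 1.
Proof.
have [x _|x x01] := @mean_value _ intW W 0 1 ltr01 (fun s _ => is_derive_intW s).
  exact: is_derive1_continuous (is_derive_intW x).
by rewrite intW0 !subr0 mulr1 => ->; exact: W_gt0.
Qed.

Definition defect l c h g x : R :=
  (g x - (if x <= c then l else - l) * W (h x)) ^+ 2.

(** Since [W(h)^2 = h - h^(m+1)], the squares produce the left-hand side, while the cross terms are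
    exact derivatives of [intW (h x)] by the chain rule. As [h] is [1] at [c] and decays at
    infinity, each half-line contributes [2 l intW 1]. *)
Lemma calibration l c h g : 0 < l -> admissible h g -> (forall x, h x <= 1) ->
  h c = 1 ->
  [/\ mu.-integrable setT (EFin \o (fun x => h x * pospow (h x))),
      mu.-integrable setT (EFin \o defect l c h g) &
  \int[mu]_(x in setT) g x ^+ 2 +
    l ^+ 2 * (\int[mu]_(x in setT) h x - \int[mu]_(x in setT) (h x * pospow (h x))) =
  4 * l * intW 1 + \int[mu]_(x in setT) defect l c h g x].
Proof.
move=> l0 ahg h1 hc; have [pg ig h0 ih ig2] := ahg.
have ch := admissible_continuous ahg.
have cp := continuous_compose ch (pospow_continuous m_gt0).
have ihp : mu.-integrable setT (EFin \o (fun x => h x * pospow (h x))).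
  apply: integrable_Rle ih => // [|x _].
    by apply: continuous_measurable_fun; exact: continuous_mul.
  rewrite ger0_norm ?mulr_ge0 ?pospow_ge0// ler_piMr// -(pospow1 m).
  exact: pospow_mono.
have cWh := continuous_compose ch (W_continuous m_gt0).
have W2 x : W (h x) ^+ 2 = h x - h x * pospow (h x).
  by rewrite W_sqr ?h0 ?h1//; ring.
have iW2 : mu.-integrable setT (EFin \o (fun x => W (h x) ^+ 2)).
  rewrite (_ : (fun x => _) = fun x => h x - h x * pospow (h x)); last exact/funext.
  exact: integrable_Rsub.
have mg : measurable_fun setT g by have [] := (locally_integrable_segment g).2 ig.
have msg : measurable_fun setT (fun x => if x <= c then l else - l).
  by apply: measurable_fun_ifT => //; exact: measurable_fun_ler.
have mWh : measurable_fun setT (fun x => W (h x)) by exact: continuous_measurable_fun.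
have idom : mu.-integrable setT
    (EFin \o (fun x => 2 * g x ^+ 2 + (2 * l ^+ 2) * W (h x) ^+ 2)).
  by apply: integrable_Radd => //; apply: integrable_Rmull.
have ie : mu.-integrable setT (EFin \o defect l c h g).
  apply: integrable_Rle idom => // [|x _].
    apply: (measurable_funX (f := fun x => g x - (if x <= c then l else - l) * W (h x))).
    by apply: measurable_funB => //; exact: measurable_funM.
  rewrite ger0_norm ?sqr_ge0// /defect; set w := W (h x); set a := g x.
  case: ifP => _; first by have := sqr_ge0 (a + l * w); lra.
  by have := sqr_ge0 (a - l * w); lra.
split => //.
have iS (F : R -> R) a b : mu.-integrable setT (EFin \o F) ->
    mu.-integrable `[a, b] (EFin \o F) by move=> iF; exact: integrableS iF.
have igW := segment_integrable_mul ig cWh.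
have pH := primitive_chain ig pg is_derive_intW (W_continuous m_gt0).
(* Stated for a free [l'] so as to serve both signs; the correction with [l'^2 - l^2] vanishes for
   [l' = l] and [l' = - l]. *)
have sq l' a b : a <= b ->
    \int[mu]_(x in `[a, b]) (g x - l' * W (h x)) ^+ 2 =
    \int[mu]_(x in `[a, b]) (g x ^+ 2 + l ^+ 2 * W (h x) ^+ 2) +
    (l' ^+ 2 - l ^+ 2) * \int[mu]_(x in `[a, b]) W (h x) ^+ 2 -
    2 * l' * (intW (h b) - intW (h a)).
  move=> ab; rewrite -(pH _ _ ab).
  have i1 : mu.-integrable `[a, b] (EFin \o (fun x => g x ^+ 2 + l ^+ 2 * W (h x) ^+ 2)).
    by apply: integrable_Radd => //; [exact: iS|apply: integrable_Rmull => //; exact: iS].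
  have i2 : mu.-integrable `[a, b] (EFin \o (fun x => (l' ^+ 2 - l ^+ 2) * W (h x) ^+ 2)).
    by apply: integrable_Rmull => //; exact: iS.
  have i3 : mu.-integrable `[a, b] (EFin \o (fun x => (2 * l') * (g x * W (h x)))).
    exact: integrable_Rmull.
  rewrite -(RintegralZl _ _ (iS _ a b iW2))// -(RintegralZl _ _ (igW a b))//.
  rewrite -RintegralD// -RintegralB//; last exact: integrable_Radd.
  by apply: eq_Rintegral => x _; ring.
have E n : \int[mu]_(x in `[c - n%:R, c + n%:R]) defect l c h g x =
    \int[mu]_(x in `[c - n%:R, c + n%:R]) (g x ^+ 2 + l ^+ 2 * W (h x) ^+ 2) -
    4 * l * intW 1 + 2 * l * (intW (h (c - n%:R)) + intW (h (c + n%:R))).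
  have n0 : (0 : R) <= n%:R by [].
  have cl : c - n%:R <= c by lra.
  have cr : c <= c + n%:R by lra.
  have iT : mu.-integrable setT (EFin \o (fun x => g x ^+ 2 + l ^+ 2 * W (h x) ^+ 2)).
    by apply: integrable_Radd => //; exact: integrable_Rmull.
  rewrite (Rintegral_segment_split cl cr (iS _ _ _ ie)).
  rewrite (Rintegral_segment_split cl cr (iS _ _ _ iT)).
  have -> : \int[mu]_(x in `[c - n%:R, c]) defect l c h g x =
      \int[mu]_(x in `[c - n%:R, c]) (g x - l * W (h x)) ^+ 2.
    apply: eq_Rintegral => x; rewrite inE/= in_itv/= => /andP[_ xc].
    by rewrite /defect xc.
  have -> : \int[mu]_(x in `[c, c + n%:R]) defect l c h g x =
      \int[mu]_(x in `[c, c + n%:R]) (g x - (- l) * W (h x)) ^+ 2.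
    have i4 : mu.-integrable `[c, c + n%:R] (EFin \o (fun x => (g x - (- l) * W (h x)) ^+ 2)).
      apply: integrable_Rle (iS _ _ _ idom) => // [|x _].
        apply: measurable_funTS.
        apply: (measurable_funX (f := fun x => g x - (- l) * W (h x))).
        by apply: measurable_funB => //; exact: measurable_funM.
      rewrite ger0_norm ?sqr_ge0//; set w := W (h x); set a := g x.
      by have := sqr_ge0 (a - l * w); lra.
    (* At [c] itself [defect] carries the sign of the left half, so the integrands are compared on
       the interval without its left endpoint. *)
    have sub : `]c, c + n%:R] `<=` `[c, c + n%:R] by apply: subset_itvr; rewrite bnd_simp.
    have i5 : mu.-integrable `]c, c + n%:R] (EFin \o defect l c h g).
      by apply: integrableS (iS _ c (c + n%:R) ie).
    have i6 : mu.-integrable `]c, c + n%:R] (EFin \o (fun x => (g x - (- l) * W (h x)) ^+ 2)).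
      by apply: integrableS i4.
    rewrite -Rintegral_itv_obnd_cbnd// -[RHS]Rintegral_itv_obnd_cbnd//.
    apply: eq_Rintegral => x; rewrite inE/= in_itv/= => /andP[cx _].
    by rewrite /defect leNgt cx.
  by rewrite !sq// hc; ring.
have cI : continuous intW.
  by move=> s; exact: is_derive1_continuous (is_derive_intW s).
have lim0 (u : nat -> R) : (forall M, \forall n \near \oo, M <= `|u n|) ->
    intW (h (u n)) @[n --> \oo] --> 0.
  move=> Hu; have hu : h (u n) @[n --> \oo] --> 0.
    apply/cvgrPdist_le => e e0; have [M _ HM] := admissible_decay ahg e0.
    apply: filterS (Hu M) => n /HM; rewrite sub0r normrN ger0_norm//.
  have := cI 0; rewrite /continuous_at intW0.
  by apply: cvg_comp.
have big M : \forall n \near \oo, M + `|c| <= (n%:R : R).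
  exists (Num.bound (M + `|c|)) => // n /= ln.
  have [M0|M0] := leP 0 (M + `|c|).
    by apply: (@le_trans _ _ (Num.bound (M + `|c|))%:R); rewrite ?ler_nat// ltW// archi_boundP.
  by apply: le_trans (ltW M0) _.
have l1 := lim0 (fun n => c - n%:R).
have l2 := lim0 (fun n => c + n%:R).
have c1 := Rintegral_symmetric_cvg c ie.
have iT : mu.-integrable setT (EFin \o (fun x => g x ^+ 2 + l ^+ 2 * W (h x) ^+ 2)).
  by apply: integrable_Radd => //; exact: integrable_Rmull.
have c2 := Rintegral_symmetric_cvg c iT.
have c3 : \int[mu]_(x in `[c - n%:R, c + n%:R]) defect l c h g x @[n --> \oo] -->
    \int[mu]_(x in setT) (g x ^+ 2 + l ^+ 2 * W (h x) ^+ 2) - 4 * l * intW 1 +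
    2 * l * (0 + 0).
  rewrite (funext E); apply: cvgD.
    by apply: cvgB; [exact: c2|exact: cvg_cst].
  apply: cvgM; first exact: cvg_cst.
  apply: cvgD.
    apply: l1 => M; apply: filterS (big M) => n H.
    by rewrite ler_normr; apply/orP; right; have := ler_norm c; lra.
  apply: l2 => M; apply: filterS (big M) => n H.
  by rewrite ler_normr; apply/orP; left; have := ler_norm (- c); rewrite normrN; lra.
have -> := cvg_unique (@Rhausdorff R) c1 c3.
rewrite RintegralD//; last exact: integrable_Rmull.
rewrite RintegralZl// -RintegralB//.
have -> : \int[mu]_(x in setT) W (h x) ^+ 2 =
    \int[mu]_(x in setT) (h x - h x * pospow (h x)) by apply: eq_Rintegral => x _.
by ring.
Qed.

End Calibration.

(** * Mass, power integral and Dirichlet integral of the profile *)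

Section ProfileIntegrals.
Context {R : realType}.
Local Notation mu := (@lebesgue_measure R).
Variable m : R.
Hypothesis m_gt0 : 0 < m.
Implicit Types (f g h F : R -> R) (x y c l s A k a b : R).
Local Notation W := (W m).
Local Notation pospow := (pospow m).
Local Notation phi := (phi m).
Local Notation dphi := (dphi m).
Local Notation L := (half_width m).

Lemma integrable_support F a b : continuous F ->
  (forall x, ~~ (a <= x <= b) -> F x = 0) -> mu.-integrable setT (EFin \o F).
Proof.
move=> cF F0.
have := (@integrable_mkcond _ _ _ mu _ _ (measurable_itv `[a, b])).1
  (continuous_segment_integrable cF a b).
apply: (@eq_integrable _ _ _ mu setT) => // x _; rewrite patchE.
case: ifPn => //=; rewrite notin_setE/= in_itv/= => /negP xab.
by rewrite F0.
Qed.

Lemma Rintegral_affine F a b k c : continuous F -> 0 < k -> a <= b ->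
  (forall x, ~~ (a <= x <= b) -> F x = 0) ->
  \int[mu]_(x in setT) F (k * x + c) = k^-1 * \int[mu]_(x in setT) F x.
Proof.
move=> cF k0 ab F0.
have abk : (a - c) / k <= (b - c) / k.
  by rewrite ler_pM2r ?invr_gt0// lerB.
rewrite (@Rintegral_support _ _ _ ((a - c) / k) ((b - c) / k))//; last first.
  move=> x _ xc; apply: F0; apply: contra xc.
  by rewrite ler_pdivrMr// ler_pdivlMr// lerBlDr lerBrDr ![x * k]mulrC.
rewrite (@Rintegral_support _ _ F a b)//; last by move=> x _; exact: F0.
have iF := continuous_segment_integrable cF.
have pF := antiderivative_primitive 0 iF.
have dF x : is_derive x 1 (antiderivative 0 F) (F x).
  by apply: (primitive_is_derive iF) => //; exact: cF.
rewrite pF//.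
pose G x := k^-1 * antiderivative 0 F (k * x + c).
have dG x : is_derive x 1 G (F (k * x + c)).
  have := is_derive1_mull k^-1 (is_derive1_affine (dF (k * x + c))).
  by rewrite mulrA mulVf ?gt_eqF// mul1r.
have cFk : continuous (fun x => F (k * x + c)).
  apply: continuous_compose => //; apply: continuous_add (@continuous_cst R c).
  exact: continuous_mul (@continuous_cst R k) (@continuous_idfun R).
transitivity (G ((b - c) / k) - G ((a - c) / k)).
  apply: FTC_open => //.
  - by apply: continuous_subspaceT => x; exact: is_derive1_continuous (dG x).
  - by move=> x _; exact: cFk.
  - exact: continuous_segment_integrable.
by rewrite /G ![k * _]mulrC !divfK ?gt_eqF// !subrK -mulrBr mulrC.
Qed.

Lemma Rintegral_scale F c k : continuous F -> 0 < k ->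
  (forall x, ~~ (- c <= x <= c) -> F x = 0) -> 0 <= c ->
  \int[mu]_(x in setT) F (k * x) = k^-1 * \int[mu]_(x in setT) F x.
Proof.
move=> cF k0 F0 c0; rewrite -(@Rintegral_affine F (- c) c k 0)//; last lra.
by under [RHS]eq_Rintegral do rewrite addr0.
Qed.

Lemma phi_support x : ~~ (- L <= x <= L) -> phi x = 0.
Proof. by rewrite -ler_norml -ltNge => /ltW; exact: phi_out. Qed.

Lemma dphi_out x : L <= `|x| -> dphi x = 0.
Proof. by move=> xL; rewrite /dphi (phi_out m_gt0 xL) (W0 m_gt0) oppr0; case: ifP. Qed.

Lemma dphi_support x : ~~ (- L <= x <= L) -> dphi x = 0.
Proof. by rewrite -ler_norml -ltNge => /ltW; exact: dphi_out. Qed.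

Definition phi_mass : R := \int[mu]_(x in setT) phi x.
Definition phi_power : R := \int[mu]_(x in setT) (phi x * pospow (phi x)).

Lemma phi_mul_pospow_continuous : continuous (fun x => phi x * pospow (phi x)).
Proof.
apply: continuous_mul; first exact: phi_continuous.
exact: continuous_compose (phi_continuous m_gt0) (pospow_continuous m_gt0).
Qed.

Lemma integrable_phi : mu.-integrable setT (EFin \o phi).
Proof. by apply: integrable_support phi_support; exact: phi_continuous. Qed.

Lemma integrable_phi_power :
  mu.-integrable setT (EFin \o (fun x => phi x * pospow (phi x))).
Proof.
apply: (@integrable_support _ (- L) L); first exact: phi_mul_pospow_continuous.
by move=> x /phi_support ->; rewrite mul0r.
Qed.

Lemma phi_gradient :
  \int[mu]_(x in setT) dphi x ^+ 2 = phi_mass - phi_power.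
Proof.
rewrite -RintegralB//; [|exact: integrable_phi|exact: integrable_phi_power].
by apply: eq_Rintegral => x _; rewrite dphi_sqr//; ring.
Qed.

(* Pohozaev identity: integrate [(phi phi')' = phi'^2 + phi phi'']. *)
Lemma phi_pohozaev : 3 * phi_mass = (m + 3) * phi_power.
Proof.
have L0 := half_width_gt0 m_gt0.
pose G x := (3 * phi x - (m + 3) * (phi x * pospow (phi x))) / 2.
have cG : continuous G.
  apply: continuous_mul; last exact: continuous_cst.
  apply: continuous_sub; apply: continuous_mul; try exact: continuous_cst.
    exact: phi_continuous.
  exact: phi_mul_pospow_continuous.
have : \int[mu]_(x in `[- L, L]) G x = phi L * dphi L - phi (- L) * dphi (- L).
  apply: (@FTC_open _ (fun x => phi x * dphi x)); first lra.
  - apply: continuous_subspaceT; apply: continuous_mul.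
      exact: phi_continuous.
    exact: dphi_continuous.
  - move=> x; rewrite -ltr_norml => xL.
    apply: (is_derive_eq (is_derive1_mul (is_derive_phi m_gt0 x) (is_derive_dphi m_gt0 xL))).
    have := dphi_sqr m_gt0 x; rewrite /G /ddphi expr2 => ->; by field.
  - by move=> x _; exact: cG.
  - exact: continuous_segment_integrable.
rewrite phi_even phi_out// ?ger0_norm// ?(ltW L0)// !mul0r subrr.
rewrite -(@Rintegral_support _ setT)//; last first.
  by move=> x _ /phi_support E; rewrite /G E mul0r !mulr0 subr0 mul0r.
have i1 : mu.-integrable setT (EFin \o (fun x => (3 / 2) * phi x)).
  by apply: integrable_Rmull => //; exact: integrable_phi.
have i2 : mu.-integrable setT (EFin \o (fun x => ((m + 3) / 2) * (phi x * pospow (phi x)))).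
  by apply: integrable_Rmull => //; exact: integrable_phi_power.
have -> : \int[mu]_(x in setT) G x = \int[mu]_(x in setT)
    ((3 / 2) * phi x - ((m + 3) / 2) * (phi x * pospow (phi x))).
  by apply: eq_Rintegral => x _; rewrite /G; field.
rewrite RintegralB//.
rewrite (@RintegralZl _ _ _ mu _ phi _ measurableT integrable_phi).
rewrite (@RintegralZl _ _ _ mu _ _ _ measurableT integrable_phi_power).
rewrite -/phi_mass -/phi_power => E.
have : 3 / 2 * phi_mass - (m + 3) / 2 * phi_power = 0 by [].
by lra.
Qed.

Lemma admissible_phi : admissible phi dphi.
Proof.
split.
- apply: (@piecewise_C1_primitive _ [::]); split.
  + exact: phi_continuous.
  + by move=> x _; exact: is_derive_phi.
  + by move=> x _; exact: dphi_continuous.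
  + by apply: continuous_segment_integrable; exact: dphi_continuous.
- by apply: continuous_segment_integrable; exact: dphi_continuous.
- by move=> x; have /andP[] := phi_01 m_gt0 x.
- exact: integrable_phi.
- apply: (@integrable_support _ (- L) L).
    exact: continuous_compose (dphi_continuous m_gt0) (@exprn_continuous R 2).
  by move=> x /dphi_support ->; rewrite expr0n.
Qed.

(** The profile satisfies [phi' = W(phi)] left of [0] and [phi' = - W(phi)] right of it, so its
    defect for [l = 1] is zero; its Dirichlet integral is also [phi_mass - phi_power], and the
    identity reads [2 (phi_mass - phi_power) = 4 intW 1]. *)
Lemma phi_calibration : phi_mass - phi_power = 2 * intW m 1.
Proof.
have h1 x : phi x <= 1 by have /andP[] := phi_01 m_gt0 x.
have [_ _] := calibration m_gt0 ltr01 admissible_phi h1 (phi0 m_gt0).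
rewrite phi_gradient -/phi_mass -/phi_power.
have -> : \int[mu]_(x in setT) defect m 1 0 phi dphi x = 0.
  rewrite (_ : \int[mu]_(x in setT) _ = \int[mu]_(x in setT) cst (0 : R) x).
    by rewrite /Rintegral integral0.
  apply: eq_Rintegral => x _; rewrite /defect /dphi.
  by case: ifP => _; rewrite ?mulN1r ?mul1r ?opprK ?subrr ?addNr expr0n.
by rewrite expr1n; lra.
Qed.

Lemma phi_massE : phi_mass * (m / (m + 3)) = 2 * intW m 1.
Proof.
have m3 : m + 3 != 0 by rewrite gt_eqF// addr_gt0.
have pE : phi_power = 3 * phi_mass / (m + 3) by rewrite phi_pohozaev; field.
by rewrite -phi_calibration pE; field.
Qed.

Lemma phi_mass_gt0 : 0 < phi_mass.
Proof.
have K0 := intW1_gt0 m_gt0.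
have c0 : 0 < m / (m + 3) by rewrite divr_gt0// addr_gt0.
by rewrite -(pmulr_lgt0 _ c0) phi_massE; lra.
Qed.

Lemma asin_within_continuous : {within `[(- 1)%R, 1%R], continuous (@asin R)}.
Proof.
have p0 : - (pi / 2) <= pi / 2 :> R by have := @pi_gt0 R; lra.
have := @segment_can_le_continuous R _ _ (@sin R) (@asin R) p0.
rewrite sinN sin_pihalf; apply.
  by apply: continuous_subspaceT; exact: continuous_sin.
exact: sinK.
Qed.

(* For [m = 3], [asin (phi^(3/2))] is an antiderivative of [-(3/2) phi]. *)
Lemma phi_mass3 : m = 3 -> phi_mass = 2 * pi / 3.
Proof.
move=> m3; have L0 := half_width_gt0 m_gt0.
have p01 x := phi_01 m_gt0 x.
have cphi := phi_continuous m_gt0.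
pose y x := phi x * Num.sqrt (phi x).
have y2 x : y x ^+ 2 = pospow (phi x).
  have /andP[q0 _] := p01 x.
  have E3 : phi x `^ m = phi x ^+ 3.
    by rewrite -(powR_mulrn 3 q0); congr (_ `^ _).
  by rewrite exprMn sqr_sqrtr// pospowE// E3; ring.
have y01 x : 0 <= y x <= 1.
  have /andP[q0 q1] := p01 x; have s0 := sqrtr_ge0 (phi x).
  have s1 : Num.sqrt (phi x) <= 1 by rewrite -sqrtr1 ler_wsqrtr.
  by rewrite mulr_ge0//= mulr_ile1.
have cy : continuous y.
  apply: continuous_mul => //.
  exact: continuous_compose cphi (@sqrt_continuous R).
have cF : {within `[0, L], continuous (fun x => asin (y x))}.
  apply: within_continuous_segment => x _ P.
  have yI : `[(- 1)%R, 1%R]%classic (y x).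
    by rewrite /= in_itv/=; have := y01 x; lra.
  move/subspace_continuousP : asin_within_continuous => /(_ _ yI) H /H /= HP.
  have {}HP := cy x _ HP; move: HP; rewrite !nbhs_simpl /=.
  apply: filterS => z /=; apply; rewrite in_itv/=.
  by have := y01 z; lra.
have : \int[mu]_(x in `[0, L]) (- (3 / 2) * phi x) = asin (y L) - asin (y 0).
  apply: (FTC_open (ltW L0) cF).
  - move=> x xL; have [q01 _] := phi_interior m_gt0 xL.
    have /andP[q0 q1] := q01.
    have dq := is_derive_phi_pos m_gt0 xL.
    have ds := is_derive1_chain dq (is_derive1_sqrt q0).
    have dy := is_derive1_mul dq ds.
    have sq0 : 0 < Num.sqrt (phi x) by rewrite sqrtr_gt0.
    have y0 : 0 < y x by rewrite mulr_gt0.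
    have pq1 : pospow (phi x) < 1.
      by rewrite -[ltRHS](pospow1 m); apply: pospow_lt => //; exact: ltW.
    have y1 : y x < 1.
      have : y x ^+ 2 < 1.
        by rewrite y2.
      by move=> ?; nra.
    have yI : -1 < y x < 1 by lra.
    apply: (is_derive_eq (is_derive1_chain dy (is_derive1_asin yI))).
    have sE : Num.sqrt (phi x) ^+ 2 = phi x by rewrite sqr_sqrtr// ltW.
    (* The second factor cancels the denominator in the derivative of the arcsine. *)
    have WE : W (phi x) = Num.sqrt (phi x) * Num.sqrt (1 - y x ^+ 2).
      by rewrite -sqrtrM ?(ltW q0)// y2.
    have s1 : Num.sqrt (1 - y x ^+ 2) != 0.
      by rewrite gt_eqF// sqrtr_gt0 y2; lra.
    rewrite WE -[in RHS]sE -[X in _ + X * _]sE; field.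
    by rewrite s1 gt_eqF.
  - move=> x _; apply: continuous_mul => //; exact: continuous_cst.
  - apply: continuous_segment_integrable; apply: continuous_mul => //.
    exact: continuous_cst.
have iphi := continuous_segment_integrable cphi.
rewrite RintegralZl//.
have -> : y L = 0 by rewrite /y phi_out ?mul0r// ger0_norm// ltW.
have -> : y 0 = 1 by rewrite /y phi0// sqrtr1 mulr1.
have pi0 : 0 <= pi / 2 :> R by have := @pi_gt0 R; lra.
have -> : asin (0 : R) = 0.
  by rewrite -[in LHS]sin0 sinK// in_itv/=; lra.
have -> : asin (1 : R) = pi / 2.
  by rewrite -[in LHS]sin_pihalf sinK// in_itv/=; lra.
move=> E.
have pP := antiderivative_primitive 0 iphi.
have dP x : is_derive x 1 (antiderivative 0 phi) (phi x).
  by apply: (primitive_is_derive iphi pP); exact: cphi.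
have refl : \int[mu]_(x in `[- L, 0]) phi x = \int[mu]_(x in `[0, L]) phi x.
  rewrite (pP _ _ (ltW L0)).
  transitivity (- antiderivative 0 phi (- 0) - (- antiderivative 0 phi (- - L))).
    have dG x : is_derive x 1 (fun x => - antiderivative 0 phi (- x)) (phi x).
      have := is_derive1_opp (is_derive1_chain
        (is_derive1_opp (is_derive_id x (1 : R))) (dP (- x))).
      by rewrite mulrN1 opprK phi_even.
    apply: (@FTC_open _ (fun x => - antiderivative 0 phi (- x))) => //.
    - lra.
    - by apply: continuous_subspaceT => x; exact: is_derive1_continuous (dG x).
    - by move=> x _; exact: cphi.
  by rewrite oppr0 !opprK addrC.
have L1 : - L <= 0 by lra.
rewrite /phi_mass (@Rintegral_support _ _ _ (- L) L)//; last first.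
  by move=> x _; exact: phi_support.
have -> := Rintegral_segment_split L1 (ltW L0) (iphi _ _).
rewrite refl.
have arith (I q : R) : - (3 / 2) * I = 0 - q / 2 -> I + I = 2 * q / 3 by lra.
exact: arith.
Qed.

End ProfileIntegrals.

(** * Rigidity in the case of equality *)

Section Rigidity.
Context {R : realType}.
Local Notation mu := (@lebesgue_measure R).
Variable m : R.
Hypothesis m_gt0 : 0 < m.
Implicit Types (f g h F : R -> R) (x y z c l s A k a b : R).
Local Notation W := (W m).
Local Notation pospow := (pospow m).
Local Notation phi := (phi m).
Local Notation dphi := (dphi m).
Local Notation tau := (tau m).
Local Notation L := (half_width m).

(** As long as [0 < h < 1], the derivative of [tau (h x)] is the constant [l]. *)
Lemma tau_ode h c l z : 0 < l -> continuous h -> h c = 1 ->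
  (forall x, c < x -> is_derive x 1 h (- (l * W (h x)))) -> c <= z ->
  (forall x, c < x < z -> 0 < h x < 1) -> tau (h z) = l * (z - c).
Proof.
move=> l0 ch hc dh; rewrite le_eqVlt => /predU1P[<- _|cz h01].
  by rewrite hc tau1 subrr mulr0.
have ct : continuous (fun x => tau (h x)).
  exact: continuous_compose ch (tau_continuous m_gt0).
have [x xI|x _|x xI] := @mean_value _ (fun x => tau (h x)) (fun=> l) c z cz.
- have := is_derive1_chain (dh x _) (is_derive_tau m_gt0 (h01 x xI)).
  have -> : - (W (h x))^-1 * - (l * W (h x)) = l.
    by field; rewrite gt_eqF// W_gt0// h01.
  by apply; have /andP[] := xI.
- exact: ct.
by rewrite hc tau1 subr0.
Qed.

(** Uniqueness fails only at height [1], where a solution may wait. After the last such time [c'],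
    the travel time [tau (h x)] grows linearly until [h] reaches zero, and [h] stays there because
    it is nonincreasing and nonnegative. *)
Lemma ode_right h c l x1 : 0 < l -> continuous h -> (forall x, 0 <= h x <= 1) ->
  h c = 1 -> (forall x, c < x -> is_derive x 1 h (- (l * W (h x)))) ->
  c <= x1 -> h x1 < 1 ->
  exists c', [/\ c <= c', forall x, c <= x <= c' -> h x = 1 &
    forall x, c' <= x -> h x = phi (l * (x - c'))].
Proof.
move=> l0 ch h01 hc dh cx1 hx1.
have mono x y : c <= x -> x <= y -> h y <= h x.
  move=> cx; rewrite le_eqVlt => /predU1P[->//|xy].
  have [z zI|z _|z zI E] := @mean_value _ h (fun x => - (l * W (h x))) x y xy.
  - by apply: dh; lra.
  - exact: ch.
  rewrite -subr_le0 E mulNr oppr_le0 !mulr_ge0 ?W_ge0 ?(ltW l0)//; lra.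
(* Its supremum is the last time at height [1]; it is finite because [h x1 < 1] and [h] is
   nonincreasing. *)
pose S := [set x | c <= x /\ h x = 1].
have Sc : S c by split.
have Sub : ubound S x1.
  move=> x [cx hx]; rewrite leNgt; apply/negP => xx.
  by have := mono _ _ cx1 (ltW xx); rewrite hx leNgt hx1.
have hS : has_sup S by split; [exists c|exists x1].
have sS := sup_upper_bound hS.
pose c' := sup S; have cc' : c <= c' by exact: sS.
have hc' : h c' = 1.
  apply/eqP; apply: contrapT => /negP hn.
  have lt1 : h c' < 1 by rewrite lt_neqAle hn; have /andP[] := h01 c'.
  have e0 : 0 < 1 - h c' by lra.
  have /cvgrPdist_lt/(_ _ e0)[d /= d0 Hd] := ch c'.
  have [y [cy hy] ys] := sup_adherent d0 hS.
  have yc' : y <= c' by apply: sS.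
  have := Hd y; rewrite hy /= => H.
  have : `|h c' - 1| < 1 - h c' by apply: H; rewrite -/c' in ys; rewrite ltr_norml; lra.
  by rewrite ltr_norml; lra.
have plateau x : c <= x <= c' -> h x = 1.
  move=> /andP[cx xc']; apply/eqP; rewrite eq_le.
  by have /andP[_ ->] := h01 x; rewrite -hc' mono.
have below x : c' < x -> h x < 1.
  move=> cx; rewrite ltNge; apply/negP => h1.
  have hx : h x = 1 by apply/eqP; rewrite eq_le h1 andbT; have /andP[] := h01 x.
  have : x <= c' by apply: sS; split => //; lra.
  by lra.
have dh' x : c' < x -> is_derive x 1 h (- (l * W (h x))).
  by move=> cx; apply: dh; lra.
exists c'; split => // x; rewrite le_eqVlt => /predU1P[<-|cx].
  by rewrite subrr mulr0 phi0.
have /andP[+ _] := h01 x; rewrite le_eqVlt => /predU1P[h0|h0].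
(* Its supremum [z] is the time at which [h] reaches zero. Applying [tau_ode] up to [z] gives
   [l (z - c') = L], so [x] lies at or beyond the edge of [phi]. *)
- pose T := [set y | c' <= y <= x /\ 0 < h y].
  have Tc : T c' by split; rewrite ?lexx ?(ltW cx)// hc'.
  have hT : has_sup T by split; [exists c'|exists x => y [/andP[]]].
  have sT := sup_upper_bound hT.
  pose z := sup T; have cz : c' <= z by exact: sT.
  have zx : z <= x by apply: ge_sup; [exists c'|move=> y [/andP[]]].
  have hz : h z = 0.
    apply/eqP; apply: contrapT => /negP hn.
    have hz0 : 0 < h z by rewrite lt0r hn; have /andP[] := h01 z.
    have /cvgrPdist_lt/(_ _ hz0)[d /= d0 Hd] := ch z.
    have zx' : z < x.
      by rewrite lt_neqAle zx andbT; apply/eqP => E; move: hz0; rewrite E -h0 ltxx.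
    pose w := Num.min x (z + d / 2).
    have wz : z < w by rewrite lt_min zx'/=; lra.
    have wx : w <= x by rewrite ge_min lexx.
    have wd : w <= z + d / 2 by rewrite ge_min lexx orbT.
    have : w <= z.
      apply: sT; split; first by rewrite wx andbT; lra.
      have : `|h z - h w| < h z by apply: Hd => /=; rewrite ltr_norml; lra.
      by rewrite ltr_norml; lra.
    by lra.
  have zpos y : c' < y < z -> 0 < h y < 1.
    move=> /andP[cy yz]; rewrite below// andbT.
    have e0 : 0 < z - y by lra.
    have [t [/andP[ct tx] ht] ty] := sup_adherent e0 hT.
    have yt : y <= t by rewrite -/z in ty; lra.
    by apply: lt_le_trans ht _; apply: mono => //; lra.
  have := tau_ode l0 ch hc' dh' cz zpos; rewrite hz -/L => Lz.
  rewrite -h0 phi_out// ger0_norm; last by rewrite mulr_ge0 ?(ltW l0)//; lra.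
  by rewrite [leLHS]Lz ler_pM2l//; lra.
- have xpos y : c' < y < x -> 0 < h y < 1.
    move=> /andP[cy yx]; rewrite below// andbT.
    by apply: lt_le_trans h0 _; apply: mono; lra.
  by rewrite -(tau_ode l0 ch hc' dh' (ltW cx) xpos) tauK.
Qed.

Lemma ae_eq0_defect l c h g : mu.-integrable setT (EFin \o defect m l c h g) ->
  \int[mu]_(x in setT) defect m l c h g x = 0 ->
  \forall x \ae mu, defect m l c h g x = 0.
Proof.
move=> ie I0.
have e0 x : 0 <= defect m l c h g x by exact: sqr_ge0.
have mE : measurable_fun setT (EFin \o defect m l c h g) by have /integrableP[] := ie.
have : (\int[mu]_x `|(defect m l c h g x)%:E| = 0)%E.
  rewrite -(@fineK _ (\int[mu]_x _)%E); last first.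
    by apply: integrable_fin_num => //; apply: integrable_abse.
  congr (_%:E); rewrite -[RHS]I0 /Rintegral; congr fine.
  by apply: eq_integral => x _; rewrite gee0_abs// lee_fin.
move=> /(ae_eq_integral_abs mu measurableT mE).
by apply: ae_imply => x /(_ I) /= [].
Qed.

(* On the plateau [h = 1] the Pohozaev integrand is [- m], elsewhere its
   integral vanishes. *)
Definition pohozaev s : R := 3 * s - (m + 3) * (s * pospow s).

Lemma pohozaev_continuous : continuous pohozaev.
Proof.
apply: continuous_sub; apply: continuous_mul; try exact: continuous_cst.
  exact: continuous_idfun.
by apply: continuous_mul; [exact: continuous_idfun|exact: pospow_continuous].
Qed.

(** The Pohozaev integrand is twice the derivative of [phi phi']. On half of a profile this product
    vanishes at the top because of [phi'] and at the edge because of [phi]. *)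
Lemma half_pohozaev l c a b : 0 < l -> a <= b ->
  (forall x, a < x < b -> `|l * (x - c)| < L) ->
  phi (l * (a - c)) * dphi (l * (a - c)) = 0 ->
  phi (l * (b - c)) * dphi (l * (b - c)) = 0 ->
  \int[mu]_(x in `[a, b]) pohozaev (phi (l * (x - c))) = 0.
Proof.
move=> l0 ab abL Fa Fb.
pose F x := (2 / l) * (phi (l * x + - (l * c)) * dphi (l * x + - (l * c))).
have aff x : l * x + - (l * c) = l * (x - c) by ring.
have caff : continuous (fun x => l * (x - c)).
  apply: continuous_mul; first exact: continuous_cst.
  apply: continuous_sub; [exact: continuous_idfun|exact: continuous_cst].
have cp : continuous (fun x => phi (l * (x - c))).
  by apply: continuous_compose caff _; exact: phi_continuous.
have cpo : continuous (fun x => pohozaev (phi (l * (x - c)))).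
  exact: continuous_compose cp pohozaev_continuous.
transitivity (F b - F a); last by rewrite /F !aff Fa Fb mulr0 subrr.
apply: (@FTC_open _ F (fun x => pohozaev (phi (l * (x - c)))) a b ab).
- apply: continuous_subspaceT; apply: continuous_mul; first exact: continuous_cst.
  under [X in continuous X]eq_fun do rewrite aff.
  apply: continuous_mul => //.
  by apply: continuous_compose caff _; exact: dphi_continuous.
- move=> x xI; have xL := abL x xI; rewrite -aff in xL.
  have d1 := is_derive_phi m_gt0 (l * x + - (l * c)).
  have d2 := is_derive_dphi m_gt0 xL.
  have d := is_derive1_mull (2 / l) (is_derive1_affine (is_derive1_mul d1 d2)).
  apply: (is_derive_eq d); rewrite -!expr2 dphi_sqr// -aff /pohozaev /ddphi.
  by field; rewrite gt_eqF.
- by move=> x _; exact: cpo.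
- exact: continuous_segment_integrable.
Qed.

(** By hypothesis the total Pohozaev integral is zero, and so are the contributions of both half
    profiles; the plateau contributes [- m (c2 - c1)]. *)
Lemma plateau_trivial l c1 c2 h : 0 < l -> continuous h -> c1 <= c2 ->
  (forall x, x <= c1 -> h x = phi (l * (x - c1))) ->
  (forall x, c1 <= x <= c2 -> h x = 1) ->
  (forall x, c2 <= x -> h x = phi (l * (x - c2))) ->
  mu.-integrable setT (EFin \o h) ->
  mu.-integrable setT (EFin \o (fun x => h x * pospow (h x))) ->
  3 * \int[mu]_(x in setT) h x = (m + 3) * \int[mu]_(x in setT) (h x * pospow (h x)) ->
  c1 = c2.
Proof.
move=> l0 ch c12 hL hP ph2 ih ihp poh.
have cpo := continuous_compose ch pohozaev_continuous.
have ipo := continuous_segment_integrable cpo.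
have L0 := half_width_gt0 m_gt0.
have lL : 0 < L / l by rewrite divr_gt0.
have Ipo : \int[mu]_(x in setT) pohozaev (h x) = 0.
  rewrite /pohozaev RintegralB//; [|exact: integrable_Rmull..].
  by rewrite !RintegralZl// poh subrr.
have supp x : ~~ (c1 - L / l <= x <= c2 + L / l) -> h x = 0.
  rewrite negb_and -!ltNge => /orP[xc|xc].
    rewrite hL; last lra.
    rewrite phi_out// ler0_norm; last by rewrite mulr_ge0_le0 ?(ltW l0)//; lra.
    by rewrite -mulrN -ler_pdivrMl// mulrC; lra.
  rewrite ph2; last lra.
  rewrite phi_out// ger0_norm; last by rewrite mulr_ge0 ?(ltW l0)//; lra.
  by rewrite -ler_pdivrMl// mulrC; lra.
move: Ipo; rewrite (@Rintegral_support _ _ _ (c1 - L / l) (c2 + L / l))//; last first.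
  by move=> x _ /supp ->; rewrite /pohozaev mul0r !mulr0 subr0.
have s1 : c1 - L / l <= c1 by lra.
have s2 : c1 <= c2 + L / l by lra.
have s3 : c2 <= c2 + L / l by lra.
have -> := Rintegral_segment_split s1 s2 (ipo _ _).
have -> := Rintegral_segment_split c12 s3 (ipo _ _).
have d0 : dphi 0 = 0 by rewrite /dphi lexx phi0 ?W1.
have lLE : l * (L / l) = L by rewrite mulrC divfK// gt_eqF.
have -> : \int[mu]_(x in `[c1 - L / l, c1]) pohozaev (h x) = 0.
  transitivity (\int[mu]_(x in `[c1 - L / l, c1]) pohozaev (phi (l * (x - c1)))).
    apply: eq_Rintegral => x; rewrite inE/= in_itv/= => /andP[_ xc].
    by rewrite hL.
  apply: half_pohozaev => //.
  - move=> x xI; rewrite ltr0_norm; last by rewrite pmulr_rlt0//; lra.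
    by rewrite -mulrN -ltr_pdivlMl// mulrC; lra.
  - rewrite (_ : l * _ = - L); last by rewrite -[in RHS]lLE; ring.
    by rewrite phi_even phi_out ?mul0r// ger0_norm// ltW.
  - by rewrite subrr mulr0 d0 mulr0.
have -> : \int[mu]_(x in `[c2, c2 + L / l]) pohozaev (h x) = 0.
  transitivity (\int[mu]_(x in `[c2, c2 + L / l]) pohozaev (phi (l * (x - c2)))).
    apply: eq_Rintegral => x; rewrite inE/= in_itv/= => /andP[xc _].
    by rewrite ph2.
  apply: half_pohozaev => //.
  - move=> x xI; rewrite gtr0_norm; last by rewrite pmulr_rgt0//; lra.
    by rewrite -ltr_pdivlMl// mulrC; lra.
  - by rewrite subrr mulr0 d0 mulr0.
  - rewrite (_ : l * _ = L); last by rewrite -[in RHS]lLE; ring.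
    by rewrite phi_out ?mul0r// ger0_norm// ltW.
have -> : \int[mu]_(x in `[c1, c2]) pohozaev (h x) = - m * (c2 - c1).
  transitivity (\int[mu]_(x in `[c1, c2]) (- m)); last by rewrite Rintegral_cst_segment.
  apply: eq_Rintegral => x; rewrite inE/= in_itv/= => xI.
  by rewrite hP// /pohozaev pospow1; ring.
rewrite add0r addr0 => /eqP; rewrite mulf_eq0 oppr_eq0 gt_eqF//= subr_eq0.
by move=> /eqP ->.
Qed.

(** A vanishing defect gives the first-order equation almost everywhere on each side of [c]. Once it
    is upgraded to every point, [ode_right] describes [h] to the right of [c] and its reflection to
    the left, up to a plateau. *)
Lemma rigidity l c h g : 0 < l -> admissible h g -> (forall x, h x <= 1) ->
  h c = 1 ->
  mu.-integrable setT (EFin \o (fun x => h x * pospow (h x))) ->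
  mu.-integrable setT (EFin \o defect m l c h g) ->
  \int[mu]_(x in setT) defect m l c h g x = 0 ->
  3 * \int[mu]_(x in setT) h x = (m + 3) * \int[mu]_(x in setT) (h x * pospow (h x)) ->
  exists c', forall x, h x = phi (l * (x - c')).
Proof.
move=> l0 ahg h1 hc ihp ie I0 poh; have [pg ig h0 ih ig2] := ahg.
have ch := admissible_continuous ahg.
have h01 x : 0 <= h x <= 1 by rewrite h0 h1.
have gae := ae_eq0_defect ie I0.
have cW := continuous_compose ch (W_continuous m_gt0).
have iW k : segment_integrable (fun x => k * W (h x)).
  by apply: continuous_segment_integrable; apply: continuous_mul => //; exact: continuous_cst.
have cWk k : continuous (fun x => k * W (h x)).
  by apply: continuous_mul => //; exact: continuous_cst.
have prim k (P : R -> Prop) : (forall x, P x -> defect m l c h g x = 0 -> g x = k * W (h x)) ->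
   forall a b, a <= b -> (forall x, a <= x <= b -> P x) ->
   h b - h a = \int[mu]_(x in `[a, b]) (k * W (h x)).
  move=> HP a b ab abP; rewrite -pg// /Rintegral; congr fine.
  have mg : measurable_fun `[a, b] (EFin \o g) by have /integrableP[] := ig a b.
  have mW : measurable_fun `[a, b] (EFin \o (fun x => k * W (h x))).
    by have /integrableP[] := iW k a b.
  apply: ae_eq_integral => //.
  apply: ae_imply gae => x dx; rewrite /= in_itv/= => xab.
  by rewrite (HP x)//; exact: abP.
have zero_of_sq (u v : R) : (u - v) ^+ 2 = 0 -> u = v.
  by move=> /eqP; rewrite expf_eq0/= subr_eq0 => /eqP.
(* The integrand [k W(h)] is continuous, so the integral equation makes [h] differentiable at every
   point off [c]. The boolean selects the side of [c]. *)
have deriv k (s : bool) : (forall a b, a <= b ->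
     (if s then c < a else b < c) ->
     h b - h a = \int[mu]_(x in `[a, b]) (k * W (h x))) ->
   forall x, (if s then c < x else x < c) -> is_derive x 1 h (k * W (h x)).
  move=> HP x xc.
  have pA := antiderivative_primitive x (iW k).
  have dA := primitive_is_derive (iW k) pA (cWk k x).
  apply: (@near_is_derive1 _ (fun y => h x + antiderivative x (fun x => k * W (h x)) y)).
    have nearc : \forall y \near x, (if s then c < y else y < c).
      by case: s xc {HP} => xc; [exact: open_gt|exact: lt_nbhsl].
    near=> y.
    have yc : if s then c < y else y < c by near: y.
    have [xy|yx] := leP x y.
      have xcy : if s then c < x else y < c by case: (s) xc yc.
      have := pA _ _ xy; rewrite antiderivative0 subr0 => <-.
      by rewrite -(HP _ _ xy xcy); ring.
    have ycx : if s then c < y else x < c by case: (s) xc yc.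
    have := pA _ _ (ltW yx); rewrite antiderivative0 sub0r => E.
    by have := HP _ _ (ltW yx) ycx; rewrite E; lra.
  rewrite -[X in is_derive _ _ _ X]add0r; apply: is_derive1_add => //.
have dr x : c < x -> is_derive x 1 h (- (l * W (h x))).
  rewrite -mulNr; apply: (deriv (- l) true) => a b ab ca.
  apply: (@prim _ (fun x => c < x)) => // [y cy|y /andP[ay _]].
    by rewrite /defect leNgt cy/= => /zero_of_sq.
  exact: lt_le_trans ay.
have dl x : x < c -> is_derive x 1 h (l * W (h x)).
  apply: (deriv l false) => a b ab bc.
  apply: (@prim _ (fun x => x < c)) => // [y yc|y /andP[_ yb]].
    by rewrite /defect (ltW yc) => /zero_of_sq.
  exact: le_lt_trans bc.
clear prim deriv zero_of_sq gae ie I0 iW cWk cW.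
have half0 : (0 : R) < 1 / 2 by lra.
have [M M0 HM] := admissible_decay ahg half0.
(* Beyond both [c] and [- c], and far enough out that [h <= 1 / 2]: the point below height [1] that
   [ode_right] asks for, both for [h] and for its reflection. *)
pose X := `|c| + M.
have Xc : c <= X by rewrite /X; have := ler_norm c; lra.
have Xnc : - c <= X by rewrite /X; have := ler_norm (- c); rewrite normrN; lra.
have XM : M <= X by rewrite /X lerDr.
have X0 : 0 <= X := le_trans M0 XM.
have hX : h X < 1.
  by apply: (@le_lt_trans _ _ (1 / 2)); [apply: HM; rewrite ger0_norm|lra].
have [c2 [cc2 pl2 ph2]] := ode_right l0 ch h01 hc dr Xc hX.
pose hr x := h (- x).
have chr : continuous hr.
  apply: (continuous_compose (f := fun x => - x)) ch.
  by move=> x; apply: continuousN; exact: cvg_id.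
have hrc : hr (- c) = 1 by rewrite /hr opprK.
have dhr x : - c < x -> is_derive x 1 hr (- (l * W (hr x))).
  move=> cx; have xc : - x < c by lra.
  have := is_derive1_chain (is_derive1_opp (is_derive_id x (1 : R))) (dl _ xc).
  by rewrite mulrN1.
have hrX : hr X < 1.
  apply: (@le_lt_trans _ _ (1 / 2)); last lra.
  by apply: HM; rewrite normrN ger0_norm.
have [c1 [cc1 pl1 ph1]] := ode_right l0 chr (fun x => h01 (- x)) hrc dhr Xnc hrX.
have c12 : - c1 <= c2 by lra.
have hL x : x <= - c1 -> h x = phi (l * (x - - c1)).
  move=> xc1; have := ph1 (- x); rewrite /hr opprK => ->; last lra.
  by rewrite -phi_even; congr (phi _); ring.
have hP x : - c1 <= x <= c2 -> h x = 1.
  move=> xI; have [cx|/ltW xc] := leP c x; first by apply: pl2; lra.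
  by have := pl1 (- x); rewrite /hr opprK; apply; lra.
have c2E := plateau_trivial l0 ch c12 hL hP ph2 ih ihp poh.
exists c2 => x; have [xc|/ltW xc] := leP c2 x; first exact: ph2.
by rewrite hL c2E.
Unshelve. all: by end_near. Qed.

End Rigidity.

(** * Bernoulli's inequality with its equality case *)

Section Bernoulli.
Context {R : realType}.
Implicit Types (s q n p : R).

Lemma bernoulli_powR q s : 1 < q -> 0 < s ->
  1 + q * (s - 1) <= s `^ q /\ (s `^ q = 1 + q * (s - 1) -> s = 1).
Proof.
move=> q1 s0.
have pc x : 0 < x -> {for x, continuous (fun y : R => y `^ q)}.
  by move=> x0; apply: is_derive1_continuous (is_derive1_powR q x0).
have q10 : 0 < q - 1 by lra.
have [s1|s1|->] := ltgtP s 1.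
- have [x x01|x x01|x /andP[sx x1] E] := @mean_value _ (fun y => y `^ q)
    (fun y => q * y `^ (q - 1)) s 1 s1.
  + by apply: is_derive1_powR; lra.
  + by apply: pc; lra.
  rewrite powR1 in E.
  have xlt : x `^ (q - 1) < 1.
    rewrite -[ltRHS](congr1 (fun F => F (q - 1)) (powR1 R)).
    by apply: gt0_ltr_powR; rewrite ?nnegrE//; lra.
  have H : 1 + q * (s - 1) < s `^ q.
    have : q * x `^ (q - 1) * (1 - s) < q * (1 - s).
      by rewrite ltr_pM2r ?subr_gt0// gtr_pMr//; lra.
    by lra.
  by split; [exact: ltW|move=> E'; move: H; rewrite E' ltxx].
- have [x x01|x x01|x /andP[sx x1] E] := @mean_value _ (fun y => y `^ q)
    (fun y => q * y `^ (q - 1)) 1 s s1.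
  + by apply: is_derive1_powR; lra.
  + by apply: pc; lra.
  rewrite powR1 in E.
  have xlt : 1 < x `^ (q - 1).
    rewrite -[ltLHS](congr1 (fun F => F (q - 1)) (powR1 R)).
    by apply: gt0_ltr_powR; rewrite ?nnegrE//; lra.
  have H : 1 + q * (s - 1) < s `^ q.
    have : q * (s - 1) < q * x `^ (q - 1) * (s - 1).
      by rewrite ltr_pM2r ?subr_gt0// ltr_pMr//; lra.
    by lra.
  by split; [exact: ltW|move=> E'; move: H; rewrite E' ltxx].
- by rewrite powR1 subrr mulr0 addr0.
Qed.

(** For fixed [n], the product [p^(q-1) (n - p)] is largest at [n = t p]; with [s = n / (t p)] the
    claim becomes [1 + q (s - 1) <= s^q]. For [q = (m + 3) / m] the ratio [t] is [(m + 3) / 3]. *)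
Lemma bernoulli_homogeneous q n p : 1 < q -> 0 < n -> 0 < p ->
  let t := q / (q - 1) in
  q * t `^ (q - 1) * p `^ (q - 1) * (n - p) <= n `^ q /\
  (n `^ q = q * t `^ (q - 1) * p `^ (q - 1) * (n - p) <-> n = t * p).
Proof.
move=> q1 n0 p0 t.
have q10 : 0 < q - 1 by lra.
have q0 : 0 < q by lra.
have t0 : 0 < t by rewrite divr_gt0.
pose s := n / (t * p); have s0 : 0 < s by rewrite divr_gt0// mulr_gt0.
have nE : n = s * (t * p) by rewrite divfK// mulf_neq0 ?gt_eqF.
have tp : t * (q - 1) = q by rewrite divfK ?gt_eqF.
have powS (x : R) : 0 < x -> x `^ q = x * x `^ (q - 1).
  by move=> x0; rewrite mulr_powRB1// ltW.
clearbody s t.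
pose C := t `^ (q - 1) * p `^ (q - 1) * (t * p).
have C0 : 0 < C by rewrite !mulr_gt0 ?powR_gt0 ?invr_gt0.
have E1 : n `^ q = C * s `^ q.
  rewrite nE powRM ?mulr_ge0 ?(ltW s0) ?(ltW t0) ?(ltW p0)//.
  by rewrite powRM ?(ltW t0) ?(ltW p0)// (powS t)// (powS p)// /C; ring.
have E2 : q * t `^ (q - 1) * p `^ (q - 1) * (n - p) = C * (1 + q * (s - 1)).
  rewrite /C nE.
  have -> : s * (t * p) - p = p * (s * t - 1) by ring.
  have : t * (1 + q * (s - 1)) = q * (s * t - 1).
    have -> : t * (1 + q * (s - 1)) = q * (s * t) - t * (q - 1) by ring.
    by rewrite tp; ring.
  move=> H; transitivity (t `^ (q - 1) * p `^ (q - 1) * p * (q * (s * t - 1))); first by ring.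
  by rewrite -H; ring.
have [B1 B2] := bernoulli_powR q1 s0.
rewrite E1 E2; split; first by rewrite ler_pM2l.
split=> [/(mulfI (lt0r_neq0 C0))/B2 s1|nt]; first by rewrite nE s1 mul1r.
have -> : s = 1.
  apply: (@mulIf _ (t * p)); first by rewrite mulf_neq0 ?gt_eqF.
  by rewrite -nE mul1r.
by rewrite powR1 subrr mulr0 addr0.
Qed.

End Bernoulli.

Section Arithmetic.
Context {R : realType}.
Implicit Types (a b d e : R).

Lemma not_eq_add1 d e : 0 <= e -> d <> d + 1 + e.
Proof. by move=> e0 H; lra. Qed.

Lemma solve_addr a b d e : d + a = b + e -> e = d + a - b.
Proof. by move=> ->; ring. Qed.

End Arithmetic.

(** * The sharp constant and the inequality for continuous representatives *)

Section SharpInequality.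
Context {R : realType}.
Local Notation mu := (@lebesgue_measure R).
Variable m : R.
Hypothesis m_gt0 : 0 < m.
Implicit Types (f g h F : R -> R) (x y z c l s A k a b C : R).
Local Notation W := (W m).
Local Notation pospow := (pospow m).
Local Notation phi := (phi m).
Local Notation dphi := (dphi m).
Local Notation K := (intW m 1).
Local Notation q := ((m + 3) / m).
Local Notation t0 := (q / (q - 1)).

(** Put [kappa = q t0^(q-1)]. Multiplying [4 K^2 <= d (n - p)] by [kappa p^(q-1)] and using
    [kappa p^(q-1) (n - p) <= n^q] gives [4 K^2 kappa p^(q-1) <= n^q d]. *)
Definition sharp_constant : R :=
  (4 * K ^+ 2 * (q * t0 `^ (q - 1)))^-1.

Lemma q_gt1 : 1 < q.
Proof. by rewrite ltr_pdivlMr// mul1r ltrDl. Qed.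

Lemma q_sub1 : q - 1 = 3 / m.
Proof. by field; rewrite gt_eqF. Qed.

Lemma t0E : t0 = (m + 3) / 3.
Proof. by rewrite q_sub1; field; rewrite gt_eqF. Qed.

Lemma kappa_gt0 : 0 < q * t0 `^ (q - 1).
Proof.
have q1 := q_gt1; have q0 : 0 < q by apply: lt_trans q1.
by rewrite mulr_gt0// powR_gt0// divr_gt0// subr_gt0.
Qed.

Lemma sharp_constant_gt0 : 0 < sharp_constant.
Proof.
have K0 := intW1_gt0 m_gt0.
by rewrite invr_gt0 mulr_gt0 ?kappa_gt0// mulr_gt0// exprn_gt0.
Qed.

(* The calibration identity for a normalised function, with the multiplier
   [l = 2K / (n - p)] that is optimal when equality holds. *)
Lemma normalized_inequality h g c : admissible h g -> (forall x, h x <= 1) ->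
  h c = 1 ->
  let n := \int[mu]_(x in setT) h x in
  let p := \int[mu]_(x in setT) (h x * pospow (h x)) in
  let d := \int[mu]_(x in setT) g x ^+ 2 in
  [/\ mu.-integrable setT (EFin \o (fun x => h x * pospow (h x))),
      0 <= p, p < n, 4 * K ^+ 2 <= d * (n - p) &
   d * (n - p) = 4 * K ^+ 2 -> 3 * n = (m + 3) * p ->
     exists k c', 0 < k /\ forall x, h x = phi (k * (x - c'))].
Proof.
move=> ahg h1 hc n p d; have K0 := intW1_gt0 m_gt0.
have [pg ig h0 ih ig2] := ahg.
have e0 l : 0 <= \int[mu]_(x in setT) defect m l c h g x.
  by apply: Rintegral_ge0 => x _; exact: sqr_ge0.
have cal l : 0 < l -> d + l ^+ 2 * (n - p) =
    4 * l * K + \int[mu]_(x in setT) defect m l c h g x.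
  by move=> l0; have [] := calibration m_gt0 l0 ahg h1 hc.
have [ihp _ _] := calibration m_gt0 ltr01 ahg h1 hc.
have p0 : 0 <= p by apply: Rintegral_ge0 => x _; rewrite mulr_ge0 ?pospow_ge0.
have d0 : 0 <= d by apply: Rintegral_ge0 => x _; exact: sqr_ge0.
have np : 0 <= n - p.
  rewrite /n /p -RintegralB//; apply: Rintegral_ge0 => x _.
  by rewrite -[X in X - _]mulr1 -mulrBr mulr_ge0// subr_ge0 -(pospow1 m) pospow_mono.
have np0 : 0 < n - p.
  move: np; rewrite le_eqVlt => /predU1P[E|//].
  (* If [n = p], calibration would give [d >= 4 l K] for every [l > 0]; this [l] turns it into
     [d >= d + 1]. *)
  have l0 : 0 < (d + 1) / (4 * K) by rewrite divr_gt0 ?mulr_gt0// ltr_wpDl.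
  have := cal _ l0; rewrite -E mulr0 addr0.
  have -> : 4 * ((d + 1) / (4 * K)) * K = d + 1 by field; rewrite gt_eqF.
  by move=> /(not_eq_add1 (e0 _)).
pose l := 2 * K / (n - p); have l0 : 0 < l by rewrite divr_gt0// mulr_gt0.
have calE : d * (n - p) = 4 * K ^+ 2 +
    (n - p) * \int[mu]_(x in setT) defect m l c h g x.
  have := cal l l0.
  have -> : l ^+ 2 * (n - p) = 4 * K ^+ 2 / (n - p) by rewrite /l; field; rewrite gt_eqF.
  have -> : 4 * l * K = 8 * K ^+ 2 / (n - p) by rewrite /l; field; rewrite gt_eqF.
  by move=> /solve_addr ->; field; rewrite gt_eqF.
split => //; first by rewrite -subr_gt0.
  by rewrite calE lerDl mulr_ge0// ltW.
move=> E poh; have [_ ie _] := calibration m_gt0 l0 ahg h1 hc.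
have I0 : \int[mu]_(x in setT) defect m l c h g x = 0.
  move: E; rewrite calE -[RHS]addr0 => /addrI /eqP.
  by rewrite mulf_eq0 gt_eqF//= => /eqP.
have [c' hE] := rigidity m_gt0 l0 ahg h1 hc ihp ie I0 poh.
by exists l, c'.
Qed.

Lemma admissible_scale A h g : 0 < A -> admissible h g ->
  admissible (fun x => A * h x) (fun x => A * g x).
Proof.
move=> A0 [pg ig h0 ih ig2]; split.
- by move=> a b ab; rewrite RintegralZl// pg// mulrBr.
- by move=> a b; exact: integrable_Rmull.
- by move=> x; rewrite mulr_ge0// ltW.
- exact: integrable_Rmull.
- rewrite (_ : (fun x => _) = fun x => A ^+ 2 * g x ^+ 2); first exact: integrable_Rmull.
  by apply/funext => x; rewrite exprMn.
Qed.

Lemma pospowM A s : 0 <= A -> 0 <= s -> pospow (A * s) = A `^ m * pospow s.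
Proof. by move=> A0 s0; rewrite !pospowE ?mulr_ge0// powRM. Qed.

(** Both sides of the inequality have the same degree in the amplitude:
    [q + 2 = (m + 1) (3 / m)]. *)
Lemma powR_qD2 A : 0 < A -> A `^ q * A ^+ 2 = (A `^ (m + 1)) `^ (3 / m).
Proof.
move=> A0; rewrite -powRrM -(powR_mulrn 2 (ltW A0)) -powRD; last first.
  by rewrite (gt_eqF A0) implybT.
by congr (_ `^ _); field; rewrite gt_eqF.
Qed.

(** By homogeneity the maximum may be scaled to [1]. The bound chains calibration with Bernoulli, so
    equality forces both to be sharp: Bernoulli then yields [3 n = (m + 3) p] and calibration
    [d (n - p) = 4 K^2], exactly what the rigidity statement takes. *)
Lemma sharp_inequality h g : admissible h g ->
  let N := \int[mu]_(x in setT) h x in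
  let P := \int[mu]_(x in setT) (h x * pospow (h x)) in
  let D := \int[mu]_(x in setT) g x ^+ 2 in
  [/\ mu.-integrable setT (EFin \o (fun x => h x * pospow (h x))),
      0 <= N, 0 <= P, P `^ (3 / m) <= sharp_constant * N `^ q * D &
   (exists x, 0 < h x) -> P `^ (3 / m) = sharp_constant * N `^ q * D ->
     exists A k c', [/\ 0 < A, 0 < k & forall x, h x = A * phi (k * (x - c'))]].
Proof.
move=> ahg N P D; have K0 := intW1_gt0 m_gt0.
have [pg ig h0 ih ig2] := ahg.
have C0 := sharp_constant_gt0; have kap0 := kappa_gt0.
have N0 : 0 <= N by apply: Rintegral_ge0.
have D0 : 0 <= D by apply: Rintegral_ge0 => x _; exact: sqr_ge0.
have P0 : 0 <= P by apply: Rintegral_ge0 => x _; rewrite mulr_ge0 ?pospow_ge0.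
have [[x0 hx0]|hn] := pselect (exists x, 0 < h x); last first.
  have hE x : h x = 0.
    apply/eqP; rewrite eq_le h0 andbT leNgt; apply/negP => hx; apply: hn.
    by exists x.
  have PE : P = 0.
    rewrite /P (_ : (fun x => _) = cst 0) ?/Rintegral ?integral0//.
    by apply/funext => x; rewrite hE mul0r.
  split => //.
  - rewrite (_ : (fun x => _) = h) //.
    by apply/funext => x; rewrite hE mul0r.
  - by rewrite PE powR0 ?mulr_ge0 ?powR_ge0 ?(ltW C0)// gt_eqF// divr_gt0.
have [c hc] := admissible_argmax ahg hx0.
pose A := h c; have A0 : 0 < A := lt_le_trans hx0 (hc x0).
have Ai0 : 0 < A^-1 by rewrite invr_gt0.
have an := admissible_scale Ai0 ahg.
have h1 x : A^-1 * h x <= 1 by rewrite ler_pdivrMl// mulr1.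
have hc1 : A^-1 * h c = 1 by rewrite mulVf// gt_eqF.
have := normalized_inequality an h1 hc1.
set n := (\int[mu]_(x in setT) (A^-1 * h x)).
set p := (\int[mu]_(x in setT) (A^-1 * h x * pospow (A^-1 * h x))).
set d := (\int[mu]_(x in setT) (A^-1 * g x) ^+ 2).
move=> /= [ihp p0 pn dK rig].
have nE : N = A * n by rewrite /n RintegralZl// mulrA divff ?mul1r// gt_eqF.
have dE : D = A ^+ 2 * d.
  rewrite /d; under [in RHS]eq_Rintegral do rewrite exprMn.
  by rewrite RintegralZl// mulrA -exprMn divff ?expr1n ?mul1r// gt_eqF.
have hpE x : h x * pospow (h x) = A `^ (m + 1) * (A^-1 * h x * pospow (A^-1 * h x)).
  have hAE : h x = A * (A^-1 * h x) by rewrite mulrA divff ?mul1r// gt_eqF.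
  have v0 : 0 <= A^-1 * h x by rewrite mulr_ge0// ltW.
  rewrite {1 2}hAE pospowM ?(ltW A0)// -(mul_pospow m_gt0 (ltW A0)).
  by rewrite (pospowE m (ltW A0)); ring.
have pE : P = A `^ (m + 1) * p.
  by rewrite /p -RintegralZl//; apply: eq_Rintegral => x _; rewrite hpE.
have ihP : mu.-integrable setT (EFin \o (fun x => h x * pospow (h x))).
  by rewrite (funext hpE); exact: integrable_Rmull.
clearbody n p d N P D.
have np0 : 0 < n - p by rewrite subr_gt0.
have n0 : 0 < n by lra.
have Aq : 0 < A `^ q * A ^+ 2 by rewrite mulr_gt0 ?powR_gt0 ?exprn_gt0.
have lhsE : P `^ (3 / m) = A `^ q * A ^+ 2 * p `^ (q - 1).
  by rewrite pE powRM ?powR_ge0// -powR_qD2// q_sub1.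
have rhsE : sharp_constant * N `^ q * D =
    A `^ q * A ^+ 2 * (sharp_constant * n `^ q * d).
  by rewrite nE powRM ?(ltW A0) ?(ltW n0)// dE; ring.
have d0 : 0 < d.
  have K2 : 0 < 4 * K ^+ 2 by rewrite mulr_gt0// exprn_gt0.
  by have := lt_le_trans K2 dK; rewrite pmulr_lgt0.
have CK : sharp_constant * (q * t0 `^ (q - 1)) * (4 * K ^+ 2) = 1.
  rewrite -mulrA [q * _ * _]mulrC /sharp_constant mulVf//.
  by rewrite gt_eqF// mulr_gt0// mulr_gt0// exprn_gt0.
have chain : 0 < p ->
   sharp_constant * (q * t0 `^ (q - 1) * p `^ (q - 1) * (n - p)) * d <=
   sharp_constant * n `^ q * d.
  move=> p0'; rewrite ler_pM2r// ler_pM2l//.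
  by have [] := bernoulli_homogeneous q_gt1 n0 p0'.
have low : p `^ (q - 1) <=
    sharp_constant * (q * t0 `^ (q - 1) * p `^ (q - 1) * (n - p)) * d.
  have -> : sharp_constant * (q * t0 `^ (q - 1) * p `^ (q - 1) * (n - p)) * d =
    p `^ (q - 1) * (sharp_constant * (q * t0 `^ (q - 1)) * (d * (n - p))) by ring.
  rewrite -[leLHS]mulr1 ler_wpM2l ?powR_ge0// -[leLHS]CK ler_pM2l//.
  exact: mulr_gt0.
have main : p `^ (q - 1) <= sharp_constant * n `^ q * d.
  move: p0; rewrite le_eqVlt => /predU1P[<-|p0'].
    rewrite powR0; last by rewrite gt_eqF// q_sub1 divr_gt0.
    by rewrite !mulr_ge0 ?powR_ge0 ?(ltW C0) ?(ltW d0).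
  exact: le_trans low (chain p0').
split => //; first by rewrite lhsE rhsE ler_pM2l.
move=> _; rewrite lhsE rhsE => /(mulfI (lt0r_neq0 Aq)) E.
(* For [p = 0] equality would make the positive number [n^q d] vanish; positivity of [p] allows
   Bernoulli and the cancellation of [p^(q-1)]. *)
have p0' : 0 < p.
  rewrite lt0r p0 andbT; apply/eqP => pz; move: E; rewrite pz powR0; last first.
    by rewrite gt_eqF// q_sub1 divr_gt0.
  by move=> /esym/eqP; rewrite gt_eqF// !mulr_gt0 ?powR_gt0.
have ch := chain p0'.
have E1 : n `^ q = q * t0 `^ (q - 1) * p `^ (q - 1) * (n - p).
  have : sharp_constant * n `^ q * d =
    sharp_constant * (q * t0 `^ (q - 1) * p `^ (q - 1) * (n - p)) * d.
    by apply: le_anti; rewrite ch -E low.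
  by move=> /(mulIf (lt0r_neq0 d0))/(mulfI (lt0r_neq0 C0)).
have [_ [/(_ E1) ntp _]] := bernoulli_homogeneous q_gt1 n0 p0'.
have poh : 3 * n = (m + 3) * p by rewrite ntp t0E; field.
have dKE : d * (n - p) = 4 * K ^+ 2.
  move: E; rewrite E1.
  have -> : sharp_constant * (q * t0 `^ (q - 1) * p `^ (q - 1) * (n - p)) * d =
    p `^ (q - 1) * (sharp_constant * (q * t0 `^ (q - 1)) * (d * (n - p))) by ring.
  rewrite -[LHS]mulr1 => /(mulfI (lt0r_neq0 (powR_gt0 _ p0'))).
  rewrite -[LHS]CK => /mulfI H; apply/esym; apply: H.
  by rewrite mulf_neq0 ?gt_eqF.
have [k [c' [k0 hE]]] := rig dKE poh.
exists A, k, c'; split => // x.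
by rewrite -hE mulrA divff ?mul1r// lt0r_neq0.
Qed.

End SharpInequality.

(** * Optimizers *)

Section Norms.
Context {R : realType}.
Local Notation mu := (@lebesgue_measure R).
Implicit Types (f g h F : R -> R) (r : R).

Lemma Lnorm_ae_ge0 r f h : 0 < r -> measurable_fun setT f -> continuous h ->
  (forall x, 0 <= h x) -> f = h %[ae mu] ->
  mu.-integrable setT (EFin \o (fun x => h x `^ r)) ->
  ('N[mu]_(r%:E)[EFin \o f] = ((\int[mu]_(x in setT) (h x `^ r)) `^ r^-1)%:E)%E.
Proof.
move=> r0 mf ch h0 fh ih.
rewrite unlock -poweR_EFin; congr (_ `^ _)%E.
rewrite /Rintegral fineK; last exact: integrable_fin_num ih.
have mp F : measurable_fun setT F ->
    measurable_fun setT (fun x => (`|(F x)%:E| `^ r)%E).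
  move=> mF; under eq_fun do rewrite abse_EFin poweR_EFin.
  apply/measurable_EFinP; apply: (measurableT_comp (measurable_powR _)).
  exact: measurableT_comp.
have mh : measurable_fun setT h.
  by apply: continuous_measurable_fun.
transitivity (\int[mu]_x (`|(h x)%:E| `^ r))%E; last first.
  by apply: eq_integral => x _; rewrite abse_EFin poweR_EFin ger0_norm.
apply: ae_eq_integral; [exact: measurableT|exact: mp|exact: mp|].
by apply: ae_imply fh => x fx _ /=; rewrite fx.
Qed.

Lemma Lnorm2_sqr g : mu.-integrable setT (EFin \o (fun x => g x ^+ 2)) ->
  ('N[mu]_(2%:E)[EFin \o g] ^+ 2 = (\int[mu]_(x in setT) (g x ^+ 2))%:E)%E.
Proof.
move=> ig.
have -> : ('N[mu]_(2%:E)[EFin \o g] =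
    ((\int[mu]_(x in setT) (g x ^+ 2)) `^ 2^-1)%:E)%E.
  rewrite unlock -poweR_EFin; congr (_ `^ _)%E.
  rewrite /Rintegral fineK; last exact: integrable_fin_num ig.
  apply: eq_integral => x _.
  by rewrite abse_EFin poweR_EFin powR_mulrn// -normrX ger0_norm// sqr_ge0.
rewrite -EFin_expe -powR_mulrn ?powR_ge0// -powRrM mulVf ?pnatr_eq0// powRr1//.
by apply: Rintegral_ge0 => x _; exact: sqr_ge0.
Qed.

Lemma support_Lfun F a b r : continuous F ->
  (forall x, ~~ (a <= x <= b) -> F x = 0) -> 0 < r -> F \in Lfun mu r%:E.
Proof.
move=> cF sF r0; rewrite inE; apply/andP; split; rewrite inE/=.
  exact: continuous_measurable_fun.
rewrite /finite_norm unlock poweR_lty//.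
have i : mu.-integrable setT (EFin \o (fun x => pospow r `|F x|)).
  apply: (@integrable_support _ _ a b).
    apply: continuous_compose; last exact: pospow_continuous.
    by move=> x; apply: cvg_norm; exact: cF.
  by move=> x /sF ->; rewrite normr0 pospow_le0.
have /integrableP[_ /(le_lt_trans _)] := i; apply.
rewrite le_eqVlt; apply/orP; left; apply/eqP; apply: eq_integral => x _ /=.
by rewrite pospowE// [in RHS]ger0_norm ?powR_ge0.
Qed.

End Norms.

(** * Translation of the inequality to continuous representatives *)

Section SzNagyReduction.
Context {R : realType}.
Local Notation mu := (@lebesgue_measure R).
Variable m : R.
Hypothesis m_gt0 : 0 < m.
Implicit Types (f g h F : R -> R) (x y z c l s A k a b C : R).
Local Notation pospow := (pospow m).
Local Notation q := ((m + 3) / m).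

Lemma Lfun_measurable (r : \bar R) f : f \in Lfun mu r -> measurable_fun setT f.
Proof. by rewrite inE => /andP[]; rewrite inE. Qed.

(** The representative is the integral of [g]; continuity upgrades its sign from almost everywhere
    to everywhere. *)
Lemma sz_nagy_pair_admissible f g : sz_nagy_pair f g ->
  exists2 h, admissible h g & f = h %[ae mu].
Proof.
move=> [f1 f0 fg g2].
have [h [ph fh]] := weak_derivative_primitive fg.
have [_ lg _] := fg.
have ig : segment_integrable g by apply/locally_integrable_segment.
have ch : continuous h := primitive_continuous ig ph.
exists h => //; split => //.
- apply: continuous_ae_ge0 => //.
  by apply: ae_imply2 f0 fh => x + fx; rewrite fx.
- have mh : measurable_fun setT (EFin \o h).
    by apply/measurable_EFinP; exact: continuous_measurable_fun.
  have /integrableP[mf fi] : mu.-integrable setT (EFin \o f).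
    exact/Lfun1_integrable.
  apply/integrableP; split => //; apply: le_lt_trans fi.
  rewrite le_eqVlt; apply/orP; left; apply/eqP.
  apply: ae_eq_integral => //; [exact: measurableT_comp|exact: measurableT_comp|].
  by apply: ae_imply fh => x fx _ /=; rewrite fx.
- exact: Lfun2_integrable_sqr.
Qed.

Lemma sz_nagy_lhsE f h : measurable_fun setT f -> continuous h ->
  (forall x, 0 <= h x) -> f = h %[ae mu] ->
  mu.-integrable setT (EFin \o (fun x => h x * pospow (h x))) ->
  sz_nagy_lhs m f =
    ((\int[mu]_(x in setT) (h x * pospow (h x))) `^ (3 / m))%:E.
Proof.
move=> mf ch h0 fh ih; rewrite /sz_nagy_lhs.
have hE : (fun x => h x * pospow (h x)) = fun x => h x `^ (m + 1).
  by apply/funext => x; rewrite mul_pospow.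
rewrite hE in ih *; rewrite (@Lnorm_ae_ge0 _ (m + 1) f h)//; last first.
  by rewrite addr_gt0.
rewrite poweR_EFin -powRrM; congr ((_ `^ _)%:E).
by field; rewrite !gt_eqF//= addr_gt0.
Qed.

Lemma sz_nagy_Lnorm1 f h : measurable_fun setT f -> continuous h ->
  (forall x, 0 <= h x) -> f = h %[ae mu] -> mu.-integrable setT (EFin \o h) ->
  ('N[mu]_1[EFin \o f] = (\int[mu]_(x in setT) h x)%:E)%E.
Proof.
move=> mf ch h0 fh ih.
have hE : h = fun x => h x `^ 1 by apply/funext => x; rewrite powRr1.
have := @Lnorm_ae_ge0 _ 1 f h ltr01 mf ch h0 fh; rewrite -hE => /(_ ih) ->.
by rewrite invr1 powRr1//; apply: Rintegral_ge0.
Qed.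

Lemma sz_nagy_rhsE C f g h : measurable_fun setT f -> admissible h g ->
  f = h %[ae mu] ->
  sz_nagy_rhs m C f g = (C * (\int[mu]_(x in setT) h x) `^ q *
    \int[mu]_(x in setT) (g x ^+ 2))%:E.
Proof.
move=> mf ahg fh; have [pg ig h0 ih ig2] := ahg.
have ch := admissible_continuous ahg.
by rewrite /sz_nagy_rhs (sz_nagy_Lnorm1 mf ch)// Lnorm2_sqr// poweR_EFin -!EFinM.
Qed.

End SzNagyReduction.

(** * Scaled profiles as optimizers *)

Section Profile.
Context {R : realType}.
Local Notation mu := (@lebesgue_measure R).
Variable m : R.
Hypothesis m_gt0 : 0 < m.
Implicit Types (f g h F : R -> R) (x y z c l s A k a b C : R).
Local Notation W := (W m).
Local Notation pospow := (pospow m).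
Local Notation phi := (phi m).
Local Notation dphi := (dphi m).
Local Notation L := (half_width m).
Local Notation q := ((m + 3) / m).
Local Notation t0 := (q / (q - 1)).
Local Notation phi_mass := (phi_mass m).
Local Notation phi_power := (phi_power m).

Lemma phi_power_gt0 : 0 < phi_power.
Proof.
have := phi_pohozaev m_gt0; have := phi_mass_gt0 m_gt0 => n0 E.
have : 0 < (m + 3) * phi_power by rewrite -E mulr_gt0.
by rewrite pmulr_rgt0// addr_gt0.
Qed.

(** The profile makes both links of the chain sharp: Pohozaev is the equality case of Bernoulli, and
    [phi_mass - phi_power = 2 K] is also its Dirichlet integral. *)
Lemma phi_equality : phi_power `^ (q - 1) =
  sharp_constant m * phi_mass `^ q * (phi_mass - phi_power).
Proof.
have n0 := phi_mass_gt0 m_gt0; have p0 := phi_power_gt0.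
have [_ [_ ->]] := bernoulli_homogeneous (q_gt1 m_gt0) n0 p0; last first.
  by rewrite t0E// mulrAC -phi_pohozaev// mulrAC divff ?mul1r// pnatr_eq0.
have K0 := intW1_gt0 m_gt0; have kap := kappa_gt0 m_gt0.
rewrite phi_calibration// /sharp_constant.
set kp := q * t0 `^ (q - 1) in kap *.
by field; rewrite !gt_eqF.
Qed.

(** Amplitude and dilation are independent here, since the inequality is invariant under both;
    steady states correspond to a curve in this family. *)
Definition profile A k x : R := A * phi (k * x).

Definition dprofile A k x : R := A * (k * dphi (k * x)).

Section ScaledProfile.
Variables A k : R.
Hypotheses (A_gt0 : 0 < A) (k_gt0 : 0 < k).
Local Notation U := (profile A k).
Local Notation dU := (dprofile A k).

Lemma scaled_continuous f : continuous f -> continuous (fun x => f (k * x)).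
Proof.
move=> cf; apply: continuous_compose => //.
by apply: continuous_mul; [exact: continuous_cst|exact: continuous_idfun].
Qed.

Lemma profile_continuous : continuous U.
Proof.
apply: continuous_mul; first exact: continuous_cst.
by apply: scaled_continuous; exact: phi_continuous.
Qed.

Lemma dprofile_continuous : continuous dU.
Proof.
apply: continuous_mul; first exact: continuous_cst.
apply: continuous_mul; first exact: continuous_cst.
by apply: scaled_continuous; exact: dphi_continuous.
Qed.

Lemma is_derive_profile x : is_derive x 1 U (dU x).
Proof.
apply: is_derive1_mull.
have H : is_derive (k * x + 0) 1 phi (dphi (k * x)).
  by rewrite addr0; exact: is_derive_phi.
have := is_derive1_affine H.
by rewrite (_ : (fun t => phi (k * t + 0)) = fun t => phi (k * t))//;
  apply/funext => t; rewrite addr0.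
Qed.

Local Notation ell := (L / k).

Lemma ell_gt0 : 0 < ell. Proof. by rewrite divr_gt0// half_width_gt0. Qed.

Lemma scaled_support f : (forall x, ~~ (- L <= x <= L) -> f x = 0) ->
  forall x, ~~ (- ell <= x <= ell) -> f (k * x) = 0.
Proof.
move=> sf x H; apply: sf; apply: contra H.
by rewrite -mulNr ler_pdivrMr// ler_pdivlMr// ![_ * k]mulrC.
Qed.

Lemma profile_support x : ~~ (- ell <= x <= ell) -> U x = 0.
Proof.
by move=> H; rewrite /profile (scaled_support (@phi_support _ _ m_gt0) H) mulr0.
Qed.

Lemma dprofile_support x : ~~ (- ell <= x <= ell) -> dU x = 0.
Proof.
move=> H.
by rewrite /dprofile (scaled_support (@dphi_support _ _ m_gt0) H) !mulr0.
Qed.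

Lemma profile_ge0 x : 0 <= U x.
Proof. by rewrite mulr_ge0 ?(ltW A_gt0)//; have /andP[] := phi_01 m_gt0 (k * x). Qed.

Lemma profile_piecewise_C1 : piecewise_C1 [::] U dU.
Proof.
split=> [|x _|x _|]; first exact: profile_continuous.
- exact: is_derive_profile.
- exact: dprofile_continuous.
- exact: continuous_segment_integrable dprofile_continuous.
Qed.

Lemma admissible_profile : admissible U dU.
Proof.
split.
- exact: piecewise_C1_primitive profile_piecewise_C1.
- exact: continuous_segment_integrable dprofile_continuous.
- exact: profile_ge0.
- exact: integrable_support profile_continuous profile_support.
- apply: (@integrable_support _ _ (- ell) ell).
    by rewrite /GRing.exp/=; exact: continuous_mul dprofile_continuous dprofile_continuous.
  by move=> x /dprofile_support ->; rewrite expr0n.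
Qed.

Lemma profile_mass : \int[mu]_(x in setT) U x = A / k * phi_mass.
Proof.
rewrite /profile RintegralZl//; last first.
  apply: (@integrable_support _ _ (- ell) ell).
    by apply: scaled_continuous; exact: phi_continuous.
  exact: scaled_support (@phi_support _ _ m_gt0).
rewrite (@Rintegral_scale _ _ L)//; last 3 first.
- exact: phi_continuous.
- exact: phi_support.
- by rewrite ltW// half_width_gt0.
by rewrite mulrA.
Qed.

Lemma profile_power : \int[mu]_(x in setT) (U x * pospow (U x)) =
  A `^ (m + 1) / k * phi_power.
Proof.
have E x : U x * pospow (U x) =
    A `^ (m + 1) * (phi (k * x) * pospow (phi (k * x))).
  have /andP[p0 _] := phi_01 m_gt0 (k * x).
  rewrite /profile pospowM ?(ltW A_gt0)// -(mul_pospow m_gt0 (ltW A_gt0)).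
  by rewrite (pospowE m (ltW A_gt0)); ring.
pose F y := phi y * pospow (phi y).
have sp x : ~~ (- L <= x <= L) -> F x = 0.
  by move=> /(@phi_support _ _ m_gt0) H; rewrite /F H mul0r.
have cp : continuous F := phi_mul_pospow_continuous m_gt0.
have iF : mu.-integrable setT (EFin \o (fun x => F (k * x))).
  apply: (@integrable_support _ _ (- ell) ell); first exact: scaled_continuous.
  exact: scaled_support.
transitivity (\int[mu]_(x in setT) (A `^ (m + 1) * F (k * x))).
  by apply: eq_Rintegral => x _; exact: E.
rewrite (RintegralZl _ measurableT iF).
rewrite (@Rintegral_scale _ F L)//; first by rewrite mulrA.
by rewrite ltW// half_width_gt0.
Qed.

Lemma profile_gradient : \int[mu]_(x in setT) (dU x ^+ 2) =
  A ^+ 2 * k * (phi_mass - phi_power).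
Proof.
have E x : dU x ^+ 2 = A ^+ 2 * k ^+ 2 * (dphi (k * x) ^+ 2).
  by rewrite /dprofile; ring.
pose F y := dphi y ^+ 2.
have sp x : ~~ (- L <= x <= L) -> F x = 0.
  by move=> /(@dphi_support _ _ m_gt0) H; rewrite /F H expr0n.
have cp : continuous F.
  by apply: continuous_mul; exact: dphi_continuous.
have iF : mu.-integrable setT (EFin \o (fun x => F (k * x))).
  apply: (@integrable_support _ _ (- ell) ell); first exact: scaled_continuous.
  exact: scaled_support.
transitivity (\int[mu]_(x in setT) (A ^+ 2 * k ^+ 2 * F (k * x))).
  by apply: eq_Rintegral => x _; exact: E.
rewrite (RintegralZl _ measurableT iF).
rewrite (@Rintegral_scale _ F L)//; last by rewrite ltW// half_width_gt0.
by rewrite /F phi_gradient//; field; rewrite gt_eqF.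
Qed.

(** Both sides scale alike: the powers of [A] match by [powR_qD2], and the dilation gives [k^(-3/m)]
    on the left against [k^(-q) k] on the right. *)
Lemma profile_equality :
  (\int[mu]_(x in setT) (U x * pospow (U x))) `^ (3 / m) =
  sharp_constant m * (\int[mu]_(x in setT) U x) `^ q *
    \int[mu]_(x in setT) (dU x ^+ 2).
Proof.
have n0 := phi_mass_gt0 m_gt0; have p0 := phi_power_gt0.
have ki : 0 < k^-1 by rewrite invr_gt0.
rewrite profile_power profile_mass profile_gradient.
rewrite powRM ?divr_ge0 ?powR_ge0 ?(ltW k_gt0) ?(ltW p0)//.
rewrite powRM ?powR_ge0 ?(ltW ki)// -powR_qD2// -q_sub1// phi_equality.
rewrite powRM ?divr_ge0 ?(ltW A_gt0) ?(ltW k_gt0) ?(ltW n0)//.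
rewrite powRM ?(ltW A_gt0) ?(ltW ki)//.
have -> : k^-1 `^ q = k^-1 * k^-1 `^ (q - 1).
  have q0 : 0 < q by apply: lt_trans (q_gt1 m_gt0).
  by rewrite mulr_powRB1// ltW.
by field; rewrite gt_eqF.
Qed.

Lemma profile_Lfun (r : R) : 0 < r -> U \in Lfun mu r%:E.
Proof. exact: support_Lfun profile_continuous profile_support. Qed.

Lemma dprofile_Lfun (r : R) : 0 < r -> dU \in Lfun mu r%:E.
Proof. exact: support_Lfun dprofile_continuous dprofile_support. Qed.

Lemma profile_weak_derivative : weak_derivative setT 1 U dU.
Proof. exact: piecewise_C1_weak_derivative profile_piecewise_C1. Qed.

Lemma profile_H1 : H1 U.
Proof.
split; first exact: profile_Lfun.
exists dU; split; [exact: profile_weak_derivative|exact: dprofile_Lfun].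
Qed.

Lemma profile_sz_nagy_pair : sz_nagy_pair U dU.
Proof.
split; [exact: profile_Lfun|exact/nearW/profile_ge0| |exact: dprofile_Lfun].
exact: profile_weak_derivative.
Qed.

End ScaledProfile.

Lemma integrable_profile_power A k : 0 < A -> 0 < k -> mu.-integrable setT
  (EFin \o (fun x => profile A k x * pospow (profile A k x))).
Proof.
move=> A0 k0; have [] := sharp_inequality m_gt0 (admissible_profile A0 k0).
by [].
Qed.

(** The profile itself rules out smaller constants. The set of valid constants is thus a closed
    half-line whose infimum is attained. *)
Lemma sz_nagy_inequalityE C : sz_nagy_inequality m C <-> sharp_constant m <= C.
Proof.
split=> [H|CC f g fg].
  have := H _ _ (profile_sz_nagy_pair ltr01 ltr01).
  have ap := admissible_profile ltr01 ltr01.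
  have cp := @profile_continuous 1 1.
  have mp : measurable_fun setT (profile 1 1) by exact: continuous_measurable_fun.
  have pE : profile 1 1 = profile 1 1 %[ae mu] by exact: ae_eq_refl.
  rewrite (sz_nagy_lhsE m_gt0 mp cp)//; last 2 first.
  - exact: profile_ge0.
  - exact: integrable_profile_power.
  rewrite (sz_nagy_rhsE _ _ mp ap pE) profile_equality// lee_fin.
  rewrite profile_mass// profile_gradient// !ler_pM2r//.
  - rewrite powR_gt0// mulr_gt0 ?divr_gt0 ?phi_mass_gt0//.
  - rewrite mulr_gt0 ?mulr_gt0// phi_calibration// mulr_gt0// intW1_gt0//.
have [h ahg fh] := sz_nagy_pair_admissible fg.
have [f1 _ _ _] := fg; have mf := Lfun_measurable f1.
have ch := admissible_continuous ahg; have [_ _ h0 _ _] := ahg.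
have [ih N0 P0 le _] := sharp_inequality m_gt0 ahg.
rewrite (sz_nagy_lhsE m_gt0 mf ch h0 fh ih) (sz_nagy_rhsE _ _ mf ahg fh).
rewrite lee_fin (le_trans le)// -!mulrA ler_wpM2r// mulr_ge0 ?powR_ge0//.
by apply: Rintegral_ge0 => x _; exact: sqr_ge0.
Qed.

Lemma sz_nagy_constantE : sz_nagy_constant m = sharp_constant m.
Proof.
rewrite /sz_nagy_constant.
have -> : [set C | sz_nagy_inequality m C] = `[sharp_constant m, +oo[%classic.
  apply/seteqP; split=> C /=; rewrite in_itv/= andbT;
    by [move/sz_nagy_inequalityE|move=> ?; exact/sz_nagy_inequalityE].
by rewrite inf_itv.
Qed.

Lemma profile_optimizer A k : 0 < A -> 0 < k -> sz_nagy_optimizer m (profile A k).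
Proof.
move=> A0 k0; split.
  move=> E; have : profile A k = cst 0.
    by apply: continuous_ae_eq E; [exact: profile_continuous|exact: continuous_cst].
  move=> /(congr1 (fun F => F 0)); rewrite /profile mulr0 phi0// mulr1 /= => E0.
  by move: A0; rewrite E0 ltxx.
exists (dprofile A k); split; first exact: profile_sz_nagy_pair.
have cp := @profile_continuous A k.
have mp : measurable_fun setT (profile A k) by exact: continuous_measurable_fun.
have pE : profile A k = profile A k %[ae mu] by exact: ae_eq_refl.
rewrite (sz_nagy_lhsE m_gt0 mp cp)//; last 2 first.
- exact: profile_ge0.
- exact: integrable_profile_power.
rewrite (sz_nagy_rhsE _ _ mp (admissible_profile A0 k0) pE).
by rewrite profile_equality// sz_nagy_constantE.
Qed.

Lemma optimizer_profile u : sz_nagy_optimizer m u ->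
  exists A k c, [/\ 0 < A, 0 < k & u = (fun x => profile A k (x - c)) %[ae mu]].
Proof.
move=> [un0 [g [ug]]]; have [h ahg uh] := sz_nagy_pair_admissible ug.
have [u1 _ _ _] := ug; have mu' := Lfun_measurable u1.
have ch := admissible_continuous ahg; have [_ _ h0 _ _] := ahg.
have [ih N0 P0 _ eq] := sharp_inequality m_gt0 ahg.
rewrite (sz_nagy_lhsE m_gt0 mu' ch h0 uh ih) (sz_nagy_rhsE _ _ mu' ahg uh).
rewrite sz_nagy_constantE => -[/eq{}eq].
have [|A [k [c [A0 k0 hE]]]] := eq.
  apply: contrapT => hn; apply: un0; apply: ae_imply uh => x ux _; rewrite (ux I) /=.
  by apply/eqP; rewrite eq_le h0 andbT leNgt; apply/negP => hx; apply: hn; exists x.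
by exists A, k, c; split => //; apply: ae_imply uh => x ux /ux ->.
Qed.

End Profile.

(** * Amplitude and dilation from mass and norm *)

Section Amplitude.
Context {R : realType}.
Local Notation mu := (@lebesgue_measure R).
Variable m : R.
Hypothesis m_gt0 : 0 < m.
Implicit Types (f g h F u : R -> R) (x y z c l s A B k a b C M : R).
Local Notation pospow := (pospow m).
Local Notation phi := (phi m).
Local Notation L := (half_width m).
Local Notation q := ((m + 3) / m).
Local Notation phi_mass := (phi_mass m).
Local Notation phi_power := (phi_power m).
Local Notation profile := (profile m).

Lemma powR_injr e x y : e != 0 -> 0 < x -> 0 < y -> x `^ e = y `^ e -> x = y.
Proof.
move=> e0 x0 y0 /(congr1 (fun z => z `^ e^-1)).
by rewrite -!powRrM mulfV// !powRr1 ?ltW.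
Qed.

Lemma translate_continuous c f : continuous f -> continuous (fun x => f (x - c)).
Proof.
move=> cf; apply: continuous_compose => //.
exact: continuous_sub (@continuous_idfun R) (@continuous_cst R c).
Qed.

Lemma Rintegral_translate F a b c : continuous F -> a <= b ->
  (forall x, ~~ (a <= x <= b) -> F x = 0) ->
  \int[mu]_(x in setT) F (x - c) = \int[mu]_(x in setT) F x.
Proof.
move=> cF ab F0; rewrite -[RHS]mul1r -invr1.
rewrite -(@Rintegral_affine _ F a b 1 (- c))//.
by under [RHS]eq_Rintegral do rewrite mul1r.
Qed.

Lemma optimizer_norms u A k c : 0 < A -> 0 < k -> measurable_fun setT u ->
  u = (fun x => profile A k (x - c)) %[ae mu] ->
  ('N[mu]_1[EFin \o u] = (A / k * phi_mass)%:E)%E /\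
  ('N[mu]_((m + 1)%:E)[EFin \o u] =
     ((A `^ (m + 1) / k * phi_power) `^ (m + 1)^-1)%:E)%E.
Proof.
move=> A0 k0 mu' uE; have m1 : 0 < m + 1 by rewrite addr_gt0.
set U := profile A k in uE *.
have cU : continuous U by exact: profile_continuous.
have U0 x : 0 <= U x by exact: profile_ge0.
have ll : - (L / k) <= L / k by have := ell_gt0 m_gt0 k0; lra.
have sU x : ~~ (- (L / k) <= x <= L / k) -> U x = 0 by exact: profile_support.
have ch := translate_continuous (c := c) cU.
have UE : (fun x => U x * pospow (U x)) = fun x => U x `^ (m + 1).
  by apply/funext => x; rewrite mul_pospow.
have cP : continuous (fun x => U x `^ (m + 1)).
  rewrite -UE; apply: continuous_mul => //.
  by apply: continuous_compose => //; exact: pospow_continuous.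
have sP x : ~~ (- (L / k) <= x <= L / k) -> U x `^ (m + 1) = 0.
  by move=> /sU ->; rewrite powR0// gt_eqF.
have sc (F : R -> R) : (forall x, ~~ (- (L / k) <= x <= L / k) -> F x = 0) ->
    forall x, ~~ (- (L / k) + c <= x <= L / k + c) -> F (x - c) = 0.
  by move=> F0 x H; apply: F0; rewrite lerBlDr lerBrDr.
split.
- rewrite (sz_nagy_Lnorm1 mu' ch)//.
  + by rewrite (Rintegral_translate _ cU ll sU) profile_mass.
  + by apply: integrable_support => //; exact: sc.
- rewrite (@Lnorm_ae_ge0 _ (m + 1) u _ m1 mu' ch)//.
  + by rewrite (Rintegral_translate _ cP ll sP) -UE profile_power.
  + by apply: (integrable_support (translate_continuous (c := c) cP));
      exact: (sc (fun x => U x `^ (m + 1))).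
Qed.

Lemma phi_mass_sub_power : phi_mass - phi_power = m / 3 * phi_power.
Proof.
have := phi_pohozaev m_gt0 => H.
have -> : phi_mass = (m + 3) * phi_power / 3 by rewrite -H; field.
by field.
Qed.

(* By the equality case, the base of the power defining [critical_norm] is
   [3 (m + 1) / (2 m) * D * P^(- 3 / m)], with [P] the power integral of the
   profile and [D] its Dirichlet integral; so the left-hand side says
   [P = 3 (m + 1) / (2 m) * D]. *)
Lemma critical_normP A k : m != 3 -> 0 < A -> 0 < k ->
  (A `^ (m + 1) / k * phi_power) `^ (m + 1)^-1 = critical_norm m (A / k * phi_mass)
  <-> k ^+ 2 = 2 / (m + 1) * A `^ (m - 1).
Proof.
move=> m3 A0 k0; have m1 : 0 < m + 1 by rewrite addr_gt0.
have p0 := phi_power_gt0 m_gt0.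
have E := profile_equality m_gt0 A0 k0.
rewrite profile_power// profile_mass// profile_gradient// phi_mass_sub_power in E.
rewrite /critical_norm sz_nagy_constantE//.
have n0 : 0 < A / k * phi_mass by rewrite mulr_gt0 ?divr_gt0 ?phi_mass_gt0.
set CM := sharp_constant m * _ in E.
have -> : 3 * (m + 1) / (2 * m * sharp_constant m * (A / k * phi_mass) `^ q) =
    3 * (m + 1) / (2 * m * CM) by rewrite /CM; congr (_ / _); ring.
have CM0 : 0 < CM by rewrite mulr_gt0 ?sharp_constant_gt0// powR_gt0.
set P := A `^ (m + 1) / k * phi_power in E *.
have P0 : 0 < P by rewrite mulr_gt0// divr_gt0// powR_gt0.
clearbody CM.
(* This is [3 (m + 1) / (2 m) * D]: the Dirichlet integral is [D = (m / 3) A^2 k phi_power] by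
   [phi_mass_sub_power]. *)
pose Y := (m + 1) / 2 * (A ^+ 2 * k * phi_power).
have Y0 : 0 < Y by rewrite !mulr_gt0// ?invr_gt0// exprn_gt0.
have P3 : 0 < P `^ (3 / m) by rewrite powR_gt0.
have XE : 3 * (m + 1) / (2 * m * CM) = Y * (P `^ (3 / m))^-1.
  rewrite E /Y; field.
  by rewrite !gt_eqF.
have PE : P = P `^ (1 - 3 / m) * P `^ (3 / m).
  by rewrite -powRD ?subrK ?powRr1 ?(ltW P0)// (gt_eqF P0) implybT.
(* The exponent in [critical_norm] is the one for which [(1 - 3 / m) * m / ((m + 1) (m - 3)) = 1 /
   (m + 1)]; it exists only for [m <> 3]. *)
have eE : P `^ (m + 1)^-1 = (P `^ (1 - 3 / m)) `^ (m / ((m + 1) * (m - 3))).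
  rewrite -powRrM; congr (_ `^ _); field.
  by rewrite subr_eq0 m3 !gt_eqF.
have e0 : m / ((m + 1) * (m - 3)) != 0.
  apply: mulf_neq0; first exact: lt0r_neq0.
  by rewrite invr_eq0 mulf_neq0 ?subr_eq0// lt0r_neq0.
have YP : P = Y <-> k ^+ 2 = 2 / (m + 1) * A `^ (m - 1).
  have AE : A `^ (m + 1) = A ^+ 2 * A `^ (m - 1).
    rewrite -(powR_mulrn 2 (ltW A0)) -powRD; last by rewrite (gt_eqF A0) implybT.
    by congr (_ `^ _); ring.
  rewrite /P /Y AE; split=> [H|H].
    have c0 : A ^+ 2 * phi_power / k != 0.
      by rewrite mulf_neq0 ?mulf_neq0 ?invr_eq0 ?expf_neq0 ?gt_eqF.
    apply: (mulfI c0).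
    transitivity (2 / (m + 1) * ((m + 1) / 2 * (A ^+ 2 * k * phi_power))).
      by field; rewrite !gt_eqF.
    by rewrite -H; field; rewrite !gt_eqF.
  have -> : A ^+ 2 * A `^ (m - 1) = (m + 1) / 2 * (A ^+ 2 * k ^+ 2).
    by rewrite H; field; rewrite !gt_eqF.
  by field; rewrite gt_eqF.
rewrite XE eE -YP; split=> [/powR_injr H|PY].
  have {}H : P `^ (1 - 3 / m) = Y * (P `^ (3 / m))^-1.
    by apply: H; rewrite ?powR_gt0// mulr_gt0// invr_gt0.
  by rewrite PE H divfK// gt_eqF.
by rewrite -PY; congr (_ `^ _); rewrite {2}PE mulfK// gt_eqF.
Qed.

(* The dilation for which [profile A (rate A)] solves
   [U'' = A^m / (m + 1) - U^m] on its support. *)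
Definition rate A : R := Num.sqrt (2 / (m + 1)) * A `^ ((m - 1) / 2).

Lemma rate_gt0 A : 0 < A -> 0 < rate A.
Proof.
by move=> A0; rewrite mulr_gt0 ?powR_gt0// sqrtr_gt0 divr_gt0// addr_gt0.
Qed.

Lemma rate_sqr A : 0 < A -> rate A ^+ 2 = 2 / (m + 1) * A `^ (m - 1).
Proof.
move=> A0; rewrite exprMn sqr_sqrtr; last by rewrite divr_ge0// addr_ge0// ltW.
rewrite -powR_mulrn ?powR_ge0// -powRrM divfK ?pnatr_eq0//.
Qed.

Lemma rateP A k : 0 < A -> 0 < k ->
  k ^+ 2 = 2 / (m + 1) * A `^ (m - 1) -> k = rate A.
Proof.
move=> A0 k0; rewrite -rate_sqr// => /eqP.
by rewrite eqrXn2 ?(ltW k0) ?(ltW (rate_gt0 A0))// => /eqP.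
Qed.

Lemma rate_ratio A : 0 < A ->
  A / rate A = A `^ ((3 - m) / 2) / Num.sqrt (2 / (m + 1)).
Proof.
move=> A0; have A1 : A = A `^ ((3 - m) / 2) * A `^ ((m - 1) / 2).
  rewrite -powRD; last by rewrite (gt_eqF A0) implybT.
  by rewrite -[LHS](powRr1 (ltW A0)); congr (_ `^ _); field.
have s0 : 0 < Num.sqrt (2 / (m + 1)) by rewrite sqrtr_gt0 divr_gt0// addr_gt0.
rewrite /rate {1}A1; field.
by rewrite !gt_eqF// powR_gt0.
Qed.

Lemma amplitude_exists M : m != 3 -> 0 < M ->
  exists2 A, 0 < A & A / rate A * phi_mass = M.
Proof.
move=> m3 M0; have n0 := phi_mass_gt0 m_gt0.
have s0 : 0 < Num.sqrt (2 / (m + 1)) by rewrite sqrtr_gt0 divr_gt0// addr_gt0.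
have b0 : 0 < M * Num.sqrt (2 / (m + 1)) / phi_mass by rewrite divr_gt0// mulr_gt0.
pose A := (M * Num.sqrt (2 / (m + 1)) / phi_mass) `^ (2 / (3 - m)).
have A0 : 0 < A by rewrite powR_gt0.
exists A => //; rewrite rate_ratio// -powRrM.
have -> : 2 / (3 - m) * ((3 - m) / 2) = 1.
  by field; rewrite subr_eq0 eq_sym.
by rewrite powRr1 ?(ltW b0)//; field; rewrite !gt_eqF.
Qed.

Lemma amplitude_inj A B : m != 3 -> 0 < A -> 0 < B ->
  A / rate A * phi_mass = B / rate B * phi_mass -> A = B.
Proof.
move=> m3 A0 B0 /(mulIf (lt0r_neq0 (phi_mass_gt0 m_gt0))).
have s0 : 0 < Num.sqrt (2 / (m + 1)) by rewrite sqrtr_gt0 divr_gt0// addr_gt0.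
rewrite !rate_ratio// => /mulIf H; apply: (@powR_injr ((3 - m) / 2)) => //.
  by rewrite mulf_neq0// subr_eq0 eq_sym.
by apply: H; rewrite invr_eq0 gt_eqF.
Qed.

Lemma phi_power3 : m = 3 -> phi_power = phi_mass / 2.
Proof. by move=> m3; have := phi_pohozaev m_gt0; rewrite m3 => H; lra. Qed.

(** Here [q = 2] and [phi_power] is half of [phi_mass], so [phi_equality] reads
    [n / 2 = C n^2 (n / 2)]. *)
Lemma sharp_constant3 : m = 3 -> sharp_constant m = phi_mass ^- 2.
Proof.
move=> m3; have n0 := phi_mass_gt0 m_gt0.
have := phi_equality m_gt0; rewrite phi_power3//.
have -> : q = 2 by rewrite m3; field.
have -> : 2 - 1 = 1 :> R by ring.
rewrite powRr1 ?divr_ge0 ?(ltW n0)// powR_mulrn ?(ltW n0)// => E.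
apply: (@mulIf _ (phi_mass ^+ 2 * (phi_mass - phi_mass / 2))).
  have -> : phi_mass - phi_mass / 2 = phi_mass / 2 by field.
  by rewrite !mulf_neq0 ?invr_eq0 ?expf_neq0 ?gt_eqF.
by rewrite mulrA -E; field; rewrite gt_eqF.
Qed.

Lemma critical_massE : m = 3 -> critical_mass = Num.sqrt 2 * phi_mass.
Proof.
move=> m3; rewrite /critical_mass -m3 sz_nagy_constantE// sharp_constant3//.
by rewrite invrK sqrtrM// sqrtr_sqr ger0_norm// ltW// phi_mass_gt0.
Qed.

(** For [m = 3] the ratio [A / rate A] equals [sqrt 2] for every amplitude: the critical mass fixes
    the dilation in terms of [A] but leaves [A] free. *)
Lemma critical_ratio A k : m = 3 -> 0 < A -> 0 < k ->
  A / k * phi_mass = critical_mass <-> k = rate A.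
Proof.
move=> m3 A0 k0; have s0 : 0 < Num.sqrt 2 :> R by rewrite sqrtr_gt0.
have n0 := lt0r_neq0 (phi_mass_gt0 m_gt0).
have r1 : rate A = A / Num.sqrt 2.
  rewrite /rate m3 (_ : (3 - 1) / 2 = 1); last by field.
  rewrite powRr1 ?(ltW A0)// mulrC (_ : 2 / (3 + 1) = 2^-1); last by field.
  by rewrite sqrtrV.
rewrite critical_massE// r1; split=> [/(mulIf n0) <-|->]; field.
  by rewrite !gt_eqF.
by rewrite !gt_eqF.
Qed.

End Amplitude.

(** * Steady states *)

Section GluedIntegrability.
Context {R : realType}.
Local Notation mu := (@lebesgue_measure R).
Implicit Types (f g : R -> R) (a b c x : R).

Lemma near_continuous f g x : (\near x, f x = g x) -> {for x, continuous f} ->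
  {for x, continuous g}.
Proof.
move=> fg cf; rewrite /prop_for /continuous_at -(nbhs_singleton fg).
by apply: cvg_trans cf; apply: near_eq_cvg; apply: filterS fg => y ->.
Qed.

(** The function is the sum of its restrictions to the two segments; [g b = 0] takes care of the
    shared point. *)
Lemma integrable_glue g a b c : g b = 0 ->
  mu.-integrable `[a, b] (EFin \o g) -> mu.-integrable `[b, c] (EFin \o g) ->
  (forall x, ~~ (a <= x <= c) -> g x = 0) -> mu.-integrable setT (EFin \o g).
Proof.
move=> gb i1 i2 g0.
have {}i1 := (@integrable_mkcond _ _ _ mu _ _ (measurable_itv `[a, b])).1 i1.
have {}i2 := (@integrable_mkcond _ _ _ mu _ _ (measurable_itv `[b, c])).1 i2.
have := @integrableD _ _ _ mu setT measurableT _ _ i1 i2.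
apply: (@eq_integrable _ _ _ mu setT) => // x _ /=; rewrite !patchE.
have mE y z : (x \in `[y, z]%classic) = (y <= x <= z).
  by apply/idP/idP; rewrite ?inE/= in_itv.
rewrite !mE; case: ifPn => [/andP[ax xb]|xab]; case: ifPn => [/andP[bx xc]|xbc].
- have -> : x = b by apply/eqP; rewrite eq_le xb bx.
  by rewrite /= gb addr0.
- by rewrite adde0.
- by rewrite add0e.
- have [bx|xb] := leP b x.
    by rewrite g0 ?adde0//; apply: contra xbc => /andP[_ ->]; rewrite bx.
  by rewrite g0 ?adde0//; apply: contra xab => /andP[-> _]; rewrite ltW.
Qed.

End GluedIntegrability.

(** * Regularity of the profile with the steady dilation *)

Section SteadyProfile.
Context {R : realType}.
Local Notation mu := (@lebesgue_measure R).
Variable m : R.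
Hypothesis m_gt0 : 0 < m.
Implicit Types (f g h F u : R -> R) (x y z c l s B a b C M : R).
Local Notation W := (W m).
Local Notation pospow := (pospow m).
Local Notation phi := (phi m).
Local Notation dphi := (dphi m).
Local Notation L := (half_width m).

Lemma dphi_le0 x : 0 <= x -> dphi x <= 0.
Proof.
rewrite le_eqVlt => /predU1P[<-|x0]; first by rewrite /dphi lexx phi0// (W1 m_gt0).
by rewrite /dphi [x <= 0]leNgt x0/= oppr_le0 W_ge0.
Qed.

Lemma dphi_odd x : dphi (- x) = - dphi x.
Proof.
have [->|x0] := eqVneq x 0.
  by rewrite oppr0 /dphi lexx phi0// (W1 m_gt0) oppr0.
rewrite /dphi phi_even oppr_le0.
have [xl|xg] := ltP x 0; first by rewrite ltW.
by rewrite ifF ?opprK//; apply/negbTE; rewrite -ltNge lt_neqAle eq_sym x0.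
Qed.

Lemma phi_decreasing x y : `|x| <= `|y| -> phi y <= phi x.
Proof.
rewrite -(phi_norm m x) -(phi_norm m y).
move: (normr_ge0 x) (normr_ge0 y); move: `|x| `|y| => {}x {}y x0 y0.
rewrite le_eqVlt => /predU1P[->//|xy].
have [t _|t _|t /andP[xt ty] E] := @mean_value _ phi dphi x y xy.
- exact: is_derive_phi.
- exact: phi_continuous.
rewrite -subr_le0 E mulr_le0_ge0 ?subr_ge0 ?(ltW xy)// dphi_le0//.
by rewrite (le_trans x0)// ltW.
Qed.

Variable A : R.
Hypothesis A_gt0 : 0 < A.
Local Notation k := (rate m A).
Local Notation U := (profile m A k).
Local Notation dU := (dprofile m A k).
Local Notation ell := (L / k).

Let k_gt0 : 0 < k. Proof. exact: rate_gt0. Qed.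

Let cU : continuous U. Proof. exact: profile_continuous. Qed.

Let U_ge0 x : 0 <= U x. Proof. exact: profile_ge0. Qed.

Lemma scaled_lt x : (`|k * x| < L) = (`|x| < ell).
Proof. by rewrite normrM gtr0_norm// ltr_pdivlMr// mulrC. Qed.

Lemma profile_out x : ell <= `|x| -> U x = 0.
Proof. by rewrite leNgt -scaled_lt -leNgt => /(phi_out m_gt0) H; rewrite /profile H mulr0. Qed.

Lemma dprofile_out x : ell <= `|x| -> dU x = 0.
Proof.
rewrite leNgt -scaled_lt -leNgt => /(dphi_out m_gt0) H.
by rewrite /dprofile H !mulr0.
Qed.

Lemma profile_gt0 x : (0 < U x) = (`|x| < ell).
Proof.
have [xl|xl] := ltP `|x| ell; last by rewrite profile_out// ltxx.
by rewrite mulr_gt0// phi_gt0// scaled_lt.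
Qed.

Lemma positivity_set_profile : positivity_set U = `]- ell, ell[%classic.
Proof.
apply/seteqP; split=> x; rewrite /positivity_set/= profile_gt0 in_itv/= ltr_norml; done.
Qed.

(** The derivative of [U^m]. Near an edge [U] vanishes quadratically, so this behaves like the
    distance to the edge to the power [2 m - 1] and is unbounded for [m < 1 / 2]. *)
Definition power_derivative x : R :=
  if `|x| < ell then m * U x `^ (m - 1) * dU x else 0.
Local Notation v := power_derivative.

(** The derivative of [U (U^m)_x = m U^m U'], with [U'^2] and [U''] expressed through [phi]. In this
    form it is continuous across the edges, thanks to the factor [U^m]. *)
Definition flux_derivative x : R :=
  m * pospow (U x) * (A * k ^+ 2) *
  (m * (1 - pospow (phi (k * x))) + (1 - (m + 1) * pospow (phi (k * x))) / 2).

Lemma near_inside x : `|x| < ell -> \forall y \near x, `|y| < ell.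
Proof.
move=> xl; near=> y.
by near: y; apply: (cvgr_lt `|x|) xl; apply: cvg_norm; exact: cvg_id.
Unshelve. all: by end_near. Qed.

Lemma near_outside x : ell < `|x| -> \forall y \near x, ell < `|y|.
Proof.
move=> xl; near=> y.
by near: y; apply: (cvgr_gt `|x|) xl; apply: cvg_norm; exact: cvg_id.
Unshelve. all: by end_near. Qed.

Lemma is_derive_profile_power x : `|x| != ell ->
  is_derive x 1 (fun x => pospow (U x)) (v x).
Proof.
rewrite neq_lt => /orP[xl|xl].
  rewrite /v xl.
  apply: (is_derive1_chain (is_derive_profile m_gt0 _ _ x)).
  by apply: is_derive_pospow; rewrite profile_gt0.
rewrite /v ltNge (ltW xl)/=.
apply: (@near_is_derive1 _ (cst 0)).
near=> y; rewrite profile_out ?pospow_le0//; apply/ltW; near: y.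
exact: near_outside.
Unshelve. all: by end_near. Qed.

Lemma power_derivative_continuous x : `|x| != ell -> {for x, continuous v}.
Proof.
rewrite neq_lt => /orP[xl|xl].
  apply: (@near_continuous _ (fun x => m * U x `^ (m - 1) * dU x)).
    by near=> y; rewrite /v ifT//; near: y; exact: near_inside.
  apply: cvgM; last exact: dprofile_continuous.
  apply: cvgM; first exact: cvg_cst.
  have Ux : 0 < U x by rewrite profile_gt0.
  have := @is_derive1_chain _ U (fun s => s `^ (m - 1)) x _ _
    (is_derive_profile m_gt0 A k x) (is_derive1_powR (m - 1) Ux).
  exact: is_derive1_continuous.
apply: (@near_continuous _ (cst 0)); last exact: cvg_cst.
near=> y; rewrite /v ifF//; apply/negbTE; rewrite -leNgt ltW//.
by near: y; exact: near_outside.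
Unshelve. all: by end_near. Qed.

Lemma power_continuous : continuous (fun x => pospow (U x)).
Proof. by apply: continuous_compose => //; exact: pospow_continuous. Qed.

Lemma dprofile_le0 x : 0 <= x -> dU x <= 0.
Proof.
move=> x0; rewrite /dprofile pmulr_rle0// pmulr_rle0// dphi_le0//.
by rewrite mulr_ge0// ltW.
Qed.

Lemma dprofile_ge0 x : x <= 0 -> 0 <= dU x.
Proof.
move=> x0; rewrite /dprofile pmulr_rge0// pmulr_rge0//.
rewrite -[k * x]opprK dphi_odd oppr_ge0 dphi_le0// oppr_ge0.
by rewrite pmulr_rle0.
Qed.

(** The derivative of [U^m] has constant sign on each half of the support, so boundedness of [U^m]
    alone gives integrability up to the edges. *)
Lemma power_derivative_integrable : mu.-integrable setT (EFin \o v).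
Proof.
have l0 := ell_gt0 m_gt0 k_gt0.
have d0 x : 0 <= m * U x `^ (m - 1) by rewrite mulr_ge0 ?powR_ge0 ?ltW.
apply: (@integrable_glue _ v (- ell) 0 ell).
- by rewrite /v normr0 l0 /dprofile mulr0 /dphi lexx phi0// (W1 m_gt0) !mulr0.
- apply: (@integrable_ge0_derive _ (fun x => pospow (U x))); first lra.
  + by apply: continuous_subspaceT; exact: power_continuous.
  + move=> x xl; apply: is_derive_profile_power.
    by rewrite lt_eqF// ltr_norml; lra.
  + move=> x xl; apply: power_derivative_continuous.
    by rewrite lt_eqF// ltr_norml; lra.
  + move=> x /andP[_ x0]; rewrite /v; case: ifP => // _.
    by rewrite mulr_ge0// dprofile_ge0// ltW.
- have : mu.-integrable `[0, ell] (EFin \o (fun x => -1 * v x)).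
    apply: (@integrable_ge0_derive _ (fun x => -1 * pospow (U x))
      (fun x => -1 * v x) 0 ell l0).
    + apply: continuous_subspaceT.
      by apply: continuous_mul; [exact: continuous_cst|exact: power_continuous].
    + move=> x xl; apply: is_derive1_mull; apply: is_derive_profile_power.
      by rewrite lt_eqF// ltr_norml; lra.
    + move=> x xl; apply: cvgM; first exact: cvg_cst.
      apply: power_derivative_continuous.
      by rewrite lt_eqF// ltr_norml; lra.
    + move=> x /andP[x0 _]; rewrite /v; case: ifP => _; last by rewrite mulr0.
      by rewrite mulN1r oppr_ge0 mulr_ge0_le0// dprofile_le0// ltW.
  move=> /(integrable_Rmull (-1) (measurable_itv _)).
  by rewrite (_ : (fun x => _) = v)//; apply/funext => x; rewrite !mulN1r opprK.
- move=> x xl; rewrite /v ifF//; apply/negbTE; apply: contra xl.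
  by rewrite ltr_norml; lra.
Qed.

Lemma power_derivative_segment_integrable : segment_integrable v.
Proof.
by move=> a b; apply: integrableS power_derivative_integrable.
Qed.

Lemma power_piecewise_C1 : piecewise_C1 [:: - ell; ell] (fun x => pospow (U x)) v.
Proof.
have H x : x \notin [:: - ell; ell] -> `|x| != ell.
  rewrite !inE negb_or => /andP[xl xr]; have l0 := ell_gt0 m_gt0 k_gt0.
  by rewrite eqr_norml (negbTE xl) (negbTE xr).
split; first exact: power_continuous.
- by move=> x /H; exact: is_derive_profile_power.
- by move=> x /H; exact: power_derivative_continuous.
- exact: power_derivative_segment_integrable.
Qed.

Lemma profile_powRE : (fun x => U x `^ m) = (fun x => pospow (U x)).
Proof. by apply/funext => x; rewrite pospowE. Qed.

Lemma mul_power_derivative x : U x * v x = m * pospow (U x) * dU x.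
Proof.
have [xl|xl] := ltP `|x| ell; last by rewrite profile_out// pospow_le0// mul0r !mulr0 mul0r.
rewrite /v xl pospowE// -(mulr_powRB1 (U_ge0 x) m_gt0); ring.
Qed.

Lemma rate_sqr_amplitude : A * k ^+ 2 = 2 / (m + 1) * A `^ m.
Proof.
by rewrite rate_sqr// mulrCA mulr_powRB1// ltW.
Qed.

Lemma is_derive_dprofile x : `|x| < ell ->
  is_derive x 1 dU (A `^ m / (m + 1) - pospow (U x)).
Proof.
move=> xl; have H : is_derive (k * x + 0) 1 dphi (ddphi m (k * x)).
  by rewrite addr0; apply: is_derive_dphi; rewrite ?scaled_lt.
have := is_derive1_mull A (is_derive1_mull k (is_derive1_affine H)).
rewrite (_ : (fun t => A * (k * dphi (k * t + 0))) = dU); last first.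
  by apply/funext => t; rewrite addr0.
move=> D; apply: (is_derive_eq D); rewrite /ddphi /profile.
rewrite pospowM ?(ltW A_gt0)//; last by have /andP[] := phi_01 m_gt0 (k * x).
transitivity (A * k ^+ 2 * (1 - (m + 1) * pospow (phi (k * x))) / 2).
  by field.
by rewrite rate_sqr_amplitude; field; rewrite gt_eqF// addr_gt0.
Qed.

Lemma dprofile_sqr x : `|x| < ell ->
  U x `^ (m - 1) * dU x ^+ 2 = A * k ^+ 2 * pospow (U x) * (1 - pospow (phi (k * x))).
Proof.
move=> xl; have U0 : 0 < U x by rewrite profile_gt0.
rewrite (pospowE m (ltW U0)) -(mulr_powRB1 (ltW U0) m_gt0).
have -> : dU x ^+ 2 = A ^+ 2 * k ^+ 2 * (dphi (k * x) ^+ 2) by rewrite /dprofile; ring.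
by rewrite dphi_sqr// /profile; ring.
Qed.

Lemma flux_derivative_continuous : continuous flux_derivative.
Proof.
have ck : continuous (fun x => pospow (phi (k * x))).
  apply: continuous_compose; last exact: pospow_continuous.
  by apply: scaled_continuous; exact: phi_continuous.
apply: continuous_mul.
  apply: continuous_mul; last exact: continuous_cst.
  by apply: continuous_mul; [exact: continuous_cst|exact: power_continuous].
apply: continuous_add.
  apply: continuous_mul; first exact: continuous_cst.
  by apply: continuous_sub => //; exact: continuous_cst.
apply: continuous_mul; last exact: continuous_cst.
apply: continuous_sub; first exact: continuous_cst.
by apply: continuous_mul => //; exact: continuous_cst.
Qed.

Lemma flux_piecewise_C1 :
  piecewise_C1 [:: - ell; ell] (fun x => U x * v x) flux_derivative.
Proof.
have cz := flux_derivative_continuous.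
rewrite (funext mul_power_derivative); split.
- apply: continuous_mul; last exact: dprofile_continuous.
  by apply: continuous_mul; [exact: continuous_cst|exact: power_continuous].
- move=> x; rewrite !inE negb_or => /andP[xl xr].
  have [lx|gx|E] := ltgtP `|x| ell.
  + have dv : is_derive x 1 (fun x => m * pospow (U x)) (m * v x).
      by apply/is_derive1_mull/is_derive_profile_power; rewrite lt_eqF.
    apply: (is_derive_eq (is_derive1_mul dv (is_derive_dprofile lx))).
    rewrite /v lx.
    have -> : m * (m * U x `^ (m - 1) * dU x) * dU x =
      m ^+ 2 * (U x `^ (m - 1) * dU x ^+ 2) by ring.
    rewrite dprofile_sqr//.
    have -> : A `^ m / (m + 1) - pospow (U x) =
        A * k ^+ 2 * (1 - (m + 1) * pospow (phi (k * x))) / 2.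
      rewrite rate_sqr_amplitude /profile pospowM ?(ltW A_gt0)//; last first.
        by have /andP[] := phi_01 m_gt0 (k * x).
      field.
      by rewrite gt_eqF// addr_gt0.
    by rewrite /flux_derivative; field.
  + have -> : flux_derivative x = 0.
      by rewrite /flux_derivative profile_out ?(ltW gx)// pospow_le0// mulr0 !mul0r.
    apply: (@near_is_derive1 _ (cst 0)).
    near=> y; rewrite profile_out ?pospow_le0 ?mulr0 ?mul0r//; apply/ltW; near: y.
    exact: near_outside.
  + by move/eqP: E; rewrite eqr_norml (negbTE xl) (negbTE xr).
- by move=> x _; exact: cz.
- exact: continuous_segment_integrable.
Unshelve. all: by end_near. Qed.

End SteadyProfile.

(** * Topology of a symmetric interval *)

Section SymmetricInterval.
Context {R : realType}.
Implicit Types (x y l : R).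

Lemma closure_symmetric_itv l : 0 < l -> closure `]- l, l[%classic = `[- l, l]%classic.
Proof.
move=> l0; apply/seteqP; split.
  have -> : `[- l, l]%classic = closure `[- l, l]%classic.
    by apply/closure_id; exact: itv_closed.
  by apply: closureS => x; rewrite /= !in_itv/= => /andP[/ltW -> /ltW ->].
move=> x; rewrite /= in_itv/= => xl B /nbhs_ballP[e /= e0 eB].
pose r := Num.min (e / 2) (l / 2); have r0 : 0 < r by rewrite lt_min; lra.
have re : r <= e / 2 by rewrite ge_min lexx.
have rl : r <= l / 2 by rewrite ge_min lexx orbT.
clearbody r.
have [x0|x0] := leP x 0.
  exists (x + r); split; first by rewrite /= in_itv/=; lra.
  by apply: eB; rewrite /ball/= ltr_norml; lra.
exists (x - r); split; first by rewrite /= in_itv/=; lra.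
by apply: eB; rewrite /ball/= ltr_norml; lra.
Qed.

Lemma boundary_symmetric_itv l x : 0 < l ->
  boundary `]- l, l[%classic x <-> `|x| = l.
Proof.
move=> l0; rewrite /boundary closure_symmetric_itv//.
have -> : (`]- l, l[%classic)° = `]- l, l[%classic.
  apply/seteqP; split; first exact: interior_subset.
  rewrite -open_subsetE//; exact: itv_open.
rewrite /= !in_itv/=; split=> [[xl /negP xl']|xl].
  apply/eqP; rewrite eq_le ler_norml xl/= leNgt ltr_norml.
  by [].
split; first by rewrite -ler_norml xl.
by rewrite -ltr_norml xl ltxx.
Qed.

Lemma near_symmetric_itv l x : 0 < l -> `|x| = l ->
  (\forall y \near x, - l < y < l <-> x < y) \/
  (\forall y \near x, - l < y < l <-> y < x).
Proof.
move=> l0 /eqP; rewrite eqr_norml => /andP[/orP[] /eqP -> _]; [right|left].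
  near=> y; have y0 : 0 < y by near: y; exact: open_gt.
  by split; lra.
near=> y; have y0 : y < 0 by near: y; apply: lt_nbhsl; lra.
by split; lra.
Unshelve. all: by end_near. Qed.

End SymmetricInterval.

(** * The profile is a steady state *)

Section SteadyState.
Context {R : realType}.
Local Notation mu := (@lebesgue_measure R).
Variable m : R.
Hypothesis m_gt0 : 0 < m.
Implicit Types (f g h F u : R -> R) (x y z c l s B a b C M : R).
Local Notation pospow := (pospow m).
Local Notation L := (half_width m).
Variable A : R.
Hypothesis A_gt0 : 0 < A.
Local Notation k := (rate m A).
Local Notation U := (profile m A k).
Local Notation dU := (dprofile m A k).
Local Notation ell := (L / k).
Local Notation v := (power_derivative m A).
Local Notation Omega := (positivity_set U).

Let k_gt0 : 0 < k. Proof. exact: rate_gt0. Qed.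

Let cU : continuous U. Proof. exact: profile_continuous. Qed.

Let ell0 : 0 < ell. Proof. exact: ell_gt0. Qed.

(** With [a_i] and [b_i] the derivatives of [U] and of a test function [psi], this is the
    cancellation in the derivative of [U psi'' - U' psi' + U'' psi]. *)
Lemma telescope a0 a1 a2 a3 b0 b1 b2 b3 :
  a1 * b2 + a0 * b3 - (a2 * b1 + a1 * b2) + (a3 * b0 + a2 * b1) =
  a0 * b3 + a3 * b0 :> R.
Proof. by ring. Qed.

(** Test functions on the open support vanish near the edges, so the classical identity
    [U''' = - (U^m)_x] inside suffices; the jump of [U''] at the edges is never seen. *)
Lemma profile_third_derivative :
  weak_derivative Omega 3 U (fun x => -1 * v x).
Proof.
have iv := power_derivative_segment_integrable m_gt0 A_gt0.
have iw : segment_integrable (fun x => -1 * v x).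
  by move=> a b; exact: integrable_Rmull.
have OE := positivity_set_profile m_gt0 A_gt0.
have oO : open Omega by rewrite OE; exact: itv_open.
have loc g : segment_integrable g -> locally_integrable Omega g.
  move=> /locally_integrable_segment [mg _ gy]; split => //.
    exact: measurable_funTS.
  by move=> K _; exact: gy.
split; [exact/loc/continuous_segment_integrable|exact: loc|move=> psi tpsi].
have [||a [b [ab abO psi0]]] := test_function_support oO _ _ tpsi.
- by exists 0; rewrite OE/= in_itv/= oppr_lt0 ell0.
- move=> x y z; rewrite OE/= !in_itv/= => /andP[lx _] /andP[_ yl] /andP[xz zy].
  by rewrite (lt_le_trans lx) ?(le_lt_trans zy).
have psi0' n x : ~~ (a <= x <= b) -> derive1n n psi x = 0.
  by move=> abx; apply: psi0; apply: contra abx => /andP[/ltW -> /ltW ->].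
have cpsi n : continuous (derive1n n psi) := test_function_continuous tpsi.
have dpsi n x := test_function_is_derive n x tpsi.
rewrite (@Rintegral_support _ _ _ a b)//; last first.
  by move=> x _ /(psi0' 3%N) ->; rewrite mulr0.
rewrite (@Rintegral_support _ _ (fun x => -1 * v x * psi x) a b)//; last first.
  by move=> x _ /(psi0' 0%N) /= ->; rewrite mulr0.
have i1 : mu.-integrable `[a, b] (EFin \o (fun x => U x * derive1n 3 psi x)).
  by apply: continuous_segment_integrable; exact: continuous_mul.
have i2 : mu.-integrable `[a, b] (EFin \o (fun x => -1 * v x * psi x)).
  by apply: segment_integrable_mul => //; exact: (cpsi 0%N).
have cd : continuous (fun x => A `^ m / (m + 1) - pospow (U x)).
  by apply: continuous_sub; [exact: continuous_cst|exact: power_continuous].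
(* [H' = U psi''' - v psi], because [U'' = A^m / (m + 1) - U^m]. *)
pose H x := (U x * derive1n 2 psi x - dU x * derive1n 1 psi x) +
  (A `^ m / (m + 1) - pospow (U x)) * psi x.
have abl x : a <= x <= b -> `|x| < ell.
  move=> abx; have : Omega x by apply: abO; rewrite /= in_itv.
  by rewrite OE/= in_itv/= ltr_norml.
have : \int[mu]_(x in `[a, b]) (U x * derive1n 3 psi x + -1 * v x * psi x) = H b - H a.
  apply: FTC_open => //.
  - apply: continuous_subspaceT; apply: continuous_add.
      apply: continuous_sub; first exact: continuous_mul.
      by apply: continuous_mul => //; exact: dprofile_continuous.
    by apply: continuous_mul => //; exact: (cpsi 0%N).
  - move=> x abx; have xl : `|x| < ell.
      by apply: abl; case/andP: abx => /ltW -> /ltW ->.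
    have d0 := is_derive_profile m_gt0 A k x.
    have d1 := is_derive_dprofile m_gt0 A_gt0 xl.
    have d2 : is_derive x 1 (fun x => A `^ m / (m + 1) - pospow (U x)) (- v x).
      have xl' : `|x| != ell by rewrite lt_eqF.
      have dc := is_derive_cst (A `^ m / (m + 1)) x (1 : R).
      have := is_derive1_sub dc (is_derive_profile_power m_gt0 A_gt0 xl').
      by rewrite sub0r.
    apply: (is_derive_eq (is_derive1_add (is_derive1_sub
      (is_derive1_mul d0 (dpsi 2%N x)) (is_derive1_mul d1 (dpsi 1%N x)))
      (is_derive1_mul d2 (dpsi 0%N x)))).
    by rewrite telescope mulN1r.
  - move=> x abx; have xl : `|x| < ell.
      by apply: abl; case/andP: abx => /ltW -> /ltW ->.
    apply: cvgD; first by apply: cvgM; [exact: cU|exact: cpsi].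
    apply: cvgM; last exact: (cpsi 0%N).
    apply: cvgM; first exact: cvg_cst.
    by apply: power_derivative_continuous => //; rewrite lt_eqF.
  - exact: integrable_Radd.
have H0 x : ~~ (a < x < b) -> H x = 0.
  move=> xab; rewrite /H (psi0 2%N)// (psi0 1%N)// (psi0 0%N x xab : psi x = 0).
  by rewrite !mulr0 subrr addr0.
rewrite !H0 ?ltxx ?andbF// subrr RintegralD// => /eqP.
by rewrite addr_eq0 => /eqP ->; rewrite -signr_odd/= expr1 mulN1r.
Qed.

Lemma profile_steady_state : steady_state m (A / k * phi_mass m) U.
Proof.
have OE := positivity_set_profile m_gt0 A_gt0.
have bO : bounded_set (positivity_set U).
  rewrite OE; exists ell; split; first exact: num_real.
  move=> M lM x; rewrite /= in_itv/= -ltr_norml => xl.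
  by rewrite ltW// (lt_trans xl).
have iv := power_derivative_segment_integrable m_gt0 A_gt0.
split.
- exact: profile_ge0.
- exact: profile_Lfun.
- exact: profile_H1.
(* Taking [- v] for the third derivative on the whole line makes the integrand of the equation
   vanish identically. *)
- exists v, (fun x => -1 * v x); split.
  + rewrite profile_powRE//.
    exact: piecewise_C1_weak_derivative (power_piecewise_C1 m_gt0 A_gt0).
  + have pF := flux_piecewise_C1 m_gt0 A_gt0.
    have cF : continuous (fun x => U x * v x) by have [] := pF.
    have cG := @flux_derivative_continuous _ _ m_gt0 A.
    have l2 f : continuous f -> L2_loc f.
      move=> cf; split; first exact: continuous_measurable_fun.
      apply/locally_integrable_segment/continuous_segment_integrable.
      exact: continuous_mul.
    split; first exact: l2.
    exists (flux_derivative m A); split; last exact: l2.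
    exact: piecewise_C1_weak_derivative pF.
  + by apply/locally_integrable_segment => a b; exact: integrable_Rmull.
  + exact: profile_third_derivative.
  + move=> psi _.
    transitivity (\int[mu]_(x in setT) (0 : R)).
      by apply: eq_Rintegral => x _; rewrite mulN1r mulrN addNr mul0r.
    by rewrite /Rintegral integral0.
- exact: cU.
- exact: profile_mass.
- by move=> /(_ bO).
- move=> _; split.
    move=> x; rewrite OE => /(boundary_symmetric_itv x ell0).
    by move=> /(near_symmetric_itv ell0) [H|H]; [left|right];
      apply: filterS H => y; rewrite /= in_itv/=.
  exists dU; split.
    by apply: continuous_subspaceT; exact: dprofile_continuous.
  by move=> x _; exact: is_derive_profile.
Qed.

Lemma profile_radially_decreasing : radially_decreasing U.
Proof.
split=> [x|x y xy]; first by rewrite /profile mulrN phi_even.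
by rewrite ler_pM2l// phi_decreasing// !normrM ler_wpM2l.
Qed.

Lemma profile_bounded_support : bounded_support U.
Proof.
rewrite /bounded_support positivity_set_profile//.
exists ell; split; first exact: num_real.
move=> M lM x; rewrite /= in_itv/= -ltr_norml => xl.
by rewrite ltW// (lt_trans xl).
Qed.

Lemma profile_zero_contact_angle : zero_contact_angle U.
Proof.
move=> x; rewrite positivity_set_profile// => /(boundary_symmetric_itv x ell0) xl.
have := is_derive_profile m_gt0 A k x.
by rewrite dprofile_out// xl.
Qed.

End SteadyState.

(** * From the distributional equation to a second-order equation *)

Section SteadyRegularity.
Context {R : realType}.
Local Notation mu := (@lebesgue_measure R).
Implicit Types (V v w p f : R -> R) (x y z c l s a b d e m : R).

(** Monotonicity in [|x|] makes the set symmetric and order-convex, and continuity makes it open, so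
    its finite supremum is an edge that does not belong to it. *)
Lemma radial_positivity_set V : continuous V -> radially_decreasing V ->
  bounded_support V -> 0 < V 0 ->
  exists2 l, 0 < l & positivity_set V = `]- l, l[%classic.
Proof.
move=> cV [Vev Vdec] [M [_ MV]] V0.
set S := positivity_set V.
have S0 : S 0 by [].
have hS : has_sup S.
  split; first by exists 0.
  by exists (M + 1) => x Sx; rewrite (le_trans (ler_norm x))// MV// ltrDl.
pose l := sup S.
have Sl x : S x -> `|x| <= l.
  move=> Sx; apply: sup_ubound; first by case: hS.
  by rewrite /S/= /positivity_set/= (lt_le_trans Sx)// Vdec// normr_id.
have lS x : `|x| < l -> S x.
  move=> xl; have [y Sy xy] : exists2 y, S y & `|x| < y.
    have e0 : 0 < l - `|x| by rewrite subr_gt0.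
    by have [y Sy] := sup_adherent e0 hS; rewrite -/l subKr; exists y.
  by apply: lt_le_trans Sy _; apply: Vdec; rewrite (le_trans (ltW xy))// ler_norm.
have nl x : S x -> x < l.
  move=> Sx; rewrite lt_neqAle (le_trans (ler_norm x) (Sl _ Sx)) andbT.
  apply/eqP => xl; have : \forall y \near x, 0 < V y.
    exact: (cvgr_gt (V x) (cV x) _ Sx).
  move=> /nbhs_ballP[e /= e0 eB].
  have /Sl : S (x + e / 2) by apply: eB; rewrite /ball/= ltr_norml; lra.
  by rewrite -xl => /(le_trans (ler_norm _)); lra.
have l0 : 0 < l by exact: nl.
exists l => //; apply/seteqP; split=> x; rewrite /= in_itv/= -ltr_norml.
  move=> Sx; apply: nl; rewrite /S /positivity_set/=.
  by have [|] := leP 0 x => x0; [rewrite ger0_norm|rewrite ltr0_norm// Vev].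
exact: lS.
Qed.

Lemma Rintegral_ae_eq (D : set R) f g : measurable D -> measurable_fun D f ->
  measurable_fun D g -> (\forall x \ae mu, D x -> f x = g x) ->
  \int[mu]_(x in D) f x = \int[mu]_(x in D) g x.
Proof.
move=> mD mf mg fg; congr fine.
apply: ae_eq_integral => //; [exact/measurable_EFinP|exact/measurable_EFinP|].
by apply: ae_imply fg => x fx Dx; rewrite /= fx.
Qed.

(** The tested equation gives [V (w + v) = 0] almost everywhere, and [V] can be divided out on its
    positivity set. Since the test functions live there, [w] may be replaced by [- v] and then
    traded for [V^m]. *)
Lemma steady_weak_equation m V v w l : continuous V ->
  0 < l -> positivity_set V = `]- l, l[%classic ->
  weak_derivative setT 1 (fun x => V x `^ m) v ->
  locally_integrable setT w ->
  weak_derivative (positivity_set V) 3 V w ->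
  (forall psi, test_function setT psi ->
     \int[mu]_(x in setT) ((V x * w x + V x * v x) * psi x) = 0) ->
  forall psi, test_function `]- l, l[%classic psi ->
    \int[mu]_(x in `]- l, l[%classic) (V x * derive1n 3 psi x) =
    - \int[mu]_(x in `]- l, l[%classic) (V x `^ m * derive1n 1 psi x).
Proof.
move=> cV l0 OE wv lw w3 eqV psi tpsi.
have ll : - l < l by lra.
have tT : test_function setT psi.
  by have [dpsi [K [cK _ K0]]] := tpsi; split => //; exists K; split.
have [lVm lv wv1] := wv; rewrite OE in w3; have [_ _ w3E] := w3.
have iv := (locally_integrable_segment v).1 lv.
have iw := (locally_integrable_segment w).1 lw.
have [a [b [ab abl psi0]]] := test_itv_support ll tpsi.
have psi0' n x : ~~ (a <= x <= b) -> derive1n n psi x = 0.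
  by move=> abx; apply: psi0; apply: contra abx => /andP[/ltW -> /ltW ->].
have supp (D : set R) n f : `[a, b] `<=` D ->
    \int[mu]_(x in D) (f x * derive1n n psi x) =
    \int[mu]_(x in `[a, b]) (f x * derive1n n psi x).
  by move=> abD; apply: Rintegral_support => // x _ /(psi0' n) ->; rewrite mulr0.
have aeE : \forall x \ae mu, V x * w x + V x * v x = 0.
  apply: ae_eq0_of_test => //; apply/locally_integrable_segment.
  have iV g : segment_integrable g -> segment_integrable (fun x => V x * g x).
    move=> ig; rewrite (_ : (fun x => _) = fun x => g x * V x).
      exact: segment_integrable_mul.
    by apply/funext => x; rewrite mulrC.
  by apply: segment_integrable_add; exact: iV.
rewrite w3E// (supp _ 1%N (fun x => V x `^ m) abl).
rewrite -(supp setT 1%N (fun x => V x `^ m))// wv1//.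
rewrite (supp setT 0%N v)// (supp _ 0%N w abl).
have -> : \int[mu]_(x in `[a, b]) (w x * derive1n 0 psi x) =
    \int[mu]_(x in `[a, b]) (-1 * (v x * derive1n 0 psi x)).
  have mpsi : measurable_fun `[a, b] (derive1n 0 psi).
    apply: measurable_funTS; apply: continuous_measurable_fun.
    exact: (test_function_continuous tpsi).
  apply: Rintegral_ae_eq => //.
  - apply: measurable_funM => //; apply: measurable_funTS.
    by have [] := lw.
  - apply: measurable_funM => //; apply: measurable_funM => //.
    by apply: measurable_funTS; have [] := lv.
  - apply: ae_imply aeE => x /eqP; rewrite -mulrDr mulf_eq0 => H /abl.
    have : `]- l, l[%classic x -> V x != 0.
      by rewrite -OE => Vx; rewrite gt_eqF.
    move=> Vn /Vn /negbTE V0; move: H; rewrite V0/= addr_eq0 => /eqP ->.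
    by rewrite mulrA mulN1r.
rewrite RintegralZl//; last first.
  by apply: segment_integrable_mul => //; exact: (test_function_continuous tpsi).
by rewrite -signr_odd/= !expr1 !mulN1r !opprK.
Qed.

(** [F] continues [V] from the support to a twice differentiable function on the whole line, which
    makes slope and equation meaningful at the edge [l]. *)
Lemma steady_profile_ode m V l : 0 < m -> continuous V -> (forall x, 0 <= V x) ->
  0 < l ->
  (forall psi, test_function `]- l, l[%classic psi ->
    \int[mu]_(x in `]- l, l[%classic) (V x * derive1n 3 psi x) =
    - \int[mu]_(x in `]- l, l[%classic) (V x `^ m * derive1n 1 psi x)) ->
  exists alpha F p, [/\ continuous p,
    forall x, is_derive x 1 F (p x),
    forall x, is_derive x 1 p (alpha - pospow m (V x)) &
    forall x, `|x| < l -> V x = F x].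
Proof.
move=> m0 cV V0 l0 wV; have ll : - l < l by lra.
have cP : continuous (fun x => pospow m (V x)).
  by apply: continuous_compose => //; exact: pospow_continuous.
have iP := continuous_segment_integrable cP.
(* With [G2'' = V^m], the equation says that [V + G2] has zero third
   derivative. *)
pose G1 := antiderivative 0 (fun x => pospow m (V x)).
have dG1 x : is_derive x 1 G1 (pospow m (V x)).
  by apply: (primitive_is_derive iP); [exact: antiderivative_primitive|exact: cP].
have cG1 : continuous G1 by move=> x; exact: is_derive1_continuous (dG1 x).
have iG1 := continuous_segment_integrable cG1.
pose G2 := antiderivative 0 G1.
have dG2 x : is_derive x 1 G2 (G1 x).
  by apply: (primitive_is_derive iG1); [exact: antiderivative_primitive|exact: cG1].
have cG2 : continuous G2 by move=> x; exact: is_derive1_continuous (dG2 x).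
clearbody G1 G2.
have [psi tpsi|c0 [c1 [c2 cE]]] := quadratic_of_test ll (continuous_add cV cG2).
  have cpsi n : continuous (derive1n n psi) := test_function_continuous tpsi.
  have dpsi n x := test_function_is_derive n x tpsi.
  have [a [b [ab abl psi0]]] := test_itv_support ll tpsi.
  have I : \int[mu]_(x in `]- l, l[%classic)
      (G2 x * derive1n 3 psi x - pospow m (V x) * derive1n 1 psi x) = 0.
    apply: (@test_FTC _ _ _ (fun x => G2 x * derive1n 2 psi x - G1 x * derive1n 1 psi x)).
    - by apply: continuous_sub; exact: continuous_mul.
    - by apply: continuous_sub; exact: continuous_mul.
    - move=> x; apply: (is_derive_eq (is_derive1_sub
        (is_derive1_mul (dG2 x) (dpsi 2%N x)) (is_derive1_mul (dG1 x) (dpsi 1%N x)))).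
      move: (G1 x) (derive1n 1 psi x) (derive1n 2 psi x) (derive1n 3 psi x) => *; ring.
    - exists a, b; split => // x xab.
      by rewrite !psi0// !mulr0 subrr.
  have iV := test_integrable ll 3 cV tpsi.
  have iG := test_integrable ll 3 cG2 tpsi.
  have iQ := test_integrable ll 1 cP tpsi.
  move: I; rewrite RintegralB; [|exact: measurable_itv|exact: iG|exact: iQ].
  move=> /eqP; rewrite subr_eq0 => /eqP I.
  have -> : \int[mu]_(x in `]- l, l[%classic) ((V x + G2 x) * derive1n 3 psi x) =
      \int[mu]_(x in `]- l, l[%classic) (V x * derive1n 3 psi x + G2 x * derive1n 3 psi x).
    by apply: eq_Rintegral => x _; rewrite mulrDl.
  rewrite RintegralD; [|exact: measurable_itv|exact: iV|exact: iG].
  rewrite I (wV _ tpsi).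
  have -> : \int[mu]_(x in `]- l, l[%classic) (V x `^ m * derive1n 1 psi x) =
      \int[mu]_(x in `]- l, l[%classic) (pospow m (V x) * derive1n 1 psi x).
    by apply: eq_Rintegral => x _; rewrite pospowE.
  by rewrite addNr.
exists (2 * c2), (fun x => c0 + c1 * x + c2 * x ^+ 2 - G2 x),
  (fun x => c1 + 2 * c2 * x - G1 x).
have dx x := is_derive_id x (1 : R).
split=> [|x|x|x xl].
- apply: continuous_sub => //; apply: continuous_add; first exact: continuous_cst.
  by apply: continuous_mul; [exact: continuous_cst|exact: continuous_idfun].
- have d1 := is_derive1_add (is_derive_cst c0 x (1 : R)) (is_derive1_mull c1 (dx x)).
  have d2 := is_derive1_mull c2 (is_derive1_pow 2 (dx x)).
  apply: (is_derive_eq (is_derive1_sub (is_derive1_add d1 d2) (dG2 x))).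
  by rewrite /=; ring.
- have d1 := is_derive1_add (is_derive_cst c1 x (1 : R)) (is_derive1_mull (2 * c2) (dx x)).
  apply: (is_derive_eq (is_derive1_sub d1 (dG1 x))).
  by rewrite /=; ring.
- by rewrite -cE ?addrK// -ltr_norml.
Qed.

(** The difference quotients from the left vanish. This is used at the edge of the support, where
    [V] and [F] agree only on the inner side. *)
Lemma is_derive_cst_left f x e d c : 0 < e -> (forall y, x - e < y <= x -> f y = c) ->
  is_derive x 1 f d -> d = 0.
Proof.
move=> e0 fc fd; apply/eqP; apply: contraT => d0.
have fdr : derivable f x 1 by exact: ex_derive.
have : \forall h \near 0^', `|d - h^-1 *: (f (h *: 1 + x) - f x)| < `|d|.
  have /cvgrPdist_lt H : h^-1 *: (f (h *: 1 + x) - f x) @[h --> 0^'] --> d.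
    by rewrite -(derive_val (df := d)); exact: fdr.
  by apply: H; rewrite normr_gt0.
move=> [r /= r0 H]; pose h := - (Num.min r e / 2).
have me : 0 < Num.min r e by rewrite lt_min r0.
have mr : Num.min r e <= r by rewrite ge_min lexx.
have mre : Num.min r e <= e by rewrite ge_min lexx orbT.
have := H h; rewrite !fc; last 2 first.
- by rewrite lexx andbT; lra.
- by rewrite [_ *: _]mulr1 /h; lra.
rewrite subrr scaler0 subr0 ltxx => /(_ _ _); apply.
  by rewrite /ball_/= sub0r /h opprK gtr0_norm; lra.
by rewrite /h oppr_eq0 gt_eqF//; lra.
Qed.

End SteadyRegularity.

(** * Classification of the steady states *)

Section SteadyClassification.
Context {R : realType}.
Local Notation mu := (@lebesgue_measure R).
Variable m : R.
Hypothesis m_gt0 : 0 < m.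
Implicit Types (x y z c s a b d e M : R).
Local Notation W := (W m).
Local Notation pospow := (pospow m).
Local Notation phi := (phi m).

Lemma is_derive_mul_pospow s : 0 < s ->
  is_derive s 1 (fun s => s * pospow s) ((m + 1) * pospow s).
Proof.
move=> s0; have ds := is_derive_id s (1 : R).
apply: (is_derive_eq (is_derive1_mul ds (is_derive_pospow m s0))).
rewrite (pospowE m (ltW s0)) mulrCA mulr_powRB1 ?(ltW s0)//; ring.
Qed.

Section FirstIntegral.
Variables (V F p : R -> R) (alpha l : R).
Hypothesis cV : continuous V.
Hypothesis radV : radially_decreasing V.
Hypothesis V_ge0 : forall x, 0 <= V x.
Hypothesis l_gt0 : 0 < l.
Hypothesis V_gt0 : forall x, (0 < V x) = (`|x| < l).
Hypothesis cp : continuous p.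
Hypothesis dF : forall x, is_derive x 1 F (p x).
Hypothesis dp : forall x, is_derive x 1 p (alpha - pospow (V x)).
Hypothesis VF : forall x, `|x| < l -> V x = F x.
Hypothesis dVl : is_derive l 1 V 0.

Local Notation A := (V 0).
Local Notation k := (rate m A).

Let A_gt0 : 0 < A. Proof. by rewrite V_gt0 normr0. Qed.

Let k_gt0 : 0 < k. Proof. exact: rate_gt0. Qed.

Let cF : continuous F. Proof. by move=> x; exact: is_derive1_continuous (dF x). Qed.

Lemma steady_out x : l <= `|x| -> V x = 0.
Proof. by move=> lx; apply/eqP; rewrite eq_le V_ge0 andbT leNgt V_gt0 -leNgt. Qed.

Lemma steady_closed_eq x : `|x| <= l -> V x = F x.
Proof.
move=> xl; pose Z := (fun x => V x - F x) @^-1` [set 0].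
have cZ : closed Z.
  apply: preimage_closed; first by move=> y _; apply: (continuous_sub cV cF).
  exact: closed_eq.
have : closure `]- l, l[%classic `<=` Z.
  rewrite [X in _ `<=` X](closure_id _).1//; apply: closureS => y.
  by rewrite /= in_itv/= -ltr_norml => /VF yl; rewrite /Z/= yl subrr.
rewrite closure_symmetric_itv// => /(_ x).
rewrite /= in_itv/= -ler_norml => /(_ xl) /eqP.
by rewrite subr_eq0 => /eqP.
Qed.

Lemma is_derive_steady x : `|x| < l -> is_derive x 1 V (p x).
Proof.
move=> xl; apply: near_is_derive1 (dF x).
near=> y; apply/esym/VF; near: y; apply: (cvgr_lt `|x|) xl; apply: cvg_norm; exact: cvg_id.
Unshelve. all: by end_near. Qed.

Lemma steady_slope0 : p 0 = 0.
Proof.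
have d0 : is_derive (0 : R) 1 V (p 0) by apply: is_derive_steady; rewrite normr0.
have dN : is_derive (0 : R) 1 (fun x => V (- x)) (- p 0).
  have di : is_derive (0 : R) 1 (fun x => - x) (- 1).
    exact: is_derive1_opp (is_derive_id (0 : R) (1 : R)).
  have dn : is_derive (- (0 : R)) 1 V (p 0) by rewrite oppr0.
  by apply: (is_derive_eq (is_derive1_chain di dn)); rewrite mulrN1.
have VN : (fun x => V (- x)) = V by apply/funext => x; case: radV.
rewrite VN in dN.
have := derive1_is_derive dN; rewrite (derive1_is_derive d0) => H.
by lra.
Qed.

(** The contact angle enters here: [V] has derivative zero at [l], and [V - F] is zero to the left
    of [l]. *)
Lemma steady_slope_edge : p l = 0.
Proof.
have d : is_derive l 1 (fun x => V x - F x) (0 - p l) by exact: is_derive1_sub.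
have : 0 - p l = 0.
  apply: (is_derive_cst_left (c := 0) l_gt0 _ d) => y /andP[ly yl].
  by rewrite steady_closed_eq ?subrr// ger0_norm//; lra.
by rewrite sub0r => /eqP; rewrite oppr_eq0 => /eqP.
Qed.

(** The energy [p^2 - 2 alpha F + 2 / (m + 1) F^(m+1)] is constant along [F'' = alpha - F^m], and it
    is zero at the edge, where both [F] and [p] vanish. *)
Lemma steady_first_integral x : 0 <= x < l ->
  p x ^+ 2 = 2 * alpha * V x - 2 / (m + 1) * (V x * pospow (V x)).
Proof.
move=> /andP[x0 xl]; have m1 : 0 < m + 1 by rewrite addr_gt0.
pose E y := p y ^+ 2 - 2 * alpha * F y + 2 / (m + 1) * (F y * pospow (F y)).
have cE : continuous E.
  apply: continuous_add; first apply: continuous_sub.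
  - exact: continuous_mul.
  - by apply: continuous_mul => //; exact: continuous_cst.
  - apply: continuous_mul; first exact: continuous_cst.
    by apply: continuous_mul => //; apply: continuous_compose => //; exact: pospow_continuous.
have [t /andP[xt tl]|t _|t _ H] := @mean_value _ E (fun=> 0) x l xl.
- have tl' : `|t| < l by rewrite ger0_norm//; lra.
  have Ft : 0 < F t by rewrite -VF// V_gt0.
  have d1 := is_derive1_pow 2 (dp t).
  have d2 := is_derive1_mull (2 * alpha) (dF t).
  have d3 := is_derive1_mull (2 / (m + 1))
    (is_derive1_chain (dF t) (is_derive_mul_pospow Ft)).
  apply: (is_derive_eq (is_derive1_add (is_derive1_sub d1 d2) d3)).
  by rewrite VF//=; field; rewrite gt_eqF.
- exact: cE.
have lF : F l = 0.
  by rewrite -steady_closed_eq ?ger0_norm ?(ltW l_gt0)// steady_out// ger0_norm// ltW.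
have : E l = 0.
  by rewrite /E steady_slope_edge lF !mul0r !mulr0 expr0n/= subrr addr0.
have xl' : `|x| < l by rewrite ger0_norm.
move: H; rewrite mul0r => /eqP; rewrite subr_eq0 => /eqP -> ; rewrite /E -VF//.
by move=> H; apply/eqP; rewrite -subr_eq0 -H; apply/eqP; ring.
Qed.

Lemma steady_alpha : alpha = A `^ m / (m + 1).
Proof.
have m1 : 0 < m + 1 by rewrite addr_gt0.
have := steady_first_integral (x := 0); rewrite lexx l_gt0 => /(_ isT).
rewrite steady_slope0 expr0n/= (pospowE m (ltW A_gt0)) => H.
apply: (mulfI (lt0r_neq0 A_gt0)); apply: (@mulfI _ 2); first by rewrite pnatr_eq0.
transitivity (2 / (m + 1) * (A * A `^ m)); last by ring.
by apply/eqP; rewrite -subr_eq0 [X in _ == X]H; apply/eqP; ring.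
Qed.

Lemma steady_ratio_01 x : 0 <= A^-1 * V x <= 1.
Proof.
rewrite mulr_ge0 ?invr_ge0 ?(ltW A_gt0)//= ler_pdivrMl// mulr1.
by have [_] := radV; apply; rewrite normr0.
Qed.

Lemma steady_slope_sqr x : 0 <= x < l ->
  p x ^+ 2 = (A * k * W (A^-1 * V x)) ^+ 2.
Proof.
move=> xl; rewrite steady_first_integral//.
have -> : (A * k * W (A^-1 * V x)) ^+ 2 = A ^+ 2 * k ^+ 2 * W (A^-1 * V x) ^+ 2.
  by ring.
rewrite W_sqr ?steady_ratio_01//.
set s := A^-1 * V x; have s0 : 0 <= s by have /andP[] := steady_ratio_01 x.
have -> : V x = A * s by rewrite /s mulrA mulfV ?mul1r// gt_eqF.
rewrite pospowM ?(ltW A_gt0)// steady_alpha.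
have -> : A ^+ 2 * k ^+ 2 = A * (A * k ^+ 2) by ring.
rewrite rate_sqr_amplitude//; field.
by rewrite gt_eqF// addr_gt0.
Qed.

(** A positive slope would make [V] increase to the right of [x], against radial monotonicity. This
    selects the square root in the first integral. *)
Lemma steady_slope_le0 x : 0 <= x < l -> p x <= 0.
Proof.
move=> /andP[x0 xl]; rewrite leNgt; apply/negP => px.
have : \forall y \near x, 0 < p y.
  exact: (cvgr_gt (p x) (@cp x) _ px).
move=> /nbhs_ballP[e /= e0 eB].
pose d := Num.min e (l - x) / 2.
have me : 0 < Num.min e (l - x) by rewrite lt_min e0 subr_gt0.
have m1 : Num.min e (l - x) <= e by rewrite ge_min lexx.
have m2 : Num.min e (l - x) <= l - x by rewrite ge_min lexx orbT.
have d0 : 0 < d by rewrite /d; lra.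
have de : d < e by rewrite /d; lra.
have dl : d < l - x by rewrite /d; lra.
clearbody d.
have [|t _|t /andP[xt td] H] := @mean_value _ F p x (x + d).
- by lra.
- exact: cF.
have pt : 0 < p t by apply: eB; rewrite /ball/= ltr_norml; lra.
have : 0 < F (x + d) - F x by rewrite H mulr_gt0//; lra.
rewrite -!VF ?ger0_norm//; [|lra..].
rewrite subr_gt0 ltNge => /negP; apply; have [_] := radV; apply.
by rewrite !ger0_norm//; lra.
Qed.

Lemma steady_slope x : 0 <= x < l -> p x = - (A * k * W (A^-1 * V x)).
Proof.
move=> xl; have := steady_slope_sqr xl; rewrite -[LHS]sqrrN => /eqP.
rewrite eqrXn2 ?oppr_ge0 ?steady_slope_le0//.
  by move=> /eqP <-; rewrite opprK.
by rewrite mulr_ge0 ?W_ge0// mulr_ge0 ?(ltW A_gt0) ?(ltW k_gt0).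
Qed.

Lemma steady_ratio_ode x : 0 < x ->
  is_derive x 1 (fun x => A^-1 * V x) (- (k * W (A^-1 * V x))).
Proof.
move=> x0; have [xl|lx|xl] := ltgtP x l.
- have dV : is_derive x 1 V (p x) by apply: is_derive_steady; rewrite gtr0_norm.
  apply: (is_derive_eq (is_derive1_mull A^-1 dV)).
  by rewrite steady_slope ?(ltW x0)//; field; rewrite gt_eqF.
- rewrite (steady_out (x := x)) ?gtr0_norm ?(ltW lx)// mulr0 (W0 m_gt0) mulr0 oppr0.
  apply: (@near_is_derive1 _ (cst 0)).
  near=> y; have ly : l < y by near: y; exact: open_gt.
  rewrite (steady_out (x := y)) ?mulr0//.
  by rewrite gtr0_norm ?(lt_trans l_gt0)// ltW.
- rewrite xl (steady_out (x := l)) ?gtr0_norm// mulr0 (W0 m_gt0) mulr0 oppr0.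
  by apply: (is_derive_eq (is_derive1_mull A^-1 dVl)); rewrite mulr0.
Unshelve. all: by end_near. Qed.

(** On a plateau the second derivative is zero, whereas the equation gives it the value
    [alpha - A^m = - m A^m / (m + 1)]. *)
Lemma steady_no_plateau c : 0 < c -> ~ (forall x, 0 <= x <= c -> V x = A).
Proof.
move=> c0 pl.
have mp : 0 < Num.min c l by rewrite lt_min c0.
have m1 : Num.min c l <= c by rewrite ge_min lexx.
have m2 : Num.min c l <= l by rewrite ge_min lexx orbT.
pose y := Num.min c l / 2.
have y0 : 0 < y by rewrite /y; lra.
have yc : y < c by rewrite /y; lra.
have yl : y < l by rewrite /y; lra.
clearbody y.
have d0 : is_derive y 1 p 0.
  apply: (@near_is_derive1 _ (cst 0)); near=> z.
  have z0 : 0 < z by near: z; exact: open_gt.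
  have zc : z < c by near: z; exact: lt_nbhsl.
  have zl : z < l by near: z; exact: lt_nbhsl.
  rewrite steady_slope ?(ltW z0)// pl ?(ltW z0) ?(ltW zc)//.
  by rewrite mulVf ?gt_eqF// (W1 m_gt0) mulr0 oppr0.
have := derive1_is_derive (dp y); rewrite (derive1_is_derive d0).
rewrite pl ?(ltW y0) ?(ltW yc)// steady_alpha (pospowE m (ltW A_gt0)).
have Am : 0 < A `^ m by rewrite powR_gt0.
have -> : A `^ m / (m + 1) - A `^ m = - (A `^ m * (m / (m + 1))).
  by field; rewrite gt_eqF// addr_gt0.
move=> /esym/eqP; rewrite oppr_eq0 gt_eqF// mulr_gt0// divr_gt0// addr_gt0//.
Unshelve. all: by end_near. Qed.

(** [V / A] solves the equation of [ode_right] to the right of its maximum, the edge and the zero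
    set included; no waiting time is possible, and evenness gives the left half. *)
Lemma steady_is_profile : V = profile m A k.
Proof.
pose h x := A^-1 * V x.
have ch : continuous h by apply: continuous_mul => //; exact: continuous_cst.
have h0 : h 0 = 1 by rewrite /h mulVf// gt_eqF.
have hl : h l < 1 by rewrite /h (steady_out (x := l)) ?mulr0// gtr0_norm.
have [c [c0 pl hE]] := ode_right m_gt0 k_gt0 ch steady_ratio_01 h0 steady_ratio_ode
  (ltW l_gt0) hl.
have hV x : h x = 1 -> V x = A.
  by rewrite /h => H; rewrite -[RHS]mulr1 -H mulrA mulfV ?mul1r// gt_eqF.
have cz : c = 0.
  apply/eqP; rewrite eq_le c0 andbT leNgt; apply/negP => cp'.
  by apply: (steady_no_plateau cp') => x /pl /hV.
have VE x : 0 <= x -> V x = A * phi (k * x).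
  move=> x0; have := hE x; rewrite cz => /(_ x0); rewrite subr0 /h => <-.
  by rewrite mulrA mulfV ?mul1r// gt_eqF.
apply/funext => x; rewrite /profile; have [x0|x0] := leP 0 x; first exact: VE.
have [<- _] := radV; rewrite VE ?oppr_ge0 ?(ltW x0)// mulrN.
by rewrite phi_even.
Qed.

End FirstIntegral.

Lemma steady_state_profile M V : 0 < M -> steady_state m M V ->
  radially_decreasing V -> bounded_support V -> zero_contact_angle V ->
  exists A, [/\ 0 < A, V = profile m A (rate m A) &
    M = A / rate m A * phi_mass m].
Proof.
move=> M0 sV radV bV zV; have cV := steady_continuous sV.
have V0 := steady_ge0 sV.
have A0 : 0 < V 0.
  rewrite lt0r V0 andbT; apply/eqP => z0.
  have Vz x : V x = 0.
    apply/eqP; rewrite eq_le V0 andbT -z0; have [_] := radV; apply.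
    by rewrite normr0.
  move: M0; rewrite -(steady_mass sV).
  have -> : \int[mu]_(x in setT) V x = \int[mu]_(x in setT) (0 : R).
    by apply: eq_Rintegral => x _; rewrite Vz.
  by rewrite /Rintegral integral0 ltxx.
have [l l0 OE] := radial_positivity_set cV radV bV A0.
have [v [w [wv _ lw w3 eqV]]] := steady_eq sV.
have wE := steady_weak_equation cV l0 OE wv lw w3 eqV.
have [alpha [F [p [cp dF dp VF]]]] := steady_profile_ode m_gt0 cV V0 l0 wE.
have V_gt0 x : (0 < V x) = (`|x| < l).
  have E : positivity_set V x = `]- l, l[%classic x by rewrite OE.
  by rewrite ltr_norml; apply/idP/idP; move: E;
    rewrite /positivity_set /= in_itv/= => ->.
have dVl : is_derive l 1 V 0.
  by apply: zV; rewrite OE; apply/boundary_symmetric_itv => //; rewrite gtr0_norm.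
have VE := steady_is_profile cV radV V0 l0 V_gt0 cp dF dp VF dVl.
exists (V 0); split => //.
by rewrite -(steady_mass sV) {1}VE profile_mass// rate_gt0.
Qed.

End SteadyClassification.

(** * Mass classes and the critical family *)

Section Critical.
Context {R : realType}.
Local Notation mu := (@lebesgue_measure R).
Implicit Types (u : R -> R) (x y A B k c M : R).

Lemma profile_mass_class m A k : 0 < m -> 0 < A -> 0 < k ->
  mass_class (A / k * phi_mass m) (profile m A k).
Proof.
move=> m0 A0 k0; have cU := @profile_continuous _ _ m0 A k.
split.
- exact: profile_Lfun.
- exact: profile_H1.
- by apply: nearW; exact: profile_ge0.
- have mU : measurable_fun setT (profile m A k) by exact: continuous_measurable_fun.
  rewrite (@sz_nagy_Lnorm1 _ _ (profile m A k))//.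
  + by rewrite profile_mass.
  + exact: profile_ge0.
  + exact: ae_eq_refl.
  + by have [_ _ _ iU _] := admissible_profile m0 A0 k0.
Qed.

Lemma profile_power_norm m A k : 0 < m -> 0 < A -> 0 < k ->
  ('N[mu]_((m + 1)%:E)[EFin \o profile m A k] =
     ((A `^ (m + 1) / k * phi_power m) `^ (m + 1)^-1)%:E)%E.
Proof.
move=> m0 A0 k0; have cU := @profile_continuous _ _ m0 A k.
have mU : measurable_fun setT (profile m A k) by exact: continuous_measurable_fun.
have E : profile m A k = (fun x => profile m A k (x - 0)) %[ae mu].
  by apply: nearW => x _; rewrite subr0.
by have [_ ->] := optimizer_norms m0 A0 k0 mU E.
Qed.

Lemma optimizer_mass_class m M u : 0 < m -> mass_class M u ->
  sz_nagy_optimizer m u ->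
  exists A k c, [/\ 0 < A, 0 < k,
    u = (fun x => profile m A k (x - c)) %[ae mu], M = A / k * phi_mass m &
    ('N[mu]_((m + 1)%:E)[EFin \o u] =
     ((A `^ (m + 1) / k * phi_power m) `^ (m + 1)^-1)%:E)%E].
Proof.
move=> m0 [u1 _ _ uM] /(optimizer_profile m0)[A [k [c [A0 k0 uE]]]].
have [N1 Np] := optimizer_norms m0 A0 k0 (Lfun_measurable u1) uE.
exists A, k, c; split => //.
by move: uM; rewrite N1 => -[->].
Qed.

Lemma centred_critical_optimizersP u : centred_critical_optimizers u <->
  exists2 A, 0 < A & u = profile 3 A (rate 3 A).
Proof.
have m0 : 0 < 3 :> R by [].
split=> [[uM uo cu [uev udec]]|[A A0 ->]].
  have [A [k [c [A0 k0 uE ME _]]]] := optimizer_mass_class m0 uM uo.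
  have kE : k = rate 3 A by apply/(critical_ratio m0 erefl A0 k0).
  have {}uE : u = fun x => profile 3 A k (x - c).
    apply: continuous_ae_eq uE => //.
    by apply: translate_continuous; exact: profile_continuous.
  exists A => //; rewrite -kE.
  suff c0 : c = 0 by apply/funext => x; rewrite uE c0 subr0.
  (* The maximum [A] is attained at [c], while a profile centred elsewhere than at [0] is below [A]
     at [0]; radial monotonicity demands [u c <= u 0]. *)
  apply/eqP; apply: contraT => c0.
  have : u c <= u 0 by apply: udec; rewrite normr0.
  rewrite uE subrr sub0r /profile mulr0 phi0// ler_pM2l// leNgt.
  by rewrite phi_lt1// mulf_neq0 ?oppr_eq0// gt_eqF.
have k0 := rate_gt0 m0 A0.
have ME : A / rate 3 A * phi_mass 3 = critical_mass by apply/critical_ratio.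
split.
- by rewrite -ME; exact: profile_mass_class.
- exact: profile_optimizer.
- exact: profile_continuous.
- exact: profile_radially_decreasing.
Qed.

(** Amplitude and dilation are proportional for [m = 3], so the mass-invariant scaling of one
    critical profile runs through all of them. *)
Lemma rate3 A : 0 < A -> rate 3 A = rate 3 1 * A.
Proof.
move=> A0; have m0 : 0 < 3 :> R by [].
have r1 : 0 < rate 3 (1 : R) by exact: rate_gt0.
apply/esym/critical_ratio => //; first exact: mulr_gt0.
rewrite -(critical_ratio m0 erefl ltr01 r1).2//.
by congr (_ * _); field; rewrite !gt_eqF.
Qed.

Lemma infinite_centred_critical_optimizers :
  infinite_set (@centred_critical_optimizers R).
Proof.
pose f (n : nat) : R -> R := profile 3 n.+1%:R (rate 3 n.+1%:R).
have fS : f @` setT `<=` @centred_critical_optimizers R.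
  by move=> _ [n _ <-]; apply/centred_critical_optimizersP; exists n.+1%:R.
move=> /(sub_finite_set fS); rewrite (@eq_finite_set _ _ _ [set: nat]).
  exact: infinite_nat.
apply: inj_card_eq => i j _ _ /(congr1 (fun u => u 0)).
rewrite /f /profile !mulr0 !phi0// !mulr1 => /eqP.
by rewrite eqr_nat eqSS => /eqP.
Qed.

End Critical.

Theorem theorem1p2 (R : realType) (m : R) (m_gt0 : 0 < m) :
  (m != 3 -> forall M : R, 0 < M ->
    exists U : R -> R,
      [/\ mass_norm_class m M U,
          sz_nagy_optimizer m U &
          forall u : R -> R, mass_norm_class m M u -> sz_nagy_optimizer m u ->
            exists a : R,
              u = (fun x => U (x - a)) %[ae @lebesgue_measure R]]
      /\
      [/\ steady_state m M U, radially_decreasing U, bounded_support U,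
          zero_contact_angle U &
          forall V : R -> R, steady_state m M V -> radially_decreasing V ->
            bounded_support V -> zero_contact_angle V -> V = U])
  /\
  (m = 3 ->
    [/\ sz_nagy_constant m = 9 / (4 * pi ^+ 2),
        infinite_set (@centred_critical_optimizers R),
        forall u : R -> R, centred_critical_optimizers u ->
          steady_state m critical_mass u,
        forall u : R -> R, mass_class critical_mass u -> sz_nagy_optimizer m u ->
          exists (v : R -> R) (a : R), centred_critical_optimizers v /\
            u = (fun x => v (x - a)) %[ae @lebesgue_measure R] &
        exists V : R -> R,
          centred_critical_optimizers =
          [set mass_scaling k V | k in [set k : R | 0 < k]]]).
Proof.
split=> [m3 M M0|m3].
  have [A A0 AM] := amplitude_exists m_gt0 m3 M0.
  have k0 := rate_gt0 m_gt0 A0.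
  exists (profile m A (rate m A)); split; split.
  - split; first by rewrite -AM; exact: profile_mass_class.
    rewrite profile_power_norm// -AM; congr (_%:E).
    by apply/critical_normP => //; exact: rate_sqr.
  - exact: profile_optimizer.
  - move=> u [uM uP] uo.
    have [B [k [c [B0 k0' uE ME PE]]]] := optimizer_mass_class m_gt0 uM uo.
    (* The prescribed norm fixes the dilation in terms of the amplitude; the prescribed mass then
       fixes the amplitude. *)
    exists c; have kE : k = rate m B.
      apply: rateP => //; apply/(critical_normP m_gt0) => //.
      by rewrite -ME; move: uP; rewrite PE => -[].
    suff -> : A = B by rewrite -kE.
    by apply: (amplitude_inj m_gt0) => //; rewrite AM ME kE.
  - by rewrite -AM; exact: profile_steady_state.
  - exact: profile_radially_decreasing.
  - exact: profile_bounded_support.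
  - exact: profile_zero_contact_angle.
  - move=> V sV rV bV zV.
    have [B [B0 -> ME]] := steady_state_profile m_gt0 M0 sV rV bV zV.
    suff -> : A = B by [].
    by apply: (amplitude_inj m_gt0) => //; rewrite AM.
subst m; split.
- rewrite sz_nagy_constantE// sharp_constant3// phi_mass3//.
  by move: (@pi_gt0 R); move: (@pi R) => c c0; field; rewrite gt_eqF.
- exact: infinite_centred_critical_optimizers.
- move=> u /centred_critical_optimizersP[A A0 ->].
  rewrite -((critical_ratio m_gt0 erefl A0 (rate_gt0 m_gt0 A0)).2 erefl).
  exact: profile_steady_state.
- move=> u uM uo.
  have [A [k [c [A0 k0 uE ME _]]]] := optimizer_mass_class m_gt0 uM uo.
  have kE : k = rate 3 A by apply/(critical_ratio m_gt0 erefl A0 k0).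
  exists (profile 3 A k), c; split => //.
  by apply/centred_critical_optimizersP; exists A; rewrite ?kE.
(* The member of height [1] generates the family: scaling by [A] produces the member of height
   [A]. *)
- exists (profile 3 1 (rate 3 1)); apply/seteqP.
  have sE A : 0 < A -> mass_scaling A (profile 3 1 (rate 3 1)) = profile 3 A (rate 3 A).
    move=> A0; apply/funext => x.
    by rewrite /mass_scaling /profile mul1r (rate3 A0) mulrA.
  split=> [u /centred_critical_optimizersP[A A0 ->]|u [A /= A0 <-]].
    by exists A => //; rewrite sE.
  by rewrite sE//; apply/centred_critical_optimizersP; exists A.
Qed.
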